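(* Let $\Omega$ be a connected Stein manifold, let $\varphi:\Omega\to\Omega$ be holomorphic, and let $(n_l)_{l\in\mathbb{N}}$ be an increasing sequence of natural numbers. Then: (1) The operator $C_\varphi$ is hypercyclic with respect to $(n_l)_l$ if and only if $\varphi$ is injective, $\varphi(\Omega)$ is a Runge domain with respect to $\Omega$, and for every $\Omega$-convex compact subset $K\subset\Omega$ there is $l\in\mathbb{N}$ such that the sets $K$ and $\varphi^{[n_l]}(K)$ are separable in $\Omega$. (2) The operator $C_\varphi$ is hereditarily hypercyclic with respect to $(n_l)_l$ if and only if $\varphi$ is injective, $\varphi(\Omega)$ is a Runge domain with respect to $\Omega$, and for every $\Omega$-convex compact subset $K\subset\Omega$ there exists $l_0$ such that for each $l\geq l_0$ the sets $K$ and $\varphi^{[n_l]}(K)$ are separable in $\Omega$.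
   Context: A Stein manifold is a complex analytic manifold $\Omega$ of finite dimension $N$ such that: $\Omega$ has an exhaustion by compact sets $K_l$ with $K_l\subset\operatorname{int}K_{l+1}$ and $\bigcup_l K_l=\Omega$; the holomorphic hull of every compact set is compact; holomorphic functions on $\Omega$ separate points; and for each $z\in\Omega$ some holomorphic map $F:\Omega\to\mathbb{C}^N$ has invertible derivative at $z$. $\mathcal{O}(\Omega)$ is the space of holomorphic functions $\Omega\to\mathbb{C}$ with the topology of uniform convergence on compact sets. $C_\varphi:\mathcal{O}(\Omega)\to\mathcal{O}(\Omega)$ is $C_\varphi(f)=f\circ\varphi$. For a self-map $T$, $T^{[n]}$ denotes its $n$-th iterate. ''Increasing'' means strictly increasing. For compact $K\subset\Omega$ the holomorphic hull is $\widehat{K}_\Omega=\{z\in\Omega: |f(z)|\le\sup_K|f| \text{ for every } f\in\mathcal{O}(\Omega)\}$; a compact set $K$ is called $\Omega$-convex if $K=\widehat{K}_\Omega$. For $\Omega=\mathbb{C}$ the hull (polynomial hull) is denoted $\widehat{K}$. Compact sets $K,L\subset\Omega$ are separable in $\Omega$ if there is $F\in\mathcal{O}(\Omega)$ with $\widehat{F(K)}\cap\widehat{F(L)}=\varnothing$ (polynomial hulls in $\mathbb{C}$). A domain $U\subset\Omega$ is a Runge domain with respect to $\Omega$ if every function in $\mathcal{O}(U)$ can be approximated locally uniformly on $U$ by functions from $\mathcal{O}(\Omega)$. A sequence $(T_l)_l$ of continuous self-maps of a topological space $X$ is universal if there is $x\in X$ with $\{T_l(x): l\in\mathbb{N}\}$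 dense in $X$; it is hereditarily universal if each of its subsequences is universal. A continuous linear operator $T$ on a topological vector space is hypercyclic (resp. hereditarily hypercyclic) with respect to $(n_l)_l$ if $(T^{[n_l]})_l$ is universal (resp. hereditarily universal). *)

(* Defs.v *)
From mathcomp Require Import all_boot all_order all_algebra.
From mathcomp Require Import all_classical all_reals all_analysis.
From mathcomp Require Export complex.

Set Implicit Arguments.
Unset Strict Implicit.
Unset Printing Implicit Defensive.

Import Order.TTheory GRing.Theory Num.Theory.
Import numFieldNormedType.Exports.

Local Open Scope classical_set_scope.
Local Open Scope ring_scope.

(* [R[i]] has no topology of its own in the library; as a [numFieldType] it
   receives the topology and the normed module structure over itself. *)
Definition Cplx (R : realType) : numFieldType := R[i].

Definition cnorm (R : realType) (z : Cplx R) : R := ComplexField.Normc.normc z.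

(* [chart_map] and [chart_inv] are total; they are only meaningful on
   [chart_dom] and its image, which are open, so that continuity there is
   continuity at each point. *)
Record chart (R : realType) (N : nat) (M : topologicalType) := Chart {
  chart_dom : set M ;
  chart_map :> M -> 'rV[Cplx R]_N ;
  chart_inv : 'rV[Cplx R]_N -> M ;
  chart_dom_open : open chart_dom ;
  chart_cod_open : open (chart_map @` chart_dom) ;
  chart_mapK : {in chart_dom, cancel chart_map chart_inv} ;
  chart_map_continuous :
    forall z, chart_dom z -> {for z, continuous chart_map} ;
  chart_inv_continuous :
    forall z, chart_dom z -> {for chart_map z, continuous chart_inv} }.

Record complexManifold (R : realType) (N : nat) := ComplexManifold {
  manifold_space :> topologicalType ;
  atlas : set (chart R N manifold_space) ;
  manifold_hausdorff : hausdorff_space manifold_space ;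
  atlas_cover : forall z, exists2 c, atlas c & chart_dom c z ;
  atlas_compatible : forall c d, atlas c -> atlas d ->
    forall z, chart_dom c z -> chart_dom d z ->
    differentiable (d \o chart_inv c) (c z) }.

(* For [U] open, [f] restricted to [U] is holomorphic; the values of [f]
   outside [U] are irrelevant. *)
Definition holomorphic_on (R : realType) (N : nat) (M : complexManifold R N)
    (V : normedModType (Cplx R)) (U : set M) (f : M -> V) : Prop :=
  forall c, atlas c -> forall z, U z -> chart_dom c z ->
    differentiable (f \o chart_inv c) (c z).

Definition holomorphic (R : realType) (N : nat) (M : complexManifold R N)
    (V : normedModType (Cplx R)) (f : M -> V) : Prop :=
  holomorphic_on setT f.

Definition holomorphic_map (R : realType) (N : nat)
    (M : complexManifold R N) (phi : M -> M) : Prop :=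
  continuous phi /\
  forall c d, atlas c -> atlas d ->
    forall z, chart_dom c z -> chart_dom d (phi z) ->
    differentiable (d \o phi \o chart_inv c) (c z).

Definition entire (R : realType) (f : Cplx R -> Cplx R) : Prop :=
  forall z, differentiable f z.

(* The supremum is taken in the extended reals, so the hull of the empty set
   is empty. *)
Definition hull (R : realType) (T : Type) (F : set (T -> Cplx R))
    (K : set T) : set T :=
  [set z | forall f, F f ->
    ((cnorm (f z))%:E <= ereal_sup [set (cnorm (f w))%:E | w in K])%E].

Definition holomorphic_hull (R : realType) (N : nat)
    (M : complexManifold R N) (K : set M) : set M :=
  hull [set f : M -> Cplx R | holomorphic f] K.

Definition polynomial_hull (R : realType) (K : set (Cplx R)) :
    set (Cplx R) :=
  hull [set f : Cplx R -> Cplx R | entire f] K.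

Definition convex_compact (R : realType) (N : nat)
    (M : complexManifold R N) (K : set M) : Prop :=
  compact K /\ K = holomorphic_hull K.

Definition separable (R : realType) (N : nat)
    (M : complexManifold R N) (K L : set M) : Prop :=
  exists2 F : M -> Cplx R, holomorphic F &
    polynomial_hull (F @` K) `&` polynomial_hull (F @` L) = set0.

Record stein (R : realType) (N : nat) (M : complexManifold R N) : Prop := {
  stein_exhaustion : exists K : nat -> set M,
    [/\ forall l, compact (K l),
        forall l, K l `<=` (K l.+1)° &
        \bigcup_l K l = setT] ;
  stein_hull : forall K : set M, compact K -> compact (holomorphic_hull K) ;
  stein_separates : forall z w : M, z <> w ->
    exists2 f : M -> Cplx R, holomorphic f & f z <> f w ;
  stein_coordinates : forall z : M,
    exists2 F : M -> 'rV[Cplx R]_N, holomorphic F &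
      forall c, atlas c -> chart_dom c z ->
        bijective ('d (F \o chart_inv c) (c z)) }.

Definition domain (T : topologicalType) (U : set T) : Prop :=
  open U /\ connected U.

Definition runge_domain (R : realType) (N : nat) (M : complexManifold R N)
    (U : set M) : Prop :=
  domain U /\
  forall f : M -> Cplx R, holomorphic_on U f ->
    forall K : set M, compact K -> K `<=` U -> forall e : R, 0 < e ->
    exists2 g : M -> Cplx R, holomorphic g &
      forall z, K z -> cnorm (f z - g z) < e.

(* The coercion from sets to types equips [holo M] with the topology induced
   by [{family compact, M -> Cplx R}], i.e. uniform convergence on compact
   sets. *)
Definition holo (R : realType) (N : nat) (M : complexManifold R N) :
    topologicalType :=
  [set f : {family compact, M -> Cplx R} | holomorphic (f : M -> Cplx R)].

Lemma near_eq_differentiable (K : numFieldType) (V W : normedModType K)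
    (f g : V -> W) (x : V) :
  (\forall y \near x, f y = g y) -> differentiable f x -> differentiable g x.
Proof.
move=> fg df; have fgx : f x = g x := nbhs_singleton fg.
have [dfc dff] := (diff_locallyP x f).1 df.
have dg : g \o shift x = cst (g x) + 'd f x +o_ 0 id.
  apply/eqaddoP => e e0; move/eqaddoP: dff => /(_ e e0) dff.
  have fg0 : \forall y \near 0, f (y + x) = g (y + x).
    by move: fg; rewrite (near_shift 0 x) => fg; near=> y;
      rewrite -[X in y + X]subr0; near: y.
  near=> y.
  have <- : (f \o shift x - (cst (f x) + 'd f x)) y
            = (g \o shift x - (cst (g x) + 'd f x)) y.
    rewrite !fctE -fgx; congr (_ - _); near: y; exact: fg0.
  by near: y.
apply/diff_locallyP; rewrite (diff_unique dfc dg); split => //.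
Unshelve. all: by end_near. Qed.

Lemma holomorphic_comp (R : realType) (N : nat) (M : complexManifold R N)
    (phi : M -> M) (f : M -> Cplx R) :
  holomorphic_map phi -> holomorphic f -> holomorphic (f \o phi).
Proof.
move=> [cphi hphi] hf c hc z _ zc.
have [d hd dz] := atlas_cover (phi z).
have cK : chart_inv c (c z) = z by apply: (chart_mapK (c := c)); exact/mem_set.
have h1 := hphi c d hc hd z zc dz.
have h2 : differentiable (f \o chart_inv d) ((d \o phi \o chart_inv c) (c z)).
  by rewrite /= cK; exact: hf.
have h3 := differentiable_comp h1 h2.
have near_eq : \forall x \near c z,
    (f \o chart_inv d) ((d \o phi \o chart_inv c) x)
    = (f \o phi \o chart_inv c) x.
  have cvg1 : (phi \o chart_inv c) @ c z --> phi z.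
    rewrite -[in X in _ --> X]cK.
    exact: (continuous_comp (chart_inv_continuous zc) (cphi _)).
  have := cvg1 _ (open_nbhs_nbhs (conj (chart_dom_open d) dz)).
  rewrite nbhs_simpl => near_d; apply: (@filterS _ (nbhs (c z)) _ _ _ _ near_d).
  move=> x /= hx.
  by congr f; apply: (chart_mapK (c := d)); exact/mem_set.
exact: near_eq_differentiable near_eq h3.
Qed.

Definition composition_operator (R : realType) (N : nat)
    (M : complexManifold R N) (phi : M -> M) (hphi : holomorphic_map phi)
    (f : holo M) : holo M :=
  SigSub (mem_set (holomorphic_comp hphi (set_mem (valP f)))).

Lemma composition_operatorE (R : realType) (N : nat)
    (M : complexManifold R N) (phi : M -> M) (hphi : holomorphic_map phi)
    (f : holo M) :
  set_val (composition_operator hphi f) = set_val f \o phi.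
Proof. by []. Qed.

Lemma composition_operator_continuous (R : realType) (N : nat)
    (M : complexManifold R N) (phi : M -> M) (hphi : holomorphic_map phi) :
  continuous (composition_operator hphi).
Proof.
apply: continuous_comp_initial => f.
have cval : (set_val : holo M -> {family compact, M -> Cplx R}) @ f
    --> (set_val f : {family compact, M -> Cplx R}).
  exact: initial_continuous.
have Ff : Filter (nbhs (f : holo M)) := nbhs_filter f.
apply/(@fam_cvgP _ _ _ _ _ (@fmap_filter _ _
  (set_val \o composition_operator hphi) _ Ff)) => K cK.
have cphiK : compact (phi @` K).
  by apply: continuous_compact => //; apply: continuous_subspaceT; exact: hphi.1.
move/(@fam_cvgP _ _ _ _ _ (@fmap_filter _ _ set_val _ Ff)): cval => /(_ _ cphiK) cval.
move=> P /uniform_nbhs [E [entE EP]].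
have /cval : nbhs (set_val f : {uniform` (phi @` K) -> Cplx R})
    [set h | forall y, (phi @` K) y -> E (set_val f y, h y)].
  by apply/uniform_nbhs; exists E; split.
rewrite /= !nbhs_simpl; apply: filterS => g Eg.
by apply: EP => y Ky; apply: Eg; exists y.
Qed.

Definition universal (X : topologicalType) (T : nat -> X -> X) : Prop :=
  exists x, dense [set T l x | l in setT].

Definition increasing (n : nat -> nat) : Prop :=
  forall i j, (i < j)%N -> (n i < n j)%N.

Definition hereditarily_universal (X : topologicalType)
    (T : nat -> X -> X) : Prop :=
  forall k : nat -> nat, increasing k -> universal (fun l => T (k l)).

Definition hypercyclic (X : topologicalType) (T : X -> X)
    (n : nat -> nat) : Prop :=
  universal (fun l => iter (n l) T).

Definition hereditarily_hypercyclic (X : topologicalType) (T : X -> X)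
    (n : nat -> nat) : Prop :=
  hereditarily_universal (fun l => iter (n l) T).

(* Main.v *)
(* Writing phi^k for iterates, universality means that one holomorphic F satisfies: for every
   holomorphic f, compact K and e > 0 some F o phi^(n_l) is e-close to f on K.

   Necessity. Approximating functions that separate points makes phi injective, hence locally
   biholomorphic by Osgood's theorem; composition with phi has dense range, and transporting
   functions by the inverse of phi shows that phi(Omega) is Runge. If F o phi^(n_l) is close on K to
   a constant exceeding |F| on K by 2, then F itself separates K from phi^(n_l)(K).

   Sufficiency. Injectivity and the Runge property make the range of composition with phi^k dense.
   If F separates K and phi^m(K), with X = F(K) and Y = F(phi^m(K)), there is an entire v close
   to 0 on X and to 1 on Y: a Cauchy integral of the indicator function of a neighbourhood of the
   hull of Y, over edges avoiding the hull of X u Y, where each kernel 1/(z - w) is approximable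
   since w lies outside that hull. Then f + (v o F)(G - f) is close to f on K and to G on
   phi^m(K), and a universal function is obtained by iterating this step along a dense sequence.

   Osgood's theorem goes by induction on the dimension: away from critical points one slices along
   a level set of a component; the Jacobian determinant J cannot vanish along a smooth
   hypersurface, so functions vanishing where J does have all their derivatives vanishing there
   too; hence J is flat at any of its zeros, thus vanishes nearby, and the map is locally constant. *)

Require Import Defs.
From HB Require Import structures.
From mathcomp Require Import all_boot all_order all_algebra.
From mathcomp Require Import all_classical all_reals all_analysis.
From mathcomp Require Import fingroup perm complex ring lra.

Set Implicit Arguments.
Unset Strict Implicit.
Unset Printing Implicit Defensive.

Import Order.TTheory GRing.Theory Num.Theory.
Import numFieldNormedType.Exports.

Local Open Scope classical_set_scope.
Local Open Scope ring_scope.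

(** * Complex numbers and real-valued norms *)

Section ComplexNumbers.
Variable R : realType.
Notation C := (Cplx R).

Definition rc (r : R) : C := (r%:C)%C.
Definition ci : C := ('i)%C.
Definition re (z : C) : R := complex.Re z.
Definition im (z : C) : R := complex.Im z.
(* The norm of a space over R[i] takes its values in R[i]; [nrm] is the same norm as a real number. *)
Definition nrm (V : normedZmodType C) (v : V) : R := re `|v|.

Lemma rc0 : rc 0 = 0. Proof. by []. Qed.
Lemma rc1 : rc 1 = 1. Proof. by []. Qed.
Lemma rcD x y : rc (x + y) = rc x + rc y. Proof. exact: (rmorphD (real_complex R)). Qed.
Lemma rcN x : rc (- x) = - rc x. Proof. exact: (rmorphN (real_complex R)). Qed.
Lemma rcB x y : rc (x - y) = rc x - rc y. Proof. exact: (rmorphB (real_complex R)). Qed.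
Lemma rcM x y : rc (x * y) = rc x * rc y. Proof. exact: (rmorphM (real_complex R)). Qed.
Lemma rcV x : rc x^-1 = (rc x)^-1. Proof. exact: (fmorphV (real_complex R)). Qed.
Lemma rcX x n : rc (x ^+ n) = rc x ^+ n. Proof. exact: (rmorphXn (real_complex R)). Qed.
Lemma rc_nat n : rc n%:R = n%:R. Proof. exact: (rmorph_nat (real_complex R)). Qed.
Lemma rc_inj : injective rc. Proof. by move=> x y []. Qed.
Lemma rc_eq0 x : (rc x == 0) = (x == 0).
Proof. by apply/eqP/eqP => [/(@rc_inj _ 0)|->]. Qed.

Lemma reD x y : re (x + y) = re x + re y. Proof. by case: x; case: y. Qed.
Lemma imD x y : im (x + y) = im x + im y. Proof. by case: x; case: y. Qed.
Lemma reN x : re (- x) = - re x. Proof. by case: x. Qed.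
Lemma imN x : im (- x) = - im x. Proof. by case: x. Qed.
Lemma reB x y : re (x - y) = re x - re y. Proof. by rewrite reD reN. Qed.
Lemma imB x y : im (x - y) = im x - im y. Proof. by rewrite imD imN. Qed.
Lemma reM x y : re (x * y) = re x * re y - im x * im y.
Proof. by case: x; case: y. Qed.
Lemma imM x y : im (x * y) = re x * im y + im x * re y.
Proof. by case: x; case: y. Qed.
Lemma re_rc x : re (rc x) = x. Proof. by []. Qed.
Lemma im_rc x : im (rc x) = 0. Proof. by []. Qed.
Lemma re_ci : re ci = 0. Proof. by []. Qed.
Lemma im_ci : im ci = 1. Proof. by []. Qed.
Lemma re0 : re 0 = 0. Proof. by []. Qed.
Lemma im0 : im 0 = 0. Proof. by []. Qed.
Lemma re1 : re 1 = 1. Proof. by []. Qed.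
Lemma im1 : im 1 = 0. Proof. by []. Qed.
Lemma crect z : z = rc (re z) + rc (im z) * ci.
Proof. by rewrite {1}[z]complexE mulrC. Qed.
Lemma c_eq x y : re x = re y -> im x = im y -> x = y.
Proof. by case: x => a b; case: y => c d /= -> ->. Qed.

Lemma normE (V : normedZmodType C) (v : V) : `|v| = rc (nrm v).
Proof.
have : `|v| >= 0 by [].
rewrite lecE /= => /andP[/eqP h _]; apply: c_eq => //.
Qed.

Lemma rc_le x y : (rc x <= rc y) = (x <= y).
Proof. by rewrite lecE /= eqxx. Qed.
Lemma rc_lt x y : (rc x < rc y) = (x < y).
Proof. by rewrite ltcE /= eqxx. Qed.
Lemma rc_gt0 x : (0 < rc x) = (0 < x).
Proof. by rewrite -rc0 rc_lt. Qed.
Lemma pos_rc (e : C) : 0 < e -> e = rc (re e) /\ 0 < re e.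
Proof.
by rewrite ltcE /= => /andP[/eqP h ?]; split => //; apply: c_eq => //=.
Qed.

Section norm.
Variable V : normedZmodType C.
Implicit Types v w : V.
Lemma nrm_ge0 v : 0 <= nrm v.
Proof. by rewrite -rc_le -normE rc0. Qed.
Lemma nrm0 : nrm (0 : V) = 0. Proof. by rewrite /nrm normr0. Qed.
Lemma nrm_eq0 v : (nrm v == 0) = (v == 0).
Proof. by rewrite -rc_eq0 -normE normr_eq0. Qed.
Lemma nrm_gt0 v : (0 < nrm v) = (v != 0).
Proof. by rewrite lt_def nrm_eq0 nrm_ge0 andbT. Qed.
Lemma nrmN v : nrm (- v) = nrm v. Proof. by rewrite /nrm normrN. Qed.
Lemma nrmC v w : nrm (v - w) = nrm (w - v). Proof. by rewrite -nrmN opprB. Qed.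
Lemma nrmD v w : nrm (v + w) <= nrm v + nrm w.
Proof. by rewrite -rc_le rcD -!normE ler_normD. Qed.
Lemma nrmB v w : nrm (v - w) <= nrm v + nrm w.
Proof. by rewrite -(nrmN w) nrmD. Qed.
Lemma nrm_tri u v w : nrm (u - w) <= nrm (u - v) + nrm (v - w).
Proof. by apply: le_trans (nrmD _ _); rewrite addrA subrK. Qed.
Lemma nrm_sub v w : nrm v - nrm w <= nrm (v - w).
Proof. by rewrite lerBlDr; apply: le_trans (nrmD _ _); rewrite subrK. Qed.
Lemma nrm_sum (I : Type) (r : seq I) (P : pred I) (F : I -> V) :
  nrm (\sum_(i <- r | P i) F i) <= \sum_(i <- r | P i) nrm (F i).
Proof.
elim/big_rec2: _ => [|i x y _ h]; first by rewrite nrm0.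
by apply: (le_trans (nrmD _ _)); rewrite lerD2l.
Qed.
Lemma nrm_lt_eps v : (forall e, 0 < e -> nrm v <= e) -> v = 0.
Proof.
move=> h; apply/eqP; rewrite -nrm_eq0; apply/eqP/le_anti.
by rewrite nrm_ge0 andbT; apply/ler_addgt0Pl => e /h; rewrite addr0.
Qed.
End norm.

Lemma nrmZ (V : normedModType C) (a : C) (v : V) : nrm (a *: v) = nrm a * nrm v.
Proof. by apply: rc_inj; rewrite rcM -!normE normrZ. Qed.
Lemma nrmM (x y : C) : nrm (x * y) = nrm x * nrm y.
Proof. by apply: rc_inj; rewrite rcM -!normE normrM. Qed.
Lemma nrmV (x : C) : nrm x^-1 = (nrm x)^-1.
Proof. by apply: rc_inj; rewrite rcV -!normE normfV. Qed.
Lemma nrmX (x : C) n : nrm (x ^+ n) = nrm x ^+ n.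
Proof. by apply: rc_inj; rewrite rcX -!normE normrX. Qed.
Lemma nrm1 : nrm (1 : C) = 1. Proof. by rewrite /nrm normr1. Qed.
Lemma nrm_cnorm (z : C) : nrm z = cnorm z.
Proof. by rewrite /nrm; have -> : `|z| = _ := normc_def z; case: z. Qed.
Lemma nrm_rc x : nrm (rc x) = `|x|.
Proof. by rewrite nrm_cnorm /cnorm /= expr0n /= addr0 sqrtr_sqr. Qed.
Lemma nrm_ci : nrm ci = 1.
Proof. by rewrite nrm_cnorm /cnorm /= expr0n /= add0r expr1n sqrtr1. Qed.
Lemma nrm_sqr (z : C) : nrm z ^+ 2 = re z ^+ 2 + im z ^+ 2.
Proof.
by rewrite nrm_cnorm; case: z => a b; rewrite /cnorm /= sqr_sqrtr // addr_ge0 ?sqr_ge0.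
Qed.
Lemma re_le (z : C) : `|re z| <= nrm z.
Proof. by rewrite nrm_cnorm; case: z => a b /=; rewrite -sqrtr_sqr ler_wsqrtr // lerDl sqr_ge0. Qed.
Lemma im_le (z : C) : `|im z| <= nrm z.
Proof. by rewrite nrm_cnorm; case: z => a b /=; rewrite -sqrtr_sqr ler_wsqrtr // lerDr sqr_ge0. Qed.
Lemma nrm_le_reim (z : C) : nrm z <= `|re z| + `|im z|.
Proof.
rewrite {1}[z]crect; apply: le_trans (nrmD _ _) _.
by rewrite nrmM !nrm_rc nrm_ci mulr1.
Qed.

Lemma nbhs_nrm (V : normedModType C) (x : V) (A : set V) :
  nbhs x A <-> exists2 e : R, 0 < e & forall y, nrm (y - x) < e -> A y.
Proof.
split=> [/nbhs_normP[e /= e0 h]|[e e0 h]].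
  have [ee re0] := pos_rc e0.
  exists (re e) => // y yx; apply: h => /=.
  by rewrite normE nrmC ee rc_lt.
apply/nbhs_normP; exists (rc e); first by rewrite /= rc_gt0.
by move=> y /=; rewrite normE rc_lt nrmC => /h.
Qed.

Lemma cvg_nrm (V W : normedModType C) (f : V -> W) (x : V) :
  {for x, continuous f} <->
  forall e, 0 < e -> exists2 d, 0 < d & forall y, nrm (y - x) < d -> nrm (f y - f x) < e.
Proof.
split=> [cf e e0|h].
  have /cf : nbhs (f x) [set w | nrm (w - f x) < e] by apply/nbhs_nrm; exists e.
  by move/nbhs_nrm.
move=> A /nbhs_nrm[e e0 eA]; have [d d0 dh] := h e e0.
by apply/nbhs_nrm; exists d => // y /dh/eA.
Qed.

End ComplexNumbers.
Arguments ci {R}.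
Arguments rc {R} r.
Arguments re {R} z.
Arguments im {R} z.
Arguments nrm {R V} v.

(** * Derivatives *)

Section Derivatives.
Variable R : realType.
Notation C := (Cplx R).

Definition hasder (V W : normedModType C) (f : V -> W) (x : V) (L : V -> W) :=
  forall e : R, 0 < e -> exists2 d, 0 < d &
    forall h, nrm h < d -> nrm (f (x + h) - f x - L h) <= e * nrm h.

Lemma differentiable_hasder (V W : normedModType C) (f : V -> W) x :
  differentiable f x -> hasder f x ('d f x).
Proof.
move=> df e e0; have [_ /eqaddoP] := (diff_locallyP x f).1 df.
have e0' : 0 < rc e by rewrite rc_gt0.
move=> /(_ _ e0') /nbhs_nrm[d d0 h]; exists d => // k kd.
have := h k; rewrite subr0 => /(_ kd); rewrite /= !normE -rcM rc_le !fctE /= opprD addrA.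
by rewrite [k + x]addrC.
Qed.

Lemma hasder_differentiable (V W : normedModType C) (f : V -> W) x
    (L : {linear V -> W}) (B : R) :
  (forall h, nrm (L h) <= B * nrm h) -> hasder f x L ->
  differentiable f x /\ 'd f x = L :> (V -> W).
Proof.
move=> LB fL.
have cL : continuous L.
  move=> y; apply/cvg_nrm => e e0.
  have B0 : 0 < `|B| + 1 by apply: ltr_wpDl.
  exists (e / (`|B| + 1)); first exact: divr_gt0.
  move=> z; rewrite ltr_pdivlMr // => h; rewrite -linearB.
  apply: le_lt_trans (LB _) _; apply: le_lt_trans h.
  rewrite mulrC ler_wpM2l ?nrm_ge0 //; apply: le_trans (ler_norm _) _.
  by rewrite lerDl.
have E : f \o shift x = cst (f x) + L +o_ 0 id.
  apply/eqaddoP => e /pos_rc[-> e0].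
  have [d d0 h] := fL _ e0.
  apply/nbhs_nrm; exists d => // y; rewrite subr0 => /h.
  by rewrite !normE -rcM rc_le !fctE /= opprD addrA [y + x]addrC.
have dE := diff_unique cL E.
split=> //; apply/diff_locallyP; rewrite dE; split=> //.
Qed.

Lemma hasder_linear (V W : normedModType C) (f : V -> W) x (L : V -> W) (B : R) :
  linear L -> (forall h, nrm (L h) <= B * nrm h) -> hasder f x L ->
  differentiable f x /\ 'd f x = L :> (V -> W).
Proof.
move=> linL; pose L' : {linear V -> W} := HB.pack L (@GRing.isLinear.Build C V W _ L linL).
exact: (@hasder_differentiable V W f x L' B).
Qed.

Lemma linear_bound (V W : normedModType C) (L : {linear V -> W}) :
  continuous L -> exists2 B, 0 < B & forall h, nrm (L h) <= B * nrm h.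
Proof.
move=> cL; have [d d0 dh] := (cvg_nrm L 0).1 (cL 0) 1 ltr01.
exists (2 / d); first exact: divr_gt0.
move=> h; have [->|h0] := eqVneq h 0; first by rewrite linear0 !nrm0 mulr0.
have nh : 0 < nrm h by rewrite nrm_gt0.
pose a := d / 2 / nrm h.
have a0 : 0 < a by rewrite !divr_gt0.
have := dh (rc a *: h); rewrite subr0 linear0 subr0 linearZ /= !nrmZ nrm_rc gtr0_norm //.
have -> : a * nrm h = d / 2 by rewrite /a; field; rewrite gt_eqF.
move=> /(_ _); rewrite ltr_pdivrMr // => /(_ _).
have -> : d < d * 2 by lra.
move=> /(_ isT) /ltW; rewrite mulrC -ler_pdivlMr // /a div1r.
have -> : (d / 2 / nrm h)^-1 = 2 / d * nrm h by field; rewrite !gt_eqF.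
done.
Qed.

Lemma diff_bound (V W : normedModType C) (f : V -> W) x : differentiable f x ->
  exists2 B, 0 < B & forall h, nrm ('d f x h) <= B * nrm h.
Proof. by move=> /diff_continuous /linear_bound. Qed.

Definition cder (f : C -> C) (z d : C) := hasder f z (fun h => h * d).

Lemma cder_differentiable f z d : cder f z d -> differentiable f z /\ 'd f z 1 = d.
Proof.
move=> h; have [] := @hasder_linear C C f z (fun h => h * d) (nrm d) _ _ h.
- by move=> a u v; rewrite mulrDl -scalerAl.
- by move=> k; rewrite nrmM mulrC.
by move=> df ->; split => //; rewrite mul1r.
Qed.

Lemma differentiable_cder (f : C -> C) z : differentiable f z -> cder f z ('d f z 1).
Proof.
move=> /differentiable_hasder h e /h[d d0 dh]; exists d => // k /dh.
have <- : 'd f z k = k * 'd f z 1; last by [].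
have -> : 'd f z k = 'd f z (k *: (1 : C)) by congr ('d f z _); rewrite -[LHS]mulr1.
by rewrite linearZ.
Qed.

Lemma cder_unique f z d d' : cder f z d -> cder f z d' -> d = d'.
Proof. by move=> /cder_differentiable[_ <-] /cder_differentiable[_ <-]. Qed.

Lemma differentiable_ex_cder (f : C -> C) z : differentiable f z <-> exists d, cder f z d.
Proof.
split=> [/differentiable_cder ?|[d /cder_differentiable[]//]]; by exists ('d f z 1).
Qed.

Lemma hasder_continuous (V W : normedModType C) (f : V -> W) x (L : V -> W) (B : R) :
  (forall h, nrm (L h) <= B * nrm h) -> hasder f x L -> {for x, continuous f}.
Proof.
move=> LB fL; apply/cvg_nrm => e e0; have [d d0 dh] := fL 1 ltr01.
have B0 : 0 < 1 + `|B| by apply: ltr_pwDl.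
exists (Num.min d (e / (1 + `|B|))); first by rewrite lt_min d0 divr_gt0.
move=> y; rewrite lt_min => /andP[yd ye].
have := dh _ yd; rewrite [x + _]addrC subrK mul1r => h1.
have -> : f y - f x = (f y - f x - L (y - x)) + L (y - x) by rewrite subrK.
apply: le_lt_trans (nrmD _ _) _; apply: (@le_lt_trans _ _ ((1 + `|B|) * nrm (y - x))).
  rewrite mulrDl mul1r lerD //; apply: le_trans (LB _) _.
  by rewrite ler_wpM2r ?nrm_ge0 // ler_norm.
by rewrite mulrC -ltr_pdivlMr.
Qed.

Lemma cder_continuous f z d : cder f z d -> {for z, continuous f}.
Proof. by apply: (@hasder_continuous _ _ _ _ _ (nrm d)) => h; rewrite nrmM mulrC. Qed.

Lemma hasder_ext (V W : normedModType C) (f g : V -> W) x L (r : R) : 0 < r ->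
  (forall y, nrm (y - x) < r -> f y = g y) -> hasder f x L -> hasder g x L.
Proof.
move=> r0 fg fL e /fL[d d0 dh]; exists (Num.min d r); first by rewrite lt_min d0.
move=> h; rewrite lt_min => /andP[hd hr]; rewrite -!fg; first exact: dh.
  by rewrite subrr nrm0.
by rewrite addrAC subrr add0r.
Qed.

Lemma cder_id z : cder id z 1.
Proof.
move=> e e0; exists 1 => // h _; rewrite mulr1 [z + h]addrC addrK subrr nrm0.
by rewrite mulr_ge0 ?nrm_ge0 // ltW.
Qed.

Lemma cder_cst (c z : C) : cder (fun=> c) z 0.
Proof.
move=> e e0; exists 1 => // h _; rewrite /= mulr0 subrr subr0 nrm0.
by rewrite mulr_ge0 ?nrm_ge0 // ltW.
Qed.

Lemma cderD f g z d d' : cder f z d -> cder g z d' -> cder (fun w => f w + g w) z (d + d').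
Proof.
move=> hf hg e e0; have e2 : 0 < e / 2 by rewrite divr_gt0.
have [a a0 ah] := hf _ e2; have [b b0 bh] := hg _ e2.
exists (Num.min a b); first by rewrite lt_min a0.
move=> h; rewrite lt_min => /andP[/ah h1 /bh h2].
have -> : f (z + h) + g (z + h) - (f z + g z) - h * (d + d') =
  (f (z + h) - f z - h * d) + (g (z + h) - g z - h * d') by ring.
apply: le_trans (nrmD _ _) _; apply: le_trans (lerD h1 h2) _; lra.
Qed.

Lemma cderM f g z d d' : cder f z d -> cder g z d' ->
  cder (fun w => f w * g w) z (d * g z + f z * d').
Proof.
move=> hf hg e e0.
set M := nrm (g z) + nrm (f z) + nrm d + 2.
have M0 : 0 < M by rewrite /M ltr_wpDl // !addr_ge0 ?nrm_ge0.
have cg := (cvg_nrm g z).1 (cder_continuous hg).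
have e2 : 0 < Num.min 1 (e / (3 * M)) by rewrite lt_min ltr01 divr_gt0 // mulr_gt0.
set e' := Num.min _ _ in e2.
have e1 : e' <= 1 by rewrite ge_min lexx.
have e3 : e' * (3 * M) <= e by rewrite -ler_pdivlMr ?mulr_gt0 // ge_min lexx orbT.
have [a a0 ah] := hf _ e2; have [b b0 bh] := hg _ e2; have [c c0 ch] := cg _ e2.
exists (Num.min a (Num.min b c)); first by rewrite !lt_min a0 b0.
move=> h; rewrite !lt_min => /and3P[/ah h1 /bh h2 hc].
have h3 : nrm (g (z + h) - g z) < e' by apply: ch; rewrite addrAC subrr add0r.
have -> : f (z + h) * g (z + h) - f z * g z - h * (d * g z + f z * d') =
  (f (z + h) - f z - h * d) * (g z + (g (z + h) - g z)) +
  (f z * (g (z + h) - g z - h * d') + h * d * (g (z + h) - g z)) by ring.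
apply: le_trans (nrmD _ _) _; rewrite nrmM.
have k1 : nrm (g z + (g (z + h) - g z)) <= M.
  apply: le_trans (nrmD _ _) _; rewrite /M.
  have := nrm_ge0 (f z); have := nrm_ge0 d; lra.
have k2 : nrm (f z * (g (z + h) - g z - h * d') + h * d * (g (z + h) - g z)) <=
   nrm (f z) * (e' * nrm h) + nrm h * nrm d * e'.
  apply: le_trans (nrmD _ _) _; rewrite !nrmM lerD //.
    by rewrite ler_wpM2l ?nrm_ge0.
  by rewrite ler_wpM2l ?mulr_ge0 ?nrm_ge0 // ltW.
have k3 : nrm (f (z + h) - f z - h * d) * nrm (g z + (g (z + h) - g z)) <= (e' * nrm h) * M.
  by apply: ler_pM => //; exact: nrm_ge0.
apply: le_trans (lerD k3 k2) _.
apply: (@le_trans _ _ (e' * (3 * M) * nrm h)); last by rewrite ler_wpM2r ?nrm_ge0.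
have := nrm_ge0 h; have := nrm_ge0 d; have := nrm_ge0 (f z); have := nrm_ge0 (g z).
move=> g0 f0 d0 h0.
have : nrm (f z) * (e' * nrm h) <= M * (e' * nrm h).
  by rewrite ler_wpM2r ?mulr_ge0 // ?ltW // /M; lra.
have : nrm d * (e' * nrm h) <= M * (e' * nrm h).
  by rewrite ler_wpM2r ?mulr_ge0 // ?ltW // /M; lra.
lra.
Qed.

Lemma cderZ (c : C) f z d : cder f z d -> cder (fun w => c * f w) z (c * d).
Proof.
move=> h; have := cderM (cder_cst c z) h.
by rewrite mul0r add0r.
Qed.

Lemma cderN f z d : cder f z d -> cder (fun w => - f w) z (- d).
Proof.
move=> /(cderZ (-1)); rewrite mulN1r.
by congr (cder _ _ _); apply/funext => w; rewrite mulN1r.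
Qed.

Lemma cderB f g z d d' : cder f z d -> cder g z d' -> cder (fun w => f w - g w) z (d - d').
Proof. by move=> hf /cderN hg; exact: cderD. Qed.

Lemma cderV f z d : cder f z d -> f z != 0 -> cder (fun w => (f w)^-1) z (- d / f z ^+ 2).
Proof.
move=> hf f0; have nf : 0 < nrm (f z) by rewrite nrm_gt0.
have cf := (cvg_nrm f z).1 (cder_continuous hf).
move=> e e0.
set M := nrm (f z) in nf *.
have m0 : 0 < M / 2 by rewrite divr_gt0.
have [a a0 ah] := cf _ m0.
have b0 : 0 < e * M ^+ 2 / 4 by rewrite divr_gt0 // mulr_gt0 // exprn_gt0.
have [b b00 bh] := hf _ b0.
have c0 : 0 < e * M ^+ 3 / (4 * (nrm d + 1)).
  by rewrite divr_gt0 // mulr_gt0 ?exprn_gt0 // ltr_wpDl ?nrm_ge0.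
have [c c00 ch] := cf _ c0.
exists (Num.min a (Num.min b c)); first by rewrite !lt_min a0 b00.
move=> h; rewrite !lt_min => /and3P[ha /bh h2 hc].
have h1 : nrm (f (z + h) - f z) < M / 2 by apply: ah; rewrite addrAC subrr add0r.
have h3 : nrm (f (z + h) - f z) < e * M ^+ 3 / (4 * (nrm d + 1)).
  by apply: ch; rewrite addrAC subrr add0r.
have h4 : M / 2 <= nrm (f (z + h)).
  have := nrm_sub (f z) (f (z + h)); rewrite nrmC -/M; lra.
have f1 : f (z + h) != 0 by rewrite -nrm_gt0; lra.
have -> : (f (z + h))^-1 - (f z)^-1 - h * (- d / f z ^+ 2) =
  - (f (z + h) - f z - h * d) / (f (z + h) * f z)
  + h * d * (f (z + h) - f z) / (f (z + h) * f z ^+ 2) by field; rewrite f1 f0.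
apply: le_trans (nrmD _ _) _; rewrite !nrmM !nrmV !nrmM nrmN -/M.
have k1 : (nrm (f (z + h)))^-1 <= 2 / M.
  rewrite -[2 / M]invrK lef_pV2 ?posrE ?invr_gt0 ?divr_gt0 //; last by lra.
  by rewrite invfM invrK mulrC.
have h0 := nrm_ge0 h; have d0 := nrm_ge0 d.
set u := nrm (f (z + h)) in h4 k1 *.
have u0 : 0 < u by lra.
have -> : (u * M)^-1 = u^-1 * M^-1 by rewrite invfM.
have -> : (u * (M * M))^-1 = u^-1 * M^- 2 by rewrite invfM expr2.
have k2 : nrm (f (z + h) - f z - h * d) * (u^-1 * M^-1) <= e * M ^+ 2 / 4 * nrm h * (2 / M * M^-1).
  apply: ler_pM => //; rewrite ?nrm_ge0 ?mulr_ge0 ?invr_ge0 ?(ltW nf) ?(ltW u0) //.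
  by rewrite ler_wpM2r // invr_ge0 ltW.
have k3 : nrm h * nrm d * nrm (f (z + h) - f z) * (u^-1 * M^- 2) <=
   nrm h * (nrm d + 1) * (e * M ^+ 3 / (4 * (nrm d + 1))) * (2 / M * M^- 2).
  apply: ler_pM; rewrite ?mulr_ge0 ?nrm_ge0 ?invr_ge0 ?exprn_ge0 ?(ltW nf) ?(ltW u0) //.
    apply: ler_pM; rewrite ?mulr_ge0 ?nrm_ge0 ?(ltW h3) //.
    by rewrite ler_wpM2l // lerDl.
  by rewrite ler_wpM2r // invr_ge0 exprn_ge0 // ltW.
apply: le_trans (lerD k2 k3) _; rewrite le_eqVlt; apply/orP; left; apply/eqP.
by field; rewrite !gt_eqF // ltr_wpDl.
Qed.

Lemma cderX f z d n : cder f z d -> cder (fun w => f w ^+ n) z (n%:R * f z ^+ n.-1 * d).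
Proof.
move=> hf; elim: n => [|n ih].
  by rewrite !mul0r; exact: cder_cst.
have := cderM hf ih; congr (cder _ _ _).
  by apply/funext => w; rewrite exprS.
case: n {ih} => [|n] /=; first by rewrite !expr0; ring.
by rewrite exprS [n.+2%:R]mulrS; ring.
Qed.

End Derivatives.

(** * Integrals along segments *)

Section SegmentIntegral.
Variable R : realType.
Notation C := (Cplx R).

Lemma real_is_derive (g : R -> R) t d :
  (forall e, 0 < e -> exists2 a, 0 < a &
     forall s, `|s| < a -> `|g (t + s) - g t - s * d| <= e * `|s|) ->
  is_derive t 1 g d.
Proof.
move=> H.
have c : (fun h => h^-1 *: ((g \o shift t) (h *: 1) - g t)) @ 0^' --> d.
  apply/cvgrPdist_le => e e0; have [a a0 ah] := H e e0.
  exists a => //= s /=; rewrite sub0r normrN => sa s0.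
  have -> : d - s^-1 *: (g (s *: 1 + t) - g t) = - (s^-1 * (g (t + s) - g t - s * d)).
    by rewrite /GRing.scale /= mulr1 [s + t]addrC; field.
  rewrite normrN normrM normfV ler_pdivrMl ?normr_gt0 // [leRHS]mulrC.
  exact: ah.
by apply: DeriveDef; [exact: cvgP c | exact: cvg_lim c].
Qed.

Lemma derivable_eps (g : R -> R) t : derivable g t 1 ->
  forall e, 0 < e -> exists2 a, 0 < a &
     forall s, `|s| < a -> `|g (t + s) - g t - s * 'D_1 g t| <= e * `|s|.
Proof.
move=> /cvgrPdist_le H e e0.
have [a /= a0 ah] := H e e0.
exists a => // s sa; have [->|s0] := eqVneq s 0.
  by rewrite addr0 subrr mul0r subrr normr0 mulr0.
have := ah s; rewrite /= sub0r normrN => /(_ sa s0).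
rewrite -/(derive g t 1).
have -> : 'D_1 g t - s^-1 *: (g (s *: 1 + t) - g t) = - (s^-1 * (g (t + s) - g t - s * 'D_1 g t)).
  by rewrite /GRing.scale /= mulr1 [s + t]addrC; field.
by rewrite normrN normrM normfV ler_pdivrMl ?normr_gt0 // [leRHS]mulrC.
Qed.

Definition rder (P : R -> C) (t : R) (d : C) :=
  forall e, 0 < e -> exists2 a, 0 < a &
    forall s, `|s| < a -> nrm (P (t + s) - P t - rc s * d) <= e * `|s|.

Lemma rder_mvt (P h : R -> C) (al be : R) :
  (forall t, 0 <= t <= 1 -> rder P t (h t)) ->
  exists2 t, 0 <= t <= 1 &
   al * re (P 1 - P 0) + be * im (P 1 - P 0) = al * re (h t) + be * im (h t).
Proof.
move=> PH; pose g t := al * re (P t) + be * im (P t).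
have gd (t : R) : 0 <= t <= 1 -> is_derive t 1 g (al * re (h t) + be * im (h t)).
  move=> /PH H; apply: real_is_derive => e e0.
  have M0 : 0 < `|al| + `|be| + 1 by rewrite ltr_wpDl ?addr_ge0.
  have [a a0 ah] := H _ (divr_gt0 e0 M0).
  exists a => // s /ah; set u := (X in nrm X).
  have -> : g (t + s) - g t - s * (al * re (h t) + be * im (h t)) = al * re u + be * im u.
    by rewrite /u /g !reB !imB reM imM re_rc im_rc; ring.
  move=> hu; apply: (@le_trans _ _ ((`|al| + `|be| + 1) * nrm u)); last first.
    by rewrite mulrC -ler_pdivlMr // mulrAC.
  apply: le_trans (ler_normD _ _) _; rewrite !normrM !mulrDl mul1r.
  rewrite -[X in X <= _]addr0 lerD ?nrm_ge0 // lerD // ler_wpM2l //; [exact: re_le|exact: im_le].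
have [t ti E] : exists2 c, c \in `[0, 1]%R & g 1 - g 0 = (al * re (h c) + be * im (h c)) * (1 - 0).
  apply: (@MVT_segment R g (fun t => al * re (h t) + be * im (h t)) 0 1 ler01).
    by move=> x; rewrite in_itv /= => /andP[x0 x1]; apply: gd; rewrite !ltW.
  apply: continuous_in_subspaceT => x /set_mem; rewrite /= in_itv /= => /gd xd.
  by apply: differentiable_continuous; apply/derivable1_diffP; exact: ex_derive.
exists t; first by move: ti; rewrite in_itv.
by move: E; rewrite subr0 mulr1 => <-; rewrite /g !reB !imB; ring.
Qed.

Lemma rder_bound (P h : R -> C) (M : R) :
  (forall t, 0 <= t <= 1 -> rder P t (h t)) ->
  (forall t, 0 <= t <= 1 -> nrm (h t) <= M) -> nrm (P 1 - P 0) <= M.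
Proof.
move=> PH hM; set w := P 1 - P 0.
have [t t01] := rder_mvt (re w) (im w) PH; rewrite -/w => E.
have M0 : 0 <= M by apply: le_trans (hM _ t01); exact: nrm_ge0.
have [->|w0] := eqVneq w 0; first by rewrite nrm0.
have nw : 0 < nrm w by rewrite nrm_gt0.
rewrite -(ler_pM2l nw) -expr2 nrm_sqr !expr2 E.
apply: le_trans (_ : nrm w * nrm (h t) <= _); last by rewrite ler_wpM2l ?hM // ltW.
apply: le_trans (ler_norm _) _.
rewrite -ler_sqr ?nnegrE ?mulr_ge0 ?nrm_ge0 // real_normK ?num_real // exprMn !nrm_sqr -subr_ge0.
set x := (X in 0 <= X); have -> : x = (re w * im (h t) - im w * re (h t)) ^+ 2 by rewrite /x; ring.
exact: sqr_ge0.
Qed.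

Lemma rder_primitive (h : R -> C) : continuous (re \o h) -> continuous (im \o h) ->
  exists P : R -> C, forall t : R, 0 <= t <= 1 -> rder P t (h t).
Proof.
have prim (g : R -> R) : continuous g -> exists G : R -> R, forall t : R, 0 <= t <= 1 ->
    forall e, 0 < e -> exists2 a, 0 < a &
     forall s, `|s| < a -> `|G (t + s) - G t - s * g t| <= e * `|s|.
  move=> cg; exists (fun x : R => (\int[lebesgue_measure]_(t in `[-1, x]) g t)%R) => t /andP[t0 t1].
  have [||||] := @continuous_FTC1_closed R g (-1) t 2.
  - by apply: le_lt_trans t1 _; rewrite ltr1n.
  - apply: continuous_compact_integrable; first exact: segment_compact.
    exact: continuous_subspaceT.
  - by apply: lt_le_trans t0; rewrite ltrN10.
  - exact: cg.
  move=> /derivable_eps H E e /H; by rewrite -derive1E E.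
move=> /prim[G HG] /prim[K HK]; exists (fun t => rc (G t) + rc (K t) * ci) => t t01 e e0.
have e2 : 0 < e / 2 by rewrite divr_gt0.
have [a a0 ah] := HG t t01 _ e2; have [b b0 bh] := HK t t01 _ e2.
exists (Num.min a b); first by rewrite lt_min a0.
move=> s; rewrite lt_min => /andP[/ah h1 /bh h2].
apply: le_trans (nrm_le_reim _) _.
rewrite !reB !imB !reD !imD !reM !imM !re_rc !im_rc re_ci im_ci.
move: h1 h2; rewrite /comp => h1 h2.
have -> : e * `|s| = e / 2 * `|s| + e / 2 * `|s| by field.
rewrite lerD //.
  by apply: le_trans h1; rewrite le_eqVlt; apply/orP; left; apply/eqP; congr `|_|; ring.
by apply: le_trans h2; rewrite le_eqVlt; apply/orP; left; apply/eqP; congr `|_|; ring.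
Qed.

End SegmentIntegral.

Section SegmentIntegralTheory.
Variable R : realType.
Notation C := (Cplx R).
Implicit Types (f g F : C -> C) (a b c v w z : C).

Definition cpt (a b : C) (t : R) : C := a + rc t * (b - a).

(* [v] is the integral of [f] along the segment from [a] to [b]; the integral is given through a
   primitive of t |-> f (a + t (b - a)) (b - a), so that no measure theory is involved. *)
Definition hasI f a b v := exists2 P : R -> C,
  (forall t, 0 <= t <= 1 -> rder P t (f (cpt a b t) * (b - a))) & v = P 1 - P 0.

Definition cts_seg f a b := forall t, 0 <= t <= 1 -> {for cpt a b t, continuous f}.

Lemma cpt0 a b : cpt a b 0 = a. Proof. by rewrite /cpt mul0r addr0. Qed.
Lemma cpt1 a b : cpt a b 1 = b. Proof. by rewrite /cpt mul1r addrC subrK. Qed.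

Lemma cont_re_im (h : R -> C) (t : R) :
  (forall e, 0 < e -> exists2 d, 0 < d & forall s, `|s - t| < d -> nrm (h s - h t) < e) ->
  {for t, continuous (re \o h)} /\ {for t, continuous (im \o h)}.
Proof.
move=> H; split; apply/cvgrPdist_lt => e /H[d d0 dh];
  exists d => //= s; rewrite /= distrC => /dh h1; rewrite distrC -?reB -?imB;
  apply: le_lt_trans h1; [exact: re_le|exact: im_le].
Qed.

Definition clamp (t : R) : R := Num.max 0 (Num.min 1 t).
Lemma clamp01 t : 0 <= clamp t <= 1.
Proof. by rewrite /clamp le_max lexx ge_max ler01 ge_min lexx. Qed.
Lemma clamp_id t : 0 <= t <= 1 -> clamp t = t.
Proof. by move=> /andP[t0 t1]; rewrite /clamp min_r // max_r. Qed.
Lemma clamp_lip s t : `|clamp s - clamp t| <= `|s - t|.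
Proof.
have c x : (x <= 0 /\ clamp x = 0) \/ (0 <= x <= 1 /\ clamp x = x) \/ (1 <= x /\ clamp x = 1).
  have [x0|x0] := leP x 0.
    left; split => //; rewrite /clamp min_r; first by rewrite max_l.
    exact: le_trans x0 ler01.
  have [x1|x1] := leP x 1; first by right; left; rewrite (ltW x0) clamp_id // (ltW x0).
  by right; right; rewrite (ltW x1) /clamp min_l ?(ltW x1) // max_r.
have K x y : y <= x -> 0 <= clamp x - clamp y <= x - y.
  by move=> yx; case: (c x) => [[? ->]|[[/andP[? ?] ->]|[? ->]]];
   case: (c y) => [[? ->]|[[/andP[? ?] ->]|[? ->]]]; apply/andP; split; lra.
have [st|/ltW st] := leP t s.
  by have /andP[h1 h2] := K _ _ st; rewrite !ger0_norm // subr_ge0.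
by have /andP[h1 h2] := K _ _ st; rewrite distrC [leRHS]distrC !ger0_norm // subr_ge0.
Qed.

Lemma nrm_cpt a b s t : nrm (cpt a b s - cpt a b t) = `|s - t| * nrm (b - a).
Proof.
have -> : cpt a b s - cpt a b t = rc (s - t) * (b - a) by rewrite /cpt rcB; ring.
by rewrite nrmM nrm_rc.
Qed.

Lemma hasI_ex f a b : cts_seg f a b -> exists v, hasI f a b v.
Proof.
move=> cf; pose h t := f (cpt a b (clamp t)) * (b - a).
have H t : {for t, continuous (re \o h)} /\ {for t, continuous (im \o h)}.
  apply: cont_re_im => e e0.
  have N0 : 0 < nrm (b - a) + 1 by rewrite ltr_wpDl ?nrm_ge0.
  have [d d0 dh] := (cvg_nrm f _).1 (cf _ (clamp01 t)) _ (divr_gt0 e0 N0).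
  exists (d / (nrm (b - a) + 1)); first exact: divr_gt0.
  move=> s; rewrite ltr_pdivlMr // => st.
  rewrite /h -mulrBl nrmM.
  have /dh : nrm (cpt a b (clamp s) - cpt a b (clamp t)) < d.
    apply: le_lt_trans st; rewrite nrm_cpt; apply: ler_pM; rewrite ?normr_ge0 ?nrm_ge0 ?lerDl //.
    exact: clamp_lip.
  rewrite ltr_pdivlMr //; apply: le_lt_trans.
  by rewrite ler_wpM2l ?nrm_ge0 // lerDl.
have [P PH] := rder_primitive (fun t => (H t).1) (fun t => (H t).2).
exists (P 1 - P 0), P => // t t01.
by have := PH t t01; rewrite /h clamp_id.
Qed.

Lemma hasI_bound f a b v M : hasI f a b v ->
  (forall t, 0 <= t <= 1 -> nrm (f (cpt a b t)) <= M) -> nrm v <= M * nrm (b - a).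
Proof.
move=> [P PH ->] fM; apply: (rder_bound PH) => t /fM h.
by rewrite nrmM ler_wpM2r ?nrm_ge0.
Qed.

Lemma hasI_mean_im f a b v m : hasI f a b v ->
  (forall t, 0 <= t <= 1 -> m <= im (f (cpt a b t) * (b - a))) -> m <= im v.
Proof.
move=> [P PH ->] fM; have [t t01] := rder_mvt 0 1 PH.
by rewrite !mul0r !add0r !mul1r => ->; exact: fM.
Qed.

Lemma rder_lin (P Q : R -> C) (t : R) (d e k : C) :
  rder P t d -> rder Q t e -> rder (fun s => k * P s + Q s) t (k * d + e).
Proof.
move=> hP hQ eps eps0.
have N0 : 0 < 2 * (nrm k + 1) by rewrite mulr_gt0 // ltr_wpDl ?nrm_ge0.
have e2 : 0 < eps / 2 by rewrite divr_gt0.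
have [x x0 xh] := hP _ (divr_gt0 eps0 N0); have [y y0 yh] := hQ _ e2.
exists (Num.min x y); first by rewrite lt_min x0.
move=> s; rewrite lt_min => /andP[/xh h1 /yh h2].
have -> : k * P (t + s) + Q (t + s) - (k * P t + Q t) - rc s * (k * d + e) =
   k * (P (t + s) - P t - rc s * d) + (Q (t + s) - Q t - rc s * e) by ring.
apply: le_trans (nrmD _ _) _; rewrite nrmM.
have -> : eps * `|s| = (nrm k + 1) * (eps / (2 * (nrm k + 1)) * `|s|) + eps / 2 * `|s|.
  have : nrm k + 1 != 0 by rewrite gt_eqF // ltr_wpDl ?nrm_ge0.
  by move=> N1; field.
rewrite lerD //; apply: ler_pM; rewrite ?nrm_ge0 ?lerDl //.
Qed.

Lemma hasI_lin f g a b v w k : hasI f a b v -> hasI g a b w ->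
  hasI (fun z => k * f z + g z) a b (k * v + w).
Proof.
move=> [P PH ->] [Q QH ->]; exists (fun s => k * P s + Q s); last by ring.
move=> t t01; rewrite mulrDl -mulrA; apply: rder_lin; [exact: PH|exact: QH].
Qed.

Lemma hasI_ext f g a b v : (forall t, 0 <= t <= 1 -> f (cpt a b t) = g (cpt a b t)) ->
  hasI f a b v -> hasI g a b v.
Proof. by move=> fg [P PH ->]; exists P => // t t01; rewrite -fg //; exact: PH. Qed.

Lemma hasI_unique f a b v w : hasI f a b v -> hasI f a b w -> v = w.
Proof.
move=> h1 h2; apply/eqP; rewrite -subr_eq0 addrC -mulN1r; apply/eqP.
apply: nrm_lt_eps => e e0; apply: le_trans (ltW e0).
rewrite -(mul0r (nrm (b - a))); apply: (hasI_bound (hasI_lin (-1) h2 h1)) => t _.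
by rewrite mulN1r addNr nrm0.
Qed.

Lemma rder_affine (P : R -> C) u s t d :
  rder P (u + s * t) d -> rder (fun t => P (u + s * t)) t (rc s * d).
Proof.
move=> H e e0; have N0 : 0 < `|s| + 1 by rewrite ltr_wpDl.
have [x x0 xh] := H _ (divr_gt0 e0 N0).
exists (x / (`|s| + 1)); first exact: divr_gt0.
move=> r; rewrite ltr_pdivlMr // => hr.
have /xh : `|s * r| < x.
  by apply: le_lt_trans hr; rewrite normrM mulrC ler_wpM2l // lerDl.
have -> : u + s * (t + r) = u + s * t + s * r by ring.
have -> : rc r * (rc s * d) = rc (s * r) * d by rewrite rcM; ring.
move=> h; apply: le_trans h _; rewrite normrM.
have N1 := gt_eqF N0.
have -> : e / (`|s| + 1) * (`|s| * `|r|) = (e * `|r|) * (`|s| / (`|s| + 1)) by field; rewrite N1.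
by rewrite ler_piMr ?mulr_ge0 // ?ltW // ltr_pdivrMr // mul1r ltrDl.
Qed.

Lemma hasI_split f a b v s : 0 <= s <= 1 -> hasI f a b v ->
  exists v1 v2, [/\ hasI f a (cpt a b s) v1, hasI f (cpt a b s) b v2 & v = v1 + v2].
Proof.
move=> /andP[s0 s1] [P PH ->].
exists (P (0 + s * 1) - P (0 + s * 0)), (P (s + (1 - s) * 1) - P (s + (1 - s) * 0)); split.
- exists (fun t => P (0 + s * t)) => // t /andP[t0 t1].
  have -> : cpt a (cpt a b s) t = cpt a b (0 + s * t) by rewrite /cpt rcD rc0 rcM; ring.
  have -> : f (cpt a b (0 + s * t)) * (cpt a b s - a) = rc s * (f (cpt a b (0 + s * t)) * (b - a)).
    by rewrite {2}/cpt; ring.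
  apply: rder_affine; apply: PH; rewrite add0r mulr_ge0 //=.
  by rewrite mulr_ile1.
- exists (fun t => P (s + (1 - s) * t)) => // t /andP[t0 t1].
  have -> : cpt (cpt a b s) b t = cpt a b (s + (1 - s) * t) by rewrite /cpt rcD rcM rcB rc1; ring.
  have -> : f (cpt a b (s + (1 - s) * t)) * (b - cpt a b s) =
     rc (1 - s) * (f (cpt a b (s + (1 - s) * t)) * (b - a)).
    by rewrite {2}/cpt rcB rc1; ring.
  apply: rder_affine; apply: PH.
  have h1 : 0 <= 1 - s by rewrite subr_ge0.
  rewrite addr_ge0 ?mulr_ge0 //=.
  have : (1 - s) * t <= 1 - s by rewrite ler_piMr.
  lra.
- rewrite !mulr1 !mulr0 !addr0 add0r; have -> : s + (1 - s) = 1 by ring.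
  ring.
Qed.

Lemma hasI_rev f a b v : hasI f a b v -> hasI f b a (- v).
Proof.
move=> [P PH ->]; exists (fun t => P (1 + (-1) * t)).
  move=> t /andP[t0 t1].
  have -> : cpt b a t = cpt a b (1 + (-1) * t) by rewrite /cpt rcD rcM rcN rc1; ring.
  have -> : f (cpt a b (1 + (-1) * t)) * (a - b) = rc (-1) * (f (cpt a b (1 + (-1) * t)) * (b - a)).
    by rewrite rcN rc1; ring.
  by apply: rder_affine; apply: PH; lra.
by rewrite !mulN1r subrr subr0 opprB.
Qed.

Lemma hasI_primitive F f a b : (forall t, 0 <= t <= 1 -> cder F (cpt a b t) (f (cpt a b t))) ->
  hasI f a b (F b - F a).
Proof.
move=> H; exists (fun t => F (cpt a b t)); last by rewrite cpt0 cpt1.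
move=> t /H h e e0; have N0 : 0 < nrm (b - a) + 1 by rewrite ltr_wpDl ?nrm_ge0.
have [x x0 xh] := h _ (divr_gt0 e0 N0).
exists (x / (nrm (b - a) + 1)); first exact: divr_gt0.
move=> s; rewrite ltr_pdivlMr // => hs.
have /xh : nrm (rc s * (b - a)) < x.
  by apply: le_lt_trans hs; rewrite nrmM nrm_rc ler_wpM2l // lerDl.
have -> : cpt a b t + rc s * (b - a) = cpt a b (t + s) by rewrite /cpt rcD; ring.
rewrite [_ * (b - a) * _]mulrAC mulrA => h1; apply: le_trans h1 _.
rewrite nrmM nrm_rc mulrAC ler_pdivrMr // -!mulrA ler_wpM2l ?(ltW e0) //.
by rewrite ler_wpM2l // lerDl.
Qed.

Lemma hasI_shift f a b c v : hasI (fun z => f (z - c)) a b v <-> hasI f (a - c) (b - c) v.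
Proof.
have E t : cpt (a - c) (b - c) t = cpt a b t - c by rewrite /cpt; ring.
have E' : b - c - (a - c) = b - a by ring.
by split=> -[P PH ->]; exists P => // t /PH; rewrite E E'.
Qed.

Definition segI f a b : C := xget 0 (hasI f a b).

Lemma segI_has f a b : cts_seg f a b -> hasI f a b (segI f a b).
Proof. by move=> /hasI_ex[v hv]; rewrite /segI; case: xgetP => // /(_ v). Qed.

Lemma segIE f a b v : hasI f a b v -> segI f a b = v.
Proof.
move=> h; rewrite /segI; case: xgetP => [w _ hw|/(_ v)//].
exact: (@hasI_unique f a b).
Qed.

Lemma complete_real (x : nat -> R) B : 
  (forall k, `|x k.+1 - x k| <= B / 2 ^+ k) ->
  exists l, forall k, `|x k - l| <= 2 * B / 2 ^+ k.
Proof.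
move=> H; pose lo k := x k - 2 * B / 2 ^+ k; pose hi k := x k + 2 * B / 2 ^+ k.
have p2 k : (0 : R) < 2 ^+ k by rewrite exprn_gt0.
have E k : 2 * B / 2 ^+ k.+1 = B / 2 ^+ k.
  by rewrite exprS; field; rewrite gt_eqF.
have lo_mono : {homo lo : i j / (i <= j)%N >-> i <= j}.
  apply: homo_leq => //; first exact: le_trans.
  move=> i; have := H i; rewrite /lo E ler_norml => /andP[h1 _].
  have -> : 2 * B / 2 ^+ i = B / 2 ^+ i + B / 2 ^+ i by field; rewrite gt_eqF.
  lra.
have hi_mono : {homo hi : i j / (i <= j)%N >-> j <= i}.
  apply: homo_leq => //; first by move=> a b c h1 h2; exact: le_trans h2 h1.
  move=> i; have := H i; rewrite /hi E ler_norml => /andP[_ h1].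
  have -> : 2 * B / 2 ^+ i = B / 2 ^+ i + B / 2 ^+ i by field; rewrite gt_eqF.
  lra.
have B0 : 0 <= B by apply: le_trans (normr_ge0 _) (le_trans (H 0%N) _); rewrite expr0 divr1.
have lohi i j : lo i <= hi j.
  apply: le_trans (lo_mono i (maxn i j) (leq_maxl _ _)) _.
  apply: le_trans (hi_mono j (maxn i j) (leq_maxr _ _)).
  rewrite /lo /hi; have : 0 <= 2 * B / 2 ^+ (maxn i j) by rewrite divr_ge0 ?mulr_ge0 // ltW.
  lra.
exists (sup (range lo)) => k.
have u1 : lo k <= sup (range lo).
  by apply: ub_le_sup; [exists (hi 0%N) => _ [i _ <-]; exact: lohi|exists k].
have u2 : sup (range lo) <= hi k.
  by apply: ge_sup; [exists (lo 0%N); exists 0%N|move=> _ [i _ <-]; exact: lohi].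
by rewrite ler_norml; move: u1 u2; rewrite /lo /hi => u1 u2; apply/andP; split; lra.
Qed.

Lemma complete_cplx (x : nat -> C) B : 
  (forall k, nrm (x k.+1 - x k) <= B / 2 ^+ k) ->
  exists l, forall k, nrm (x k - l) <= 4 * B / 2 ^+ k.
Proof.
move=> H.
have [l1 h1] : exists l, forall k, `|re (x k) - l| <= 2 * B / 2 ^+ k.
  by apply: complete_real => k; rewrite -reB; apply: le_trans (re_le _) _.
have [l2 h2] : exists l, forall k, `|im (x k) - l| <= 2 * B / 2 ^+ k.
  by apply: complete_real => k; rewrite -imB; apply: le_trans (im_le _) _.
exists (rc l1 + rc l2 * ci) => k; apply: le_trans (nrm_le_reim _) _.
have -> : 4 * B / 2 ^+ k = 2 * B / 2 ^+ k + 2 * B / 2 ^+ k by field; rewrite gt_eqF ?exprn_gt0.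
rewrite !reB !imB !reD !imD !reM !imM !re_rc !im_rc re_ci im_ci.
by rewrite !(mulr0, mulr1, subr0, addr0, add0r, mul0r) lerD.
Qed.

End SegmentIntegralTheory.

(** * Goursat's theorem *)

Section Goursat.
Variable R : realType.
Notation C := (Cplx R).
Implicit Types (f g F : C -> C) (a b c v w z : C).

Definition convex_closed (K : C -> Prop) :=
  (forall a b t, K a -> K b -> 0 <= t <= 1 -> K (cpt a b t)) /\
  (forall x, (forall e : R, 0 < e -> exists2 y, K y & nrm (y - x) < e) -> K x).

Definition cder_on (K : C -> Prop) f := forall z, K z -> exists d, cder f z d.

Lemma cder_on_cts K f a b : convex_closed K -> cder_on K f -> K a -> K b -> cts_seg f a b.
Proof.
move=> [cK _] Kf Ka Kb t t01; have [d] := Kf _ (cK _ _ _ Ka Kb t01).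
exact: cder_continuous.
Qed.

Definition mid a b := cpt a b 2^-1.
Lemma half01 : 0 <= (2^-1 : R) <= 1. Proof. by apply/andP; split; lra. Qed.

Lemma midE a b : mid a b = (a + b) / 2.
Proof. by rewrite /mid /cpt rcV rc_nat; field. Qed.

Lemma segI_mid f a b : cts_seg f a b -> segI f a b = segI f a (mid a b) + segI f (mid a b) b.
Proof.
move=> /segI_has /(hasI_split half01)[v1 [v2 [h1 h2 ->]]].
by rewrite (segIE h1) (segIE h2).
Qed.

Lemma segI_rev f a b : cts_seg f a b -> segI f b a = - segI f a b.
Proof. by move=> /segI_has /hasI_rev /segIE. Qed.

Definition tri f a b c := segI f a b + segI f b c + segI f c a.
Definition per a b c : R := nrm (b - a) + nrm (c - b) + nrm (a - c).

Lemma nrm_half z : nrm (z / 2) = nrm z / 2.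
Proof. by rewrite nrmM nrmV -rc_nat nrm_rc ger0_norm. Qed.

Lemma tri_step K f : convex_closed K -> cder_on K f ->
  forall T : C * C * C, exists T' : C * C * C,
  K T.1.1 -> K T.1.2 -> K T.2 ->
  [/\ [/\ K T'.1.1, K T'.1.2 & K T'.2],
      per T'.1.1 T'.1.2 T'.2 = per T.1.1 T.1.2 T.2 / 2,
      nrm (tri f T.1.1 T.1.2 T.2) <= 4 * nrm (tri f T'.1.1 T'.1.2 T'.2) &
      nrm (T'.1.1 - T.1.1) <= per T.1.1 T.1.2 T.2].
Proof.
move=> hK Kf [[a b] c] /=.
have [Ka|?] := pselect (K a); last by exists (a, b, c).
have [Kb|?] := pselect (K b); last by exists (a, b, c).
have [Kc|?] := pselect (K c); last by exists (a, b, c).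
have cK := hK.1.
have K1 : K (mid a b) by apply: cK => //; exact: half01.
have K2 : K (mid b c) by apply: cK => //; exact: half01.
have K3 : K (mid c a) by apply: cK => //; exact: half01.
have cs x y : K x -> K y -> cts_seg f x y := cder_on_cts hK Kf.
set m1 := mid a b in K1 *; set m2 := mid b c in K2 *; set m3 := mid c a in K3 *.
have E : tri f a b c = (tri f a m1 m3 + tri f m1 b m2) + (tri f m3 m2 c + tri f m1 m2 m3).
  rewrite /tri (segI_mid (cs a b Ka Kb)) (segI_mid (cs b c Kb Kc)) (segI_mid (cs c a Kc Ka)).
  rewrite -/m1 -/m2 -/m3 (segI_rev (cs m1 m3 K1 K3)) (segI_rev (cs m1 m2 K1 K2)).
  rewrite (segI_rev (cs m2 m3 K2 K3)); ring.
have P1 : per a m1 m3 = per a b c / 2.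
  rewrite /per !mulrDl -!nrm_half /m1 /m3 !midE.
  have -> : (a + b) / 2 - a = (b - a) / 2 by field.
  have -> : (c + a) / 2 - (a + b) / 2 = (c - b) / 2 by field.
  by have -> : a - (c + a) / 2 = (a - c) / 2 by field.
have P2 : per m1 b m2 = per a b c / 2.
  rewrite /per !mulrDl -!nrm_half /m1 /m2 !midE.
  have -> : b - (a + b) / 2 = (b - a) / 2 by field.
  have -> : (b + c) / 2 - b = (c - b) / 2 by field.
  by have -> : (a + b) / 2 - (b + c) / 2 = (a - c) / 2 by field.
have P3 : per m3 m2 c = per a b c / 2.
  rewrite /per !mulrDl -!nrm_half /m3 /m2 !midE.
  have -> : (b + c) / 2 - (c + a) / 2 = (b - a) / 2 by field.
  have -> : c - (b + c) / 2 = (c - b) / 2 by field.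
  by have -> : (c + a) / 2 - c = (a - c) / 2 by field.
have P4 : per m1 m2 m3 = per a b c / 2.
  rewrite /per !mulrDl -!nrm_half /m3 /m2 /m1 !midE.
  have -> : (b + c) / 2 - (a + b) / 2 = - ((a - c) / 2) by field.
  have -> : (c + a) / 2 - (b + c) / 2 = - ((b - a) / 2) by field.
  have -> : (a + b) / 2 - (c + a) / 2 = - ((c - b) / 2) by field.
  rewrite !nrmN; ring.
have D1 : nrm (m1 - a) <= per a b c.
  have -> : m1 - a = (b - a) / 2 by rewrite /m1 midE; field.
  rewrite nrm_half /per; have := nrm_ge0 (b - a); have := nrm_ge0 (c - b); have := nrm_ge0 (a - c); lra.
have D3 : nrm (m3 - a) <= per a b c.
  have -> : m3 - a = - ((a - c) / 2) by rewrite /m3 midE; field.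
  rewrite nrmN nrm_half /per; have := nrm_ge0 (b - a); have := nrm_ge0 (c - b); have := nrm_ge0 (a - c); lra.
have D0 : nrm (a - a) <= per a b c by rewrite subrr nrm0 /per !addr_ge0 ?nrm_ge0.
set t := tri f a b c in E *; set t1 := tri f a m1 m3 in E; set t2 := tri f m1 b m2 in E.
set t3 := tri f m3 m2 c in E; set t4 := tri f m1 m2 m3 in E.
have le4 : nrm t <= nrm t1 + nrm t2 + (nrm t3 + nrm t4).
  rewrite E; apply: le_trans (nrmD _ _) _; rewrite lerD //; exact: nrmD.
have [h1|h1] := leP (nrm t) (4 * nrm t1); first by exists (a, m1, m3).
have [h2|h2] := leP (nrm t) (4 * nrm t2); first by exists (m1, b, m2).
have [h3|h3] := leP (nrm t) (4 * nrm t3); first by exists (m3, m2, c).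
have [h4|h4] := leP (nrm t) (4 * nrm t4); first by exists (m1, m2, m3).
by exfalso; lra.
Qed.

Lemma archi_pow (x : R) : exists k : nat, x < 2 ^+ k.
Proof.
exists (Num.truncn `|x|).+1.
apply: le_lt_trans (ler_norm x) _; apply: lt_le_trans (truncnS_gt _) _.
rewrite -natrX ler_nat; elim: (Num.truncn `|x|).+1 => // n ih.
by rewrite expnS mul2n -addnn -addn1 leq_add // expn_gt0.
Qed.

Lemma small_pow (x e : R) : 0 < e -> exists k : nat, x / 2 ^+ k < e.
Proof.
move=> e0; have [k hk] := archi_pow (x / e); exists k.
by rewrite ltr_pdivrMr ?exprn_gt0 // mulrC -ltr_pdivrMr.
Qed.

Lemma cder_quadratic (p u d z : C) : 
  cder (fun z => u * z + d * ((z - p) ^+ 2 / 2)) z (u + d * (z - p)).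
Proof.
have h1 := cderZ u (cder_id z).
have h2 := cderB (cder_id z) (cder_cst p z).
have h3 := cderZ d (cderZ 2^-1 (cderX 2 h2)).
have := cderD h1 h3; rewrite mulr1 expr1 subr0.
congr (cder _ _ _); last by rewrite mulr1; field.
by apply/funext => x; field.
Qed.

Theorem goursat K f a b c : convex_closed K -> cder_on K f -> K a -> K b -> K c ->
  tri f a b c = 0.
Proof.
move=> hK Kf Ka Kb Kc.
have [nx nxP] := choice (tri_step hK Kf).
pose T k := iter k nx (a, b, c).
have TK k : [/\ K (T k).1.1, K (T k).1.2 & K (T k).2].
  by elim: k => //= k [h1 h2 h3]; have [] := nxP _ h1 h2 h3.
have TP k : per (T k).1.1 (T k).1.2 (T k).2 = per a b c / 2 ^+ k.
  elim: k => [|k ih]; first by rewrite divr1.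
  have [h1 h2 h3] := TK k; have [_ /= -> _ _] := nxP _ h1 h2 h3.
  by rewrite ih exprS; field; rewrite gt_eqF // exprn_gt0.
have TI k : nrm (tri f a b c) <= 4 ^+ k * nrm (tri f (T k).1.1 (T k).1.2 (T k).2).
  elim: k => [|k ih]; first by rewrite mul1r.
  have [h1 h2 h3] := TK k; have [_ _ h _] := nxP _ h1 h2 h3.
  apply: le_trans ih _; rewrite exprSr -mulrA ler_wpM2l ?exprn_ge0 //.
have TA k : nrm ((T k.+1).1.1 - (T k).1.1) <= per a b c / 2 ^+ k.
  by have [h1 h2 h3] := TK k; have [_ _ _ h] := nxP _ h1 h2 h3; rewrite -TP.
have [p hp] := complete_cplx TA.
set P := per a b c in TP TA hp.
have P0 : 0 <= P by rewrite /P /per !addr_ge0 ?nrm_ge0.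
have Kp : K p.
  apply: hK.2 => e e0; have [k hk] := small_pow (4 * P) e0.
  by exists (T k).1.1; [case: (TK k)|exact: le_lt_trans (hp k) hk].
have [d hd] := Kf p Kp.
apply: nrm_lt_eps => e e0.
have N0 : 0 < 5 * (P + 1) ^+ 2 by rewrite mulr_gt0 // exprn_gt0 // ltr_wpDl.
have [dl dl0 dh] := hd _ (divr_gt0 e0 N0).
have [k hk] := small_pow (5 * P) dl0.
apply: le_trans (TI k) _.
have [h1 h2 h3] := TK k.
move: (TP k) (hp k) h1 h2 h3; case: (T k) => [[x y] w] /= Pk xp Kx Ky Kw.
set A := fun z => f p + d * (z - p).
have HA u v : hasI A u v (f p * v + d * ((v - p) ^+ 2 / 2) - (f p * u + d * ((u - p) ^+ 2 / 2))).
  by apply: (@hasI_primitive R (fun z => f p * z + d * ((z - p) ^+ 2 / 2))) => t _; exact: cder_quadratic.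
have dist u v t : nrm (u - x) <= P / 2 ^+ k -> nrm (v - x) <= P / 2 ^+ k -> 0 <= t <= 1 ->
    nrm (cpt u v t - p) <= 5 * P / 2 ^+ k.
  move=> hu hv /andP[t0 t1].
  have -> : cpt u v t - p = rc (1 - t) * (u - x) + rc t * (v - x) + (x - p).
    by rewrite /cpt rcB rc1; ring.
  apply: le_trans (nrmD _ _) _.
  have -> : 5 * P / 2 ^+ k = P / 2 ^+ k + 4 * P / 2 ^+ k.
    by field; rewrite gt_eqF ?exprn_gt0.
  rewrite lerD //; apply: le_trans (nrmD _ _) _; rewrite !nrmM !nrm_rc ger0_norm ?subr_ge0 //.
  rewrite ger0_norm //.
  apply: (@le_trans _ _ ((1 - t) * (P / 2 ^+ k) + t * (P / 2 ^+ k))).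
    by rewrite lerD // ler_wpM2l // subr_ge0.
  by rewrite -mulrDl subrK mul1r.
have EST u v : K u -> K v -> nrm (u - x) <= P / 2 ^+ k -> nrm (v - x) <= P / 2 ^+ k ->
   nrm (segI f u v - (f p * v + d * ((v - p) ^+ 2 / 2) - (f p * u + d * ((u - p) ^+ 2 / 2))))
   <= e / (5 * (P + 1) ^+ 2) * (5 * P / 2 ^+ k) * nrm (v - u).
  move=> Ku Kv hu hv.
  have := hasI_lin (-1) (HA u v) (segI_has (cder_on_cts hK Kf Ku Kv)).
  rewrite mulN1r [- _ + _]addrC => H; apply: (hasI_bound H) => t t01.
  have hd1 := dist _ _ _ hu hv t01.
  have /dh : nrm (cpt u v t - p) < dl by exact: le_lt_trans hd1 hk.
  rewrite [p + _]addrC subrK.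
  have -> : -1 * A (cpt u v t) + f (cpt u v t) = f (cpt u v t) - f p - (cpt u v t - p) * d.
    by rewrite /A; ring.
  by move/le_trans; apply; rewrite ler_wpM2l // divr_ge0 // ltW.
have n3 : nrm (y - x) + nrm (w - y) + nrm (x - w) = P / 2 ^+ k by exact: Pk.
have [q1 q2 q3] : [/\ 0 <= nrm (y - x), 0 <= nrm (w - y) & 0 <= nrm (x - w)] by rewrite !nrm_ge0.
have dxx : nrm (x - x) <= P / 2 ^+ k by rewrite subrr nrm0 divr_ge0 // exprn_ge0.
have dyx : nrm (y - x) <= P / 2 ^+ k by lra.
have dwx : nrm (w - x) <= P / 2 ^+ k by rewrite nrmC; lra.
have e1 := EST _ _ Kx Ky dxx dyx; have e2 := EST _ _ Ky Kw dyx dwx; have e3 := EST _ _ Kw Kx dwx dxx.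
set B := e / _ * _ in e1 e2 e3.
have tb : nrm (tri f x y w) <= B * (P / 2 ^+ k).
  rewrite -n3 !mulrDr; set X1 := (X in segI f x y - X) in e1.
  set X2 := (X in segI f y w - X) in e2; set X3 := (X in segI f w x - X) in e3.
  have -> : tri f x y w = (segI f x y - X1) + (segI f y w - X2) + (segI f w x - X3).
    by rewrite /tri /X1 /X2 /X3; ring.
  by apply: le_trans (nrmD _ _) _; rewrite lerD //; apply: le_trans (nrmD _ _) _; rewrite lerD.
apply: le_trans (_ : 4 ^+ k * (B * (P / 2 ^+ k)) <= _).
  by rewrite ler_wpM2l // exprn_ge0.
have -> : (4 : R) ^+ k = 2 ^+ k * 2 ^+ k by rewrite -exprMn; congr (_ ^+ _); ring.
rewrite /B.
have -> : 2 ^+ k * 2 ^+ k * (e / (5 * (P + 1) ^+ 2) * (5 * P / 2 ^+ k) * (P / 2 ^+ k)) =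
  e * (P ^+ 2 / (P + 1) ^+ 2).
  by field; rewrite !gt_eqF ?exprn_gt0 // ltr_wpDl.
rewrite ler_piMr ?(ltW e0) // ler_pdivrMr ?exprn_gt0 ?ltr_wpDl // mul1r.
by rewrite lerXn2r ?nnegrE // ?lerDl // addr_ge0.
Qed.

Lemma segI_cder K f z0 z (r : R) : convex_closed K -> cder_on K f -> K z0 -> 0 < r ->
  (forall w, nrm (w - z) < r -> K w) -> cder (segI f z0) z (f z).
Proof.
move=> hK Kf K0 r0 Kr.
have Kz : K z by apply: Kr; rewrite subrr nrm0.
have [d hd] := Kf z Kz.
have cf := (cvg_nrm f z).1 (cder_continuous hd).
move=> e e0; have [x x0 xh] := cf e e0.
exists (Num.min r x); first by rewrite lt_min r0.
move=> h; rewrite lt_min => /andP[hr hx].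
have Kzh : K (z + h) by apply: Kr; rewrite addrAC subrr add0r.
have := goursat hK Kf K0 Kz Kzh; rewrite /tri.
rewrite (segI_rev (cder_on_cts hK Kf K0 Kzh)) => E.
have -> : segI f z0 (z + h) - segI f z0 z = segI f z (z + h).
  by apply/eqP; rewrite -subr_eq0 -oppr_eq0 -[X in _ == X]E; apply/eqP; ring.
have H1 : hasI (fun=> f z) z (z + h) (h * f z).
  have := @hasI_primitive R (fun w => f z * w) (fun=> f z) z (z + h).
  have -> : f z * (z + h) - f z * z = h * f z by ring.
  by apply=> t _; rewrite -{2}[f z]mulr1; apply: cderZ; exact: cder_id.
have := hasI_lin (-1) H1 (segI_has (cder_on_cts hK Kf Kz Kzh)).
rewrite !mulN1r [X in hasI _ _ _ X]addrC => H.
have E' : z + h - z = h by rewrite [z + h]addrC addrK.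
rewrite -[X in _ <= _ * nrm X]E'.
apply: (hasI_bound H) => t /andP[t0 t1]; rewrite addrC; apply/ltW/xh.
have -> : cpt z (z + h) t - z = rc t * h by rewrite /cpt; ring.
rewrite nrmM nrm_rc ger0_norm //; apply: le_lt_trans hx.
by rewrite ler_piMl ?nrm_ge0.
Qed.

Lemma cder_quotient F f z d (r : R) : 0 < r ->
  (forall w, nrm (w - z) < r -> cder F w (f w)) -> cder f z d ->
  cder (fun w => if w == z then f z else (F w - F z) / (w - z)) z (d / 2).
Proof.
move=> r0 Ff fd e e0; have [x x0 xh] := fd e e0.
exists (Num.min r x); first by rewrite lt_min r0.
move=> h; rewrite lt_min => /andP[hr hx]; rewrite eqxx.
have [->|h0] := eqVneq h 0.
  by rewrite addr0 eqxx subrr mul0r subr0 nrm0 mulr0.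
have -> : (z + h == z) = false.
  by apply/negP => /eqP /(congr1 (fun x => x - z)); rewrite addrAC subrr add0r => /eqP; rewrite (negbTE h0).
rewrite [z + h]addrC addrK [h + z]addrC.
have -> : (F (z + h) - F z) / h - f z - h * (d / 2) = (F (z + h) - F z - f z * h - d * (h ^+ 2 / 2)) / h.
  by field.
rewrite nrmM nrmV ler_pdivrMr ?nrm_gt0 //.
have B t : 0 <= t <= 1 -> nrm (cpt z (z + h) t - z) <= nrm h.
  move=> /andP[t0 t1]; have -> : cpt z (z + h) t - z = rc t * h by rewrite /cpt; ring.
  by rewrite nrmM nrm_rc ger0_norm // ler_piMl ?nrm_ge0.
have H1 : hasI f z (z + h) (F (z + h) - F z).
  apply: hasI_primitive => t t01; apply: Ff; apply: le_lt_trans hr; exact: B.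
have H2 : hasI (fun w => f z + d * (w - z)) z (z + h) (f z * h + d * (h ^+ 2 / 2)).
  have := @hasI_primitive R (fun w => f z * w + d * ((w - z) ^+ 2 / 2)) (fun w => f z + d * (w - z)) z (z + h) (fun t _ => cder_quadratic _ _ _ _).
  congr (hasI _ _ _ _); rewrite subrr expr0n /= mul0r mulr0 addr0 [z + h]addrC addrK; ring.
have := hasI_lin (-1) H2 H1; rewrite mulN1r.
have -> : F (z + h) - F z - f z * h - d * (h ^+ 2 / 2) = - (f z * h + d * (h ^+ 2 / 2)) + (F (z + h) - F z) by ring.
move=> H; have E : z + h - z = h by rewrite [z + h]addrC addrK.
rewrite -[X in _ <= _ * nrm X]E.
apply: (hasI_bound H) => t t01.
have /xh : nrm (cpt z (z + h) t - z) < x by apply: le_lt_trans hx; exact: B.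
rewrite [z + (_ - z)]addrC subrK => h1.
have -> : -1 * (f z + d * (cpt z (z + h) t - z)) + f (cpt z (z + h) t) =
  f (cpt z (z + h) t) - f z - (cpt z (z + h) t - z) * d by ring.
by apply: le_trans h1 _; rewrite ler_wpM2l ?(ltW e0) // B.
Qed.

End Goursat.

(** * Cauchy's formula on squares *)

Section Squares.
Variable R : realType.
Notation C := (Cplx R).
Implicit Types (f g F : C -> C) (a b c v w z : C) (h m M : R).

Definition sqr a h z := (0 <= re (z - a) <= h) /\ (0 <= im (z - a) <= h).
Definition inside a h z := (0 < re (z - a) < h) /\ (0 < im (z - a) < h).
Definition bd a h z := sqr a h z /\
  [\/ re (z - a) = 0, re (z - a) = h, im (z - a) = 0 | im (z - a) = h].

Lemma cptE a b t : re (cpt a b t) = re a + t * (re b - re a) /\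
  im (cpt a b t) = im a + t * (im b - im a).
Proof. by rewrite /cpt reD imD reM imM re_rc im_rc reB imB; split; ring. Qed.

Lemma sqr_convex a h : convex_closed (sqr a h).
Proof.
split=> [x y t [/andP[x1 x2] /andP[x3 x4]] [/andP[y1 y2] /andP[y3 y4]] /andP[t0 t1]|x H].
  rewrite /sqr !(reB, imB) in x1 x2 x3 x4 y1 y2 y3 y4 *; have [-> ->] := cptE x y t.
  split; apply/andP; split; nra.
have aux (p : C -> R) : (forall y, `|p y| <= nrm y) -> (forall y z, p (y - z) = p y - p z) ->
    (forall y, sqr a h y -> 0 <= p (y - a) <= h) -> 0 <= p (x - a) <= h.
  move=> p1 p2 p3; apply/andP; split.
    apply/ler_addgt0Pl => e /H[y /p3 /andP[y1 y2] ye].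
    have := p1 (y - x); rewrite ler_norml !p2 in y1 y2 * => /andP[]; lra.
  apply/ler_addgt0Pl => e /H[y /p3 /andP[y1 y2] ye].
  have := p1 (y - x); rewrite ler_norml !p2 in y1 y2 * => /andP[]; lra.
split; apply: aux => //; [exact: re_le|exact: reB|by move=> y []|exact: im_le|exact: imB|by move=> y []].
Qed.

Let e1 a h := a + rc h.
Let e2 a h := a + rc h + rc h * ci.
Let e3 a h := a + rc h * ci.

Let simp := (reD, imD, reB, imB, reM, imM, re_rc, im_rc, @re_ci R, @im_ci R, mulr0, mulr1, mul0r, addr0, add0r, subr0, sub0r).

Lemma e1_sqr a h : 0 <= h -> sqr a h (e1 a h).
Proof. by move=> h0; rewrite /sqr /e1 !simp; split; apply/andP; split; lra. Qed.
Lemma e2_sqr a h : 0 <= h -> sqr a h (e2 a h).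
Proof. by move=> h0; rewrite /sqr /e2 !simp; split; apply/andP; split; lra. Qed.
Lemma e3_sqr a h : 0 <= h -> sqr a h (e3 a h).
Proof. by move=> h0; rewrite /sqr /e3 !simp; split; apply/andP; split; lra. Qed.
Lemma e0_sqr a h : 0 <= h -> sqr a h a.
Proof. by move=> h0; rewrite /sqr !simp; split; apply/andP; split; lra. Qed.

Lemma edge_bd a h t : 0 <= h -> 0 <= t <= 1 ->
  [/\ bd a h (cpt a (e1 a h) t), bd a h (cpt (e1 a h) (e2 a h) t),
      bd a h (cpt (e2 a h) (e3 a h) t) & bd a h (cpt (e3 a h) a t)].
Proof.
move=> h0 t01; have cv := (sqr_convex a h).1.
split; (split; first by apply: cv => //; (exact: e0_sqr || exact: e1_sqr || exact: e2_sqr || exact: e3_sqr)).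
- by constructor 3; rewrite imB (cptE _ _ _).2 /e1 !simp; ring.
- by constructor 2; rewrite reB (cptE _ _ _).1 /e1 /e2 !simp; ring.
- by constructor 4; rewrite imB (cptE _ _ _).2 /e3 /e2 !simp; ring.
- by constructor 1; rewrite reB (cptE _ _ _).1 /e3 !simp; ring.
Qed.

Definition hasQ f a h v := exists v1 v2 v3 v4,
  [/\ hasI f a (e1 a h) v1, hasI f (e1 a h) (e2 a h) v2, hasI f (e2 a h) (e3 a h) v3,
      hasI f (e3 a h) a v4 & v = v1 + v2 + v3 + v4].

Definition cts_bd f a h := forall z, bd a h z -> {for z, continuous f}.

Lemma hasQ_ex f a h : 0 <= h -> cts_bd f a h -> exists v, hasQ f a h v.
Proof.
move=> h0 cf.
have [v1 h1] : exists v, hasI f a (e1 a h) v.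
  by apply: hasI_ex => t t01; apply: cf; case: (edge_bd a h0 t01).
have [v2 h2] : exists v, hasI f (e1 a h) (e2 a h) v.
  by apply: hasI_ex => t t01; apply: cf; case: (edge_bd a h0 t01).
have [v3 h3] : exists v, hasI f (e2 a h) (e3 a h) v.
  by apply: hasI_ex => t t01; apply: cf; case: (edge_bd a h0 t01).
have [v4 h4] : exists v, hasI f (e3 a h) a v.
  by apply: hasI_ex => t t01; apply: cf; case: (edge_bd a h0 t01).
by exists (v1 + v2 + v3 + v4), v1, v2, v3, v4.
Qed.

Lemma hasQ_lin f g a h v w k : hasQ f a h v -> hasQ g a h w ->
  hasQ (fun z => k * f z + g z) a h (k * v + w).
Proof.
move=> [v1 [v2 [v3 [v4 [h1 h2 h3 h4 ->]]]]] [w1 [w2 [w3 [w4 [k1 k2 k3 k4 ->]]]]].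
exists (k * v1 + w1), (k * v2 + w2), (k * v3 + w3), (k * v4 + w4).
by split; try exact: hasI_lin; ring.
Qed.

Lemma edge_len a h : 0 <= h -> [/\ nrm (e1 a h - a) = h, nrm (e2 a h - e1 a h) = h,
  nrm (e3 a h - e2 a h) = h & nrm (a - e3 a h) = h].
Proof.
move=> h0; rewrite /e1 /e2 /e3; split.
- by rewrite [a + _]addrC addrK nrm_rc ger0_norm.
- by rewrite [_ + _ * ci]addrC addrK nrmM nrm_rc nrm_ci mulr1 ger0_norm.
- have -> : a + rc h * ci - (a + rc h + rc h * ci) = - rc h by ring.
  by rewrite nrmN nrm_rc ger0_norm.
- have -> : a - (a + rc h * ci) = - (rc h * ci) by ring.
  by rewrite nrmN nrmM nrm_rc nrm_ci mulr1 ger0_norm.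
Qed.

Lemma hasQ_bound f a h v M : 0 <= h -> hasQ f a h v ->
  (forall z, bd a h z -> nrm (f z) <= M) -> nrm v <= 4 * h * M.
Proof.
move=> h0 [v1 [v2 [v3 [v4 [h1 h2 h3 h4 ->]]]]] fM.
have [l1 l2 l3 l4] := edge_len a h0.
have b1 : nrm v1 <= M * h.
  by rewrite -[X in _ * X]l1; apply: (hasI_bound h1) => t t01; apply: fM; case: (edge_bd a h0 t01).
have b2 : nrm v2 <= M * h.
  by rewrite -[X in _ * X]l2; apply: (hasI_bound h2) => t t01; apply: fM; case: (edge_bd a h0 t01).
have b3 : nrm v3 <= M * h.
  by rewrite -[X in _ * X]l3; apply: (hasI_bound h3) => t t01; apply: fM; case: (edge_bd a h0 t01).
have b4 : nrm v4 <= M * h.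
  by rewrite -[X in _ * X]l4; apply: (hasI_bound h4) => t t01; apply: fM; case: (edge_bd a h0 t01).
have := nrmD (v1 + v2 + v3) v4; have := nrmD (v1 + v2) v3; have := nrmD v1 v2; lra.
Qed.

Lemma hasQ_unique f a h v w : hasQ f a h v -> hasQ f a h w -> v = w.
Proof.
move=> [v1 [v2 [v3 [v4 [h1 h2 h3 h4 ->]]]]] [w1 [w2 [w3 [w4 [k1 k2 k3 k4 ->]]]]].
by rewrite (hasI_unique h1 k1) (hasI_unique h2 k2) (hasI_unique h3 k3) (hasI_unique h4 k4).
Qed.

Lemma hasQ_ext f g a h v : 0 <= h -> (forall z, bd a h z -> f z = g z) ->
  hasQ f a h v -> hasQ g a h v.
Proof.
move=> h0 fg [v1 [v2 [v3 [v4 [h1 h2 h3 h4 ->]]]]]; exists v1, v2, v3, v4; split=> //.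
- by apply: hasI_ext h1 => t t01; apply: fg; case: (edge_bd a h0 t01).
- by apply: hasI_ext h2 => t t01; apply: fg; case: (edge_bd a h0 t01).
- by apply: hasI_ext h3 => t t01; apply: fg; case: (edge_bd a h0 t01).
- by apply: hasI_ext h4 => t t01; apply: fg; case: (edge_bd a h0 t01).
Qed.

Lemma hasQ_primitive F f a h : 0 <= h -> (forall z, bd a h z -> cder F z (f z)) ->
  hasQ f a h 0.
Proof.
move=> h0 Ff; exists (F (e1 a h) - F a), (F (e2 a h) - F (e1 a h)), (F (e3 a h) - F (e2 a h)), (F a - F (e3 a h)).
split; last by ring.
all: by apply: hasI_primitive => t t01; apply: Ff; case: (edge_bd a h0 t01).
Qed.

Lemma hasQ_shift f a h c v : hasQ (fun z => f (z - c)) a h v <-> hasQ f (a - c) h v.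
Proof.
have E1 : e1 (a - c) h = e1 a h - c by rewrite /e1; ring.
have E2 : e2 (a - c) h = e2 a h - c by rewrite /e2; ring.
have E3 : e3 (a - c) h = e3 a h - c by rewrite /e3; ring.
rewrite /hasQ E1 E2 E3.
have H x y u := hasI_shift f x y c u.
split=> -[v1 [v2 [v3 [v4 [h1 h2 h3 h4 ->]]]]]; exists v1, v2, v3, v4; split.
- exact: (H _ _ _).1.
- exact: (H _ _ _).1.
- exact: (H _ _ _).1.
- exact: (H _ _ _).1.
- by [].
- exact: (H _ _ _).2.
- exact: (H _ _ _).2.
- exact: (H _ _ _).2.
- exact: (H _ _ _).2.
- by [].
Qed.

Lemma hasQ_goursat f a h : 0 <= h -> cder_on (sqr a h) f -> hasQ f a h 0.
Proof.
move=> h0 fd; have hK := sqr_convex a h.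
have cs x y (kx : sqr a h x) (ky : sqr a h y) := cder_on_cts hK fd kx ky.
have [k0 k1 k2 k3] := And4 (e0_sqr a h0) (e1_sqr a h0) (e2_sqr a h0) (e3_sqr a h0).
exists (segI f a (e1 a h)), (segI f (e1 a h) (e2 a h)), (segI f (e2 a h) (e3 a h)), (segI f (e3 a h) a).
split; try by apply: segI_has; exact: cs.
have := goursat hK fd k0 k1 k2; have := goursat hK fd k0 k2 k3.
rewrite /tri (segI_rev (cs _ _ k0 k2)) => T1 T2.
rewrite -[LHS]addr0 -{1}T1 -T2; ring.
Qed.

Definition qI f a h := xget 0 (hasQ f a h).
Lemma qIE f a h v : hasQ f a h v -> qI f a h = v.
Proof.
move=> H; rewrite /qI; case: xgetP => [w _ hw|/(_ v)//]; exact: hasQ_unique hw H.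
Qed.
Lemma qI_has f a h : 0 <= h -> cts_bd f a h -> hasQ f a h (qI f a h).
Proof. by move=> h0 /(hasQ_ex h0)[v hv]; rewrite (qIE hv). Qed.

Lemma inside_dist a h z : inside a h z -> exists2 m, 0 < m &
  forall w, bd a h w -> m <= nrm (w - z).
Proof.
move=> [/andP[x0 x1] /andP[y0 y1]].
pose m := Num.min (Num.min (re (z - a)) (h - re (z - a))) (Num.min (im (z - a)) (h - im (z - a))).
have [[m1 m2] [m3 m4]] : ((m <= re (z - a)) /\ (m <= h - re (z - a))) /\
     ((m <= im (z - a)) /\ (m <= h - im (z - a))) by rewrite /m !ge_min !lexx !orbT.
exists m; first by rewrite /m !lt_min; apply/andP; split; apply/andP; split; lra.
move=> w [_]; rewrite !(reB, imB) in m1 m2 m3 m4 *.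
have := re_le (w - z); have := im_le (w - z); rewrite !ler_norml reB imB.
move=> /andP[q1 q2] /andP[q3 q4] []; lra.
Qed.

Lemma contM f g z : {for z, continuous f} -> {for z, continuous g} ->
  {for z, continuous (fun w => f w * g w)}.
Proof. by move=> cf cg; exact: (@cvgM _ _ (nbhs z) _ f g _ _ cf cg). Qed.

Lemma nrmc_gt0 (x : C) : (0 < nrm x) = (x != 0). Proof. exact: nrm_gt0. Qed.


Lemma cder_sub z w : cder (fun x => x - z) w 1.
Proof. by have := cderB (cder_id w) (cder_cst z w); rewrite subr0. Qed.

Lemma kernel_cts g a h z n : (forall w, bd a h w -> {for w, continuous g}) ->
  (forall w, bd a h w -> w != z) -> cts_bd (fun w => g w / (w - z) ^+ n) a h.
Proof.
move=> cg nz w bw; apply: contM; first exact: cg.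
have w0 : (w - z) ^+ n != 0 by rewrite expf_neq0 // subr_eq0 nz.
exact: cder_continuous (cderV (cderX n (cder_sub z w)) w0).
Qed.

Lemma quad_cder f z d (B r : R) : 0 < r ->
  (forall k, nrm k <= r -> nrm (f (z + k) - f z - k * d) <= B * nrm k ^+ 2) -> cder f z d.
Proof.
move=> r0 H e e0; have B0 : 0 < `|B| + 1 by rewrite ltr_wpDl.
exists (Num.min r (e / (`|B| + 1))); first by rewrite lt_min r0 divr_gt0.
move=> k; rewrite lt_min ltr_pdivlMr // => /andP[/ltW/H h1 h2].
apply: le_trans h1 _; rewrite expr2 mulrA ler_wpM2r ?nrm_ge0 //.
apply: le_trans (ltW h2); rewrite mulrC ler_wpM2l ?nrm_ge0 //.
by apply: le_trans (ler_norm _) _; rewrite lerDl.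
Qed.

Definition K1 g a h z := qI (fun w => g w / (w - z) ^+ 1) a h.
Definition K2 g a h z := qI (fun w => g w / (w - z) ^+ 2) a h.
Definition K3 g a h z := qI (fun w => g w / (w - z) ^+ 3) a h.

Section kernels.
Variables (g : C -> C) (a : C) (h m M : R) (z : C).
Hypotheses (h0 : 0 <= h) (m0 : 0 < m) (cg : cts_bd g a h)
  (gM : forall w, bd a h w -> nrm (g w) <= M) (zm : forall w, bd a h w -> m <= nrm (w - z)).

Lemma kernel_far k w : nrm k <= m / 2 -> bd a h w ->
  [/\ w != z, w != z + k, nrm (w - z) / 2 <= nrm (w - (z + k)) & nrm k <= nrm (w - z) / 2].
Proof.
move=> hk bw; have d1 := zm bw.
have d2 : nrm (w - z) / 2 <= nrm (w - (z + k)).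
  have := nrm_sub (w - z) k; rewrite -addrA -opprD => d2; apply: le_trans d2.
  by rewrite lerBrDr -lerBrDl; apply: le_trans hk _; lra.
have d3 : 0 < nrm (w - z) by exact: lt_le_trans m0 d1.
have d4 : 0 < nrm (w - (z + k)) by apply: lt_le_trans d2; rewrite divr_gt0.
split; [by rewrite -subr_eq0 -nrmc_gt0|by rewrite -subr_eq0 -nrmc_gt0|exact: d2|].
by apply: le_trans hk _; rewrite ler_pM2r ?invr_gt0.
Qed.

Lemma K1_quad k : nrm k <= m / 2 ->
  nrm (K1 g a h (z + k) - K1 g a h z - k * K2 g a h z) <= 4 * h * (2 * M / m ^+ 3 * nrm k ^+ 2).
Proof.
move=> hk.
have c0 : nrm (0 : C) <= m / 2 by rewrite nrm0 divr_ge0 // ltW.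
have q1 : hasQ (fun w => g w / (w - (z + k)) ^+ 1) a h (K1 g a h (z + k)).
  apply: (qI_has h0); apply: (kernel_cts cg) => w bw; by have [_ n2 _ _] := kernel_far hk bw.
have q2 : hasQ (fun w => g w / (w - z) ^+ 1) a h (K1 g a h z).
  apply: (qI_has h0); apply: (kernel_cts cg) => w bw; by have [n1 _ _ _] := kernel_far hk bw.
have q3 : hasQ (fun w => g w / (w - z) ^+ 2) a h (K2 g a h z).
  apply: (qI_has h0); apply: (kernel_cts cg) => w bw; by have [n1 _ _ _] := kernel_far hk bw.
have Q := hasQ_lin (- k) q3 (hasQ_lin (-1) q2 q1).
have -> : K1 g a h (z + k) - K1 g a h z - k * K2 g a h z =
  - k * K2 g a h z + (-1 * K1 g a h z + K1 g a h (z + k)) by ring.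
apply: (hasQ_bound h0 Q) => w bw; have [n1 n2 n3 n4] := kernel_far hk bw.
have := zm bw; have := gM bw; move: n1 n2 n3 n4; rewrite -subr_eq0 -(subr_eq0 w (z + k)).
set u := w - z; have -> : w - (z + k) = u - k by rewrite /u; ring.
move=> u0 uk0 n3 n4 hg mu.
have -> : - k * (g w / u ^+ 2) + (-1 * (g w / u ^+ 1) + g w / (u - k) ^+ 1) =
  g w * (k ^+ 2 / (u ^+ 2 * (u - k))) by field; rewrite u0 uk0.
rewrite nrmM [nrm (k ^+ 2 * _)]nrmM nrmV [nrm (u ^+ 2 * _)]nrmM !nrmX.
have U : 0 < nrm u by rewrite nrmc_gt0.
have UK : 0 < nrm (u - k) by rewrite nrmc_gt0.
have -> : 2 * M / m ^+ 3 * nrm k ^+ 2 = M * (nrm k ^+ 2 * (2 / m ^+ 3)) by ring.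
apply: ler_pM; rewrite ?nrm_ge0 ?mulr_ge0 ?invr_ge0 ?exprn_ge0 ?mulr_ge0 ?exprn_ge0 ?nrm_ge0 //.
rewrite ler_wpM2l ?exprn_ge0 ?nrm_ge0 //.
rewrite -[2 / _]invrK lef_pV2 ?posrE ?invr_gt0 ?mulr_gt0 ?exprn_gt0 ?invr_gt0 ?divr_gt0 ?exprn_gt0 //.
rewrite invfM invrK mulrC ler_pdivrMr //.
apply: (@le_trans _ _ (nrm u ^+ 3)).
  by rewrite lerXn2r ?nnegrE ?(ltW m0) ?(ltW U).
by rewrite exprSr -[leRHS]mulrA ler_wpM2l ?exprn_ge0 ?nrm_ge0 //; lra.
Qed.

Lemma K2_quad k : nrm k <= m / 2 ->
  nrm (K2 g a h (z + k) - K2 g a h z - k * (2 * K3 g a h z)) <= 4 * h * (16 * M / m ^+ 4 * nrm k ^+ 2).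
Proof.
move=> hk.
have q1 : hasQ (fun w => g w / (w - (z + k)) ^+ 2) a h (K2 g a h (z + k)).
  apply: (qI_has h0); apply: (kernel_cts cg) => w bw; by have [_ n2 _ _] := kernel_far hk bw.
have q2 : hasQ (fun w => g w / (w - z) ^+ 2) a h (K2 g a h z).
  apply: (qI_has h0); apply: (kernel_cts cg) => w bw; by have [n1 _ _ _] := kernel_far hk bw.
have q3 : hasQ (fun w => g w / (w - z) ^+ 3) a h (K3 g a h z).
  apply: (qI_has h0); apply: (kernel_cts cg) => w bw; by have [n1 _ _ _] := kernel_far hk bw.
have Q := hasQ_lin (- k * 2) q3 (hasQ_lin (-1) q2 q1).
have -> : K2 g a h (z + k) - K2 g a h z - k * (2 * K3 g a h z) =
  - k * 2 * K3 g a h z + (-1 * K2 g a h z + K2 g a h (z + k)) by ring.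
apply: (hasQ_bound h0 Q) => w bw; have [n1 n2 n3 n4] := kernel_far hk bw.
have := zm bw; have := gM bw; move: n1 n2 n3 n4; rewrite -subr_eq0 -(subr_eq0 w (z + k)).
set u := w - z; have -> : w - (z + k) = u - k by rewrite /u; ring.
move=> u0 uk0 n3 n4 hg mu.
have -> : - k * 2 * (g w / u ^+ 3) + (-1 * (g w / u ^+ 2) + g w / (u - k) ^+ 2) =
  g w * (k ^+ 2 * ((3 * u - 2 * k) / (u ^+ 3 * (u - k) ^+ 2))) by field; rewrite u0 uk0.
rewrite nrmM [nrm (k ^+ 2 * _)]nrmM [nrm (_ / _)]nrmM nrmV [nrm (u ^+ 3 * _)]nrmM !nrmX.
have U : 0 < nrm u by rewrite nrmc_gt0.
have UK : 0 < nrm (u - k) by rewrite nrmc_gt0.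
have -> : 16 * M / m ^+ 4 * nrm k ^+ 2 = M * (nrm k ^+ 2 * (16 / m ^+ 4)) by ring.
apply: ler_pM; rewrite ?nrm_ge0 ?mulr_ge0 ?invr_ge0 ?exprn_ge0 ?mulr_ge0 ?exprn_ge0 ?nrm_ge0 //.
rewrite ler_wpM2l ?exprn_ge0 ?nrm_ge0 //.
have t1 : nrm (3 * u - 2 * k) <= 4 * nrm u.
  apply: le_trans (nrmB _ _) _; rewrite !nrmM -!rc_nat !nrm_rc !ger0_norm //; lra.
rewrite ler_pdivrMr ?mulr_gt0 ?exprn_gt0 //.
apply: le_trans t1 _; rewrite mulrAC ler_pdivlMr ?exprn_gt0 //.
apply: (@le_trans _ _ (4 * nrm u * nrm u ^+ 4)).
  by rewrite ler_wpM2l ?mulr_ge0 ?nrm_ge0 // lerXn2r ?nnegrE ?(ltW m0) ?(ltW U).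
have -> : 4 * nrm u * nrm u ^+ 4 = nrm u ^+ 3 * (16 * (nrm u / 2) ^+ 2) by field.
rewrite mulrCA ler_wpM2l // ler_wpM2l ?exprn_ge0 ?nrm_ge0 //.
by rewrite lerXn2r ?nnegrE ?divr_ge0 ?nrm_ge0.
Qed.

Lemma K1_cder : cder (K1 g a h) z (K2 g a h z).
Proof.
apply: (@quad_cder _ _ _ (4 * h * (2 * M / m ^+ 3)) (m / 2)); first exact: divr_gt0.
by move=> k /K1_quad; rewrite !mulrA.
Qed.

Lemma K2_cder : cder (K2 g a h) z (2 * K3 g a h z).
Proof.
apply: (@quad_cder _ _ _ (4 * h * (16 * M / m ^+ 4)) (m / 2)); first exact: divr_gt0.
by move=> k /K2_quad; rewrite !mulrA.
Qed.

Lemma K3_bound : nrm (K3 g a h z) <= 4 * h * (M / m ^+ 3).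
Proof.
have c0 : nrm (0 : C) <= m / 2 by rewrite nrm0 divr_ge0 // ltW.
have q3 : hasQ (fun w => g w / (w - z) ^+ 3) a h (K3 g a h z).
  apply: (qI_has h0); apply: (kernel_cts cg) => w bw; by have [n1 _ _ _] := kernel_far c0 bw.
apply: (hasQ_bound h0 q3) => w bw; rewrite nrmM nrmV nrmX.
apply: ler_pM; rewrite ?nrm_ge0 ?invr_ge0 ?exprn_ge0 ?nrm_ge0 ?gM //.
rewrite lef_pV2 ?posrE ?exprn_gt0 //; last by apply: lt_le_trans m0 _; exact: zm.
rewrite lerXn2r ?nnegrE ?(ltW m0) ?nrm_ge0 //; exact: zm.
Qed.

Lemma K1_bound : nrm (K1 g a h z) <= 4 * h * (M / m).
Proof.
have c0 : nrm (0 : C) <= m / 2 by rewrite nrm0 divr_ge0 // ltW.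
have q3 : hasQ (fun w => g w / (w - z) ^+ 1) a h (K1 g a h z).
  apply: (qI_has h0); apply: (kernel_cts cg) => w bw; by have [n1 _ _ _] := kernel_far c0 bw.
apply: (hasQ_bound h0 q3) => w bw; rewrite nrmM nrmV expr1.
apply: ler_pM; rewrite ?nrm_ge0 ?invr_ge0 ?nrm_ge0 ?gM //.
rewrite lef_pV2 ?posrE //; first exact: zm.
by apply: lt_le_trans m0 _; exact: zm.
Qed.
End kernels.

End Squares.

Section CauchyFormula.
Variable R : realType.
Notation C := (Cplx R).
Implicit Types (f g F : C -> C) (a b c v w z : C) (h m M r : R).

Definition wnd a h z := K1 (fun=> 1) a h z.

Lemma cder_zero_const F a b :
  (forall t, 0 <= t <= 1 -> cder F (cpt a b t) 0) -> F b = F a.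
Proof.
move=> H; have := @hasI_primitive R F (fun=> 0) a b H => /hasI_bound => /(_ 0).
move=> B; apply/eqP; rewrite -subr_eq0; apply/eqP/nrm_lt_eps => e e0.
apply: le_trans (ltW e0); rewrite -(mul0r (nrm (b - a))); apply: B => t _.
by rewrite nrm0.
Qed.

Lemma conv_gt0 (x y t : R) : 0 < x -> 0 < y -> 0 <= t <= 1 -> 0 < x + t * (y - x).
Proof.
move=> x0 y0 /andP[t0 t1]; have [xy|/ltW yx] := leP x y.
  by rewrite ltr_wpDr // mulr_ge0 // subr_ge0.
have -> : x + t * (y - x) = y + (1 - t) * (x - y) by ring.
by rewrite ltr_wpDr // mulr_ge0 // subr_ge0.
Qed.

Lemma inside_convex a h z1 z2 t : inside a h z1 -> inside a h z2 -> 0 <= t <= 1 ->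
  inside a h (cpt z1 z2 t).
Proof.
move=> [/andP[x1' x2] /andP[x3' x4]] [/andP[y1' y2] /andP[y3' y4]] t01.
have x2' : 0 < h - re (z1 - a) by lra.
have x4' : 0 < h - im (z1 - a) by lra.
have y2' : 0 < h - re (z2 - a) by lra.
have y4' : 0 < h - im (z2 - a) by lra.
rewrite /inside !(reB, imB) in x1' x2' x3' x4' y1' y2' y3' y4' *; have [-> ->] := cptE z1 z2 t.
have := conv_gt0 x1' y1' t01; have := conv_gt0 x2' y2' t01.
have := conv_gt0 x3' y3' t01; have := conv_gt0 x4' y4' t01.
by move=> ? ? ? ?; split; apply/andP; split; lra.
Qed.

Lemma cst_cts a h : cts_bd (fun=> 1 : C) a h.
Proof. by move=> z _; exact: cder_continuous (cder_cst 1 z). Qed.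

Lemma wnd_cder a h z : 0 <= h -> inside a h z -> cder (wnd a h) z 0.
Proof.
move=> h0 /inside_dist[m m0 zm].
have -> : 0 = K2 (fun=> 1) a h z.
  apply/esym/qIE/(@hasQ_primitive R (fun w => - (w - z)^-1)) => // w bw.
  have w0 : w - z != 0 by rewrite -nrmc_gt0; apply: lt_le_trans m0 (zm _ bw).
  by have := cderN (cderV (cder_sub z w) w0); rewrite mulNr opprK.
by apply: (@K1_cder R _ a h m 1 z h0 m0 (@cst_cts a h)) => // w _; rewrite nrm1.
Qed.

Lemma wnd_const a h z1 z2 : 0 <= h -> inside a h z1 -> inside a h z2 ->
  wnd a h z1 = wnd a h z2.
Proof.
move=> h0 i1 i2; apply: cder_zero_const => t t01; apply: wnd_cder => //.
exact: inside_convex.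
Qed.

Lemma im_div (u w : C) m : 0 < nrm w ^+ 2 ->
  m * nrm w ^+ 2 <= im u * re w - re u * im w -> m <= im (u / w).
Proof.
move=> w0; have nw : 0 < nrm w by rewrite lt_def nrm_ge0 andbT; apply: contraTneq w0 => ->; rewrite expr0n ltxx.
have wn : w != 0 by rewrite -nrmc_gt0.
set v := u / w; have -> : u = v * w by rewrite /v divfK.
rewrite reM imM nrm_sqr in w0 *.
have -> : (re v * im w + im v * re w) * re w - (re v * re w - im v * im w) * im w =
  im v * (re w ^+ 2 + im w ^+ 2) by ring.
by rewrite ler_pM2r.
Qed.

Definition ctr a h : C := a + rc (h / 2) + rc (h / 2) * ci.
Lemma ctr_inside a h : 0 < h -> inside a h (ctr a h).
Proof.
move=> h0; rewrite /inside /ctr !reB !imB !reD !imD !reM !imM !re_rc !im_rc re_ci im_ci.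
by split; apply/andP; split; lra.
Qed.

Lemma wnd_center a h : 0 < h -> 4 <= im (wnd a h (ctr a h)).
Proof.
move=> h0; have h0' := ltW h0; have [m m0 zm] := inside_dist (ctr_inside a h0).
have Q : hasQ (fun w => 1 / (w - ctr a h) ^+ 1) a h (wnd a h (ctr a h)).
  apply: (qI_has h0'); apply: (kernel_cts (@cst_cts a h)) => w bw.
  by rewrite -subr_eq0 -nrmc_gt0; apply: lt_le_trans m0 (zm _ bw).
have [v1 [v2 [v3 [v4 [H1 H2 H3 H4 ->]]]]] := Q.
have aux p q v : hasI (fun w => 1 / (w - ctr a h) ^+ 1) p q v ->
   (forall t, 0 <= t <= 1 -> bd a h (cpt p q t) /\
      nrm (cpt p q t - ctr a h) ^+ 2 <= im (q - p) * re (cpt p q t - ctr a h) - re (q - p) * im (cpt p q t - ctr a h)) ->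
   1 <= im v.
  move=> Hv B; apply: (hasI_mean_im Hv) => t /B[bt le].
  rewrite expr1 div1r mulrC; apply: im_div; last by rewrite mul1r.
  by rewrite exprn_gt0 //; apply: lt_le_trans m0 (zm _ bt).
have E (t : R) : 0 <= t <= 1 -> t * t <= t by move=> /andP[t0 t1]; rewrite ler_piMr.
have p1 : 1 <= im v1.
  apply: (aux _ _ _ H1) => t t01; split; first by case: (edge_bd a h0' t01).
  rewrite nrm_sqr !reB !imB (cptE _ _ _).1 (cptE _ _ _).2 /ctr !reD !imD !reM !imM !re_rc !im_rc re_ci im_ci.
  have := E t t01; have : 0 <= h * h by rewrite mulr_ge0 ?ltW.
  by move=> hh tt; nra.
have p2 : 1 <= im v2.
  apply: (aux _ _ _ H2) => t t01; split; first by case: (edge_bd a h0' t01).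
  rewrite nrm_sqr !reB !imB (cptE _ _ _).1 (cptE _ _ _).2 /ctr !reD !imD !reM !imM !re_rc !im_rc re_ci im_ci.
  have := E t t01; have : 0 <= h * h by rewrite mulr_ge0 ?ltW.
  by move=> hh tt; nra.
have p3 : 1 <= im v3.
  apply: (aux _ _ _ H3) => t t01; split; first by case: (edge_bd a h0' t01).
  rewrite nrm_sqr !reB !imB (cptE _ _ _).1 (cptE _ _ _).2 /ctr !reD !imD !reM !imM !re_rc !im_rc re_ci im_ci.
  have := E t t01; have : 0 <= h * h by rewrite mulr_ge0 ?ltW.
  by move=> hh tt; nra.
have p4 : 1 <= im v4.
  apply: (aux _ _ _ H4) => t t01; split; first by case: (edge_bd a h0' t01).
  rewrite nrm_sqr !reB !imB (cptE _ _ _).1 (cptE _ _ _).2 /ctr !reD !imD !reM !imM !re_rc !im_rc re_ci im_ci.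
  have := E t t01; have : 0 <= h * h by rewrite mulr_ge0 ?ltW.
  by move=> hh tt; nra.
rewrite !imD; lra.
Qed.

Lemma qI_congr f g a b h : (forall v, hasQ f a h v <-> hasQ g b h v) -> qI f a h = qI g b h.
Proof. by move=> H; rewrite /qI; congr xget; apply/funext => v; apply/propext. Qed.

Lemma wnd_shift a h z : 0 <= h -> wnd a h z = wnd 0 h (z - a).
Proof.
move=> h0; apply: qI_congr => v; have E0 : 0 = a - a by rewrite subrr.
rewrite {1}E0; have H := @hasQ_shift R (fun w => 1 / (w - (z - a)) ^+ 1) a h a v.
apply: iff_trans H; split; apply: hasQ_ext => // w _; congr (_ / _ ^+ _); ring.
Qed.

(* [W h] plays the part of 2 pi i in Cauchy's formula; only the bound 4 <= |W h| is ever needed. *)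
Definition W h := wnd 0 h (ctr 0 h).

Lemma wnd_in a h z : 0 < h -> inside a h z -> wnd a h z = W h.
Proof.
move=> h0 zi; rewrite (wnd_const (ltW h0) zi (ctr_inside a h0)) wnd_shift ?(ltW h0) //.
by congr (wnd _ _ _); rewrite /ctr; ring.
Qed.

Lemma W_ge h : 0 < h -> 4 <= nrm (W h).
Proof. by move=> h0; apply: le_trans (im_le _); apply: le_trans (ler_norm _); exact: wnd_center. Qed.
Lemma W_neq0 h : 0 < h -> W h != 0.
Proof. by move=> h0; rewrite -nrmc_gt0; apply: lt_le_trans (W_ge h0). Qed.

Lemma wnd_out a h z : 0 <= h -> ~ sqr a h z -> wnd a h z = 0.
Proof.
move=> h0 nz; apply/qIE/hasQ_goursat => // w sw.
have w0 : w - z != 0 by rewrite subr_eq0; apply/eqP => wz; apply: nz; rewrite -wz.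
exists (- (1 : C) / (w - z) ^+ 2).
have := cderV (cder_sub z w) w0.
by congr (cder _ _ _); apply/funext => x; rewrite expr1 div1r.
Qed.

Lemma cauchy_prim F f a h z : 0 < h ->
  (forall w, sqr a h w -> exists2 r, 0 < r & forall u, nrm (u - w) < r -> cder F u (f u)) ->
  cder_on (sqr a h) f -> inside a h z -> F z * W h = K1 F a h z.
Proof.
move=> h0 Ff fd zi; have h0' := ltW h0.
have zs : sqr a h z.
  by move: zi => [/andP[x1 x2] /andP[x3 x4]]; split; apply/andP; split; apply: ltW.
have FF w : sqr a h w -> cder F w (f w).
  by move=> /Ff[r r0]; apply; rewrite subrr nrm0.
set G := fun w => if w == z then f z else (F w - F z) / (w - z).
have GQ : hasQ G a h 0.
  apply: hasQ_goursat => // w sw; have [->|wz] := eqVneq w z.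
    have [r r0 Fr] := Ff z zs; have [d hd] := fd z zs.
    by exists (d / 2); exact: cder_quotient r0 Fr hd.
  have w0 : w - z != 0 by rewrite subr_eq0.
  have dq := cderM (cderB (FF w sw) (cder_cst (F z) w)) (cderV (cder_sub z w) w0).
  eexists; apply: (@hasder_ext _ _ _ _ _ _ _ (nrm (w - z))) dq; first by rewrite nrmc_gt0.
  move=> y; rewrite /G; case: eqP => [->|//].
  by rewrite nrmC ltxx.
have [m m0 zm] := inside_dist zi.
have nz w : bd a h w -> w != z.
  by move=> bw; rewrite -subr_eq0 -nrmc_gt0; apply: lt_le_trans m0 (zm _ bw).
have FQ : hasQ (fun w => F w / (w - z) ^+ 1) a h (K1 F a h z).
  apply: (qI_has h0'); apply: kernel_cts nz => w [sw _]; exact: cder_continuous (FF w sw).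
have OQ : hasQ (fun w => 1 / (w - z) ^+ 1) a h (wnd a h z).
  by apply: (qI_has h0'); apply: kernel_cts nz; exact: cst_cts.
have Q := hasQ_lin (- F z) OQ FQ.
have := hasQ_unique Q (hasQ_ext h0' _ GQ).
rewrite (wnd_in h0 zi) => E; apply/eqP; rewrite eq_sym -subr_eq0; apply/eqP.
rewrite -E; first by ring.
move=> w bw; rewrite /G (negbTE (nz _ bw)); have := nz _ bw; rewrite -subr_eq0 => w0.
by field.
Qed.

Lemma inside_near a h z : inside a h z -> exists2 r, 0 < r & forall w, nrm (w - z) < r -> inside a h w.
Proof.
move=> [/andP[x0 x1] /andP[y0 y1]].
pose m := Num.min (Num.min (re (z - a)) (h - re (z - a))) (Num.min (im (z - a)) (h - im (z - a))).
have [[m1 m2] [m3 m4]] : ((m <= re (z - a)) /\ (m <= h - re (z - a))) /\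
     ((m <= im (z - a)) /\ (m <= h - im (z - a))) by rewrite /m !ge_min !lexx !orbT.
exists m; first by rewrite /m !lt_min; apply/andP; split; apply/andP; split; lra.
move=> w wm; rewrite /inside !(reB, imB) in m1 m2 m3 m4 *.
have := le_lt_trans (re_le (w - z)) wm; have := le_lt_trans (im_le (w - z)) wm.
rewrite !ltr_norml reB imB => /andP[? ?] /andP[? ?].
by split; apply/andP; split; lra.
Qed.

Definition hol1 f c r := forall z, nrm (z - c) < r -> exists d, cder f z d.

Lemma cauchy_est f c r M d : 0 < r -> hol1 f c r ->
  (forall z, nrm (z - c) < r -> nrm (f z) <= M) -> cder f c d ->
  nrm d <= 32 * M / r /\
  forall k, nrm k <= r / 8 -> nrm (f (c + k) - f c - k * d) <= 1024 * M / r ^+ 2 * nrm k ^+ 2.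
Proof.
move=> r0 fh fM fd.
pose s := r / 2; have s0 : 0 < s by rewrite divr_gt0.
pose A := c - rc s - rc s * ci; pose a := c - rc (s / 2) - rc (s / 2) * ci.
have AE z : re (z - A) = re (z - c) + s /\ im (z - A) = im (z - c) + s.
  by rewrite /A !reB !imB reM imM !re_rc !im_rc re_ci im_ci; split; ring.
have aE z : re (z - a) = re (z - c) + s / 2 /\ im (z - a) = im (z - c) + s / 2.
  by rewrite /a !reB !imB reM imM !re_rc !im_rc re_ci im_ci; split; ring.
have Ar z : sqr A (2 * s) z -> nrm (z - c) < r.
  move=> [/andP[]]; have [-> ->] := AE z => h1 h2 /andP[h3 h4].
  rewrite -ltr_sqr ?nnegrE ?nrm_ge0 ?(ltW r0) // nrm_sqr.
  have -> : r = 2 * s by rewrite /s; field.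
  nra.
have fA : cder_on (sqr A (2 * s)) f by move=> z /Ar /fh.
have cA : sqr A (2 * s) c.
  by split; have [h1 h2] := AE c; rewrite ?h1 ?h2 subrr ?re0 ?im0; apply/andP; split; lra.
pose F := segI f c.
have Fi z : inside A (2 * s) z -> cder F z (f z).
  move=> /inside_near[e e0 he]; apply: (segI_cder (sqr_convex A (2 * s)) fA cA e0) => w /he.
  by move=> [/andP[x1 x2] /andP[x3 x4]]; split; apply/andP; split; apply: ltW.
have saA z : sqr a s z -> inside A (2 * s) z.
  move=> [/andP[]]; have [-> ->] := aE z => h1 h2 /andP[h3 h4].
  by rewrite /inside; have [-> ->] := AE z; split; apply/andP; split; lra.
have Ff w : sqr a s w -> exists2 e, 0 < e & forall u, nrm (u - w) < e -> cder F u (f u).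
  by move=> /saA /inside_near[e e0 he]; exists e => // u /he/Fi.
have fa : cder_on (sqr a s) f.
  move=> z /saA [/andP[x1 x2] /andP[x3 x4]]; apply: fA.
  by split; apply/andP; split; apply: ltW.
have M0 : 0 <= M by apply: le_trans (nrm_ge0 _) (fM c _); rewrite subrr nrm0.
have FM w : bd a s w -> nrm (F w) <= M * s.
  move=> [sw _]; have := sw => -[/andP[]]; have [-> ->] := aE w => h1 h2 /andP[h3 h4].
  have cs : cts_seg f c w.
    apply: (cder_on_cts (sqr_convex A (2 * s)) fA cA).
    by have [/andP[x1 x2] /andP[x3 x4]] := saA _ sw; split; apply/andP; split; apply: ltW.
  have : nrm (F w) <= M * nrm (w - c).
    apply: (hasI_bound (segI_has cs)) => t t01; apply/fM/Ar.
    apply: (sqr_convex A (2 * s)).1 => //.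
    by have [/andP[x1 x2] /andP[x3 x4]] := saA _ sw; split; apply/andP; split; apply: ltW.
  move/le_trans; apply; rewrite ler_wpM2l //.
  apply: le_trans (nrm_le_reim _) _.
  have : `|re (w - c)| <= s / 2 by rewrite ler_norml; apply/andP; split; lra.
  have : `|im (w - c)| <= s / 2 by rewrite ler_norml; apply/andP; split; lra.
  lra.
have cF : cts_bd F a s by move=> w [/saA/Fi/cder_continuous].
have ci' : inside a s c.
  by split; have [h1 h2] := aE c; rewrite ?h1 ?h2 subrr ?re0 ?im0; apply/andP; split; lra.
have K2E z : inside a s z -> f z * W s = K2 F a s z.
  move=> zi; have [m m0 zm] := inside_dist zi.
  have k1 := K1_cder (ltW s0) m0 cF FM zm.
  have [e e0 he] := inside_near zi.
  apply: cder_unique _ k1.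
  have zA : inside A (2 * s) z.
    by apply: saA; move: zi => [/andP[x1 x2] /andP[x3 x4]]; split; apply/andP; split; apply: ltW.
  have := cderZ (W s) (Fi z zA); rewrite mulrC.
  apply: hasder_ext e0 _ => w /he wi; rewrite mulrC.
  exact: cauchy_prim Ff fa wi.
have cm w : bd a s w -> s / 2 <= nrm (w - c).
  move=> [_ H]; have := re_le (w - c); have := im_le (w - c); move: H; have [-> ->] := aE w.
  rewrite !ler_norml => H /andP[q1 q2] /andP[q3 q4]; case: H; lra.
have s2 : 0 < s / 2 by rewrite divr_gt0.
have dE : d * W s = 2 * K3 F a s c.
  have k2 := K2_cder (ltW s0) s2 cF FM cm.
  apply: cder_unique _ k2; have [e e0 he] := inside_near ci'.
  have := cderZ (W s) fd; rewrite mulrC.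
  by apply: hasder_ext e0 _ => w /he wi; rewrite mulrC K2E.
have W4 := W_ge s0.
split.
  have := K3_bound (ltW s0) s2 cF FM cm => k3.
  have k4 : nrm d * nrm (W s) <= 2 * (4 * s * (M * s / (s / 2) ^+ 3)).
    by rewrite -nrmM dE nrmM -rc_nat nrm_rc ger0_norm // ler_wpM2l.
  have k5 : nrm d * 4 <= nrm d * nrm (W s) by rewrite ler_wpM2l ?nrm_ge0.
  have k6 := le_trans k5 k4.
  rewrite -(ler_pM2r (ltr0n R 4)); apply: le_trans k6 _.
  rewrite le_eqVlt; apply/orP; left; apply/eqP; rewrite /s; field.
  by rewrite gt_eqF.
move=> k hk.
have ki : inside a s (c + k).
  have := le_trans (re_le k) hk; have := le_trans (im_le k) hk; rewrite !ler_norml.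
  move=> /andP[q1 q2] /andP[q3 q4]; split; have [h1 h2] := aE (c + k);
    rewrite ?h1 ?h2 [c + k]addrC addrK; apply/andP; split; rewrite /s; lra.
have hk' : nrm k <= s / 2 / 2 by apply: le_trans hk _; rewrite /s; lra.
have := K2_quad (ltW s0) s2 cF FM cm hk'.
rewrite -!K2E // -dE.
have -> : f (c + k) * W s - f c * W s - k * (d * W s) = (f (c + k) - f c - k * d) * W s by ring.
rewrite nrmM => k4.
set X := nrm (_ - _ - _) in k4 *.
have k5 : X * 4 <= X * nrm (W s) by rewrite ler_wpM2l ?nrm_ge0.
have k6 := le_trans k5 k4.
rewrite -(ler_pM2r (ltr0n R 4)); apply: le_trans k6 _.
rewrite le_eqVlt; apply/orP; left; apply/eqP; rewrite /s; field.
by rewrite gt_eqF.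
Qed.

End CauchyFormula.

(** * Functions of several variables *)

HB.lock Definition dif (R : realType) (V : normedModType (Cplx R)) (f : V -> Cplx R)
  (x v : V) : Cplx R := 'd f x v.

Section SeveralVariables.
Variable R : realType.
Notation C := (Cplx R).
Variable V : normedModType C.
Implicit Types (f g : V -> C) (x y v w : V) (r M e : R).

Definition hol f x r := forall y, nrm (y - x) < r -> differentiable f y.

Lemma difP f x (a : C) u v : dif f x (a *: u + v) = a * dif f x u + dif f x v.
Proof. by rewrite dif.unlock linearP. Qed.
Lemma difD f x u v : dif f x (u + v) = dif f x u + dif f x v.
Proof. by rewrite -[u]scale1r difP mul1r scale1r. Qed.
Lemma dif0 f x : dif f x 0 = 0.
Proof. by rewrite dif.unlock linear0. Qed.
Lemma difZ f x (a : C) v : dif f x (a *: v) = a * dif f x v.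
Proof. by rewrite -[_ *: v]addr0 difP dif0 addr0. Qed.
Lemma difB f x u v : dif f x (u - v) = dif f x u - dif f x v.
Proof. by rewrite -scaleN1r addrC difP mulN1r addrC. Qed.

Lemma dif_hasder f x : differentiable f x -> hasder f x (dif f x).
Proof. by rewrite dif.unlock; exact: differentiable_hasder. Qed.

Lemma dif_bound f x : differentiable f x ->
  exists2 B, 0 < B & forall h, nrm (dif f x h) <= B * nrm h.
Proof. by rewrite dif.unlock; exact: diff_bound. Qed.

Lemma hasder_dif f x (L : V -> C) B : (forall a u v, L (a *: u + v) = a * L u + L v) ->
  (forall h, nrm (L h) <= B * nrm h) -> hasder f x L ->
  differentiable f x /\ forall v, dif f x v = L v.
Proof.
move=> lin bnd hd; have [df E] := @hasder_linear R V C f x L B lin bnd hd.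
by split=> // v; rewrite dif.unlock E.
Qed.

Lemma line_cder f x v (t : C) : differentiable f (x + t *: v) ->
  cder (fun s => f (x + s *: v)) t (dif f (x + t *: v) v).
Proof.
move=> /dif_hasder h e e0; have N0 : 0 < nrm v + 1 by rewrite ltr_wpDl ?nrm_ge0.
have [d d0 dh] := h _ (divr_gt0 e0 N0).
exists (d / (nrm v + 1)); first exact: divr_gt0.
move=> s; rewrite ltr_pdivlMr // => hs.
have /dh : nrm (s *: v) < d.
  by apply: le_lt_trans hs; rewrite nrmZ ler_wpM2l ?nrm_ge0 ?lerDl.
rewrite difZ scalerDl addrA => h1; apply: le_trans h1 _.
rewrite nrmZ mulrAC ler_pdivrMr // -!mulrA ler_wpM2l ?(ltW e0) // ler_wpM2l ?nrm_ge0 //.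
by rewrite lerDl.
Qed.

Lemma cauchyV f x r M : 0 < r -> hol f x r -> (forall y, nrm (y - x) < r -> nrm (f y) <= M) ->
  forall v, nrm (dif f x v) <= 32 * M / r * nrm v /\
    (nrm v <= r / 8 -> nrm (f (x + v) - f x - dif f x v) <= 1024 * M / r ^+ 2 * nrm v ^+ 2).
Proof.
move=> r0 fh fM v.
have [->|v0] := eqVneq v 0.
  split=> [|_]; rewrite dif0 !nrm0 ?expr0n ?mulr0 //.
  by rewrite addr0 subrr subr0 nrm0.
have nv : 0 < nrm v by rewrite nrm_gt0.
pose rho := r / nrm v; have rho0 : 0 < rho by rewrite divr_gt0.
have B (t : C) : nrm (t - 0) < rho -> nrm (x + t *: v - x) < r.
  by rewrite subr0 ltr_pdivlMr // [x + _]addrC addrK nrmZ.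
have h1 : hol1 (fun t : C => f (x + t *: v)) 0 rho.
  by move=> t /B/fh/line_cder ?; eexists; eassumption.
have h2 (t : C) : nrm (t - 0) < rho -> nrm (f (x + t *: v)) <= M by move=> /B/fM.
have d0 : cder (fun s : C => f (x + s *: v)) 0 (dif f x v).
  have := @line_cder f x v 0; rewrite scale0r addr0; apply; apply: fh.
  by rewrite subrr nrm0.
have [c1 c2] := cauchy_est rho0 h1 h2 d0; split.
  apply: le_trans c1 _; rewrite /rho le_eqVlt; apply/orP; left; apply/eqP.
  by field; rewrite !gt_eqF.
move=> hv; have := c2 1; rewrite nrm1 add0r scale1r scale0r addr0 mul1r => /(_ _).
move=> H; apply: le_trans (H _) _.
  by rewrite ler_pdivlMr // mul1r /rho ler_pdivlMr // mulrC -ler_pdivlMr.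
rewrite /rho le_eqVlt; apply/orP; left; apply/eqP.
by field; rewrite !gt_eqF.
Qed.

Lemma diff_bounded (W : normedModType C) (f : V -> W) x : differentiable f x ->
  exists2 r, 0 < r & exists M, forall y, nrm (y - x) < r -> nrm (f y) <= M.
Proof.
move=> /differentiable_continuous/cvg_nrm /(_ 1 ltr01)[r r0 h].
exists r => //; exists (nrm (f x) + 1) => y /h /ltW hy.
have -> : f y = f x + (f y - f x) by rewrite addrC subrK.
by apply: le_trans (nrmD _ _) _; rewrite lerD2l.
Qed.

Definition fsub f g : V -> C := fun y => f y - g y.
Definition fsubc f (c : C) : V -> C := fun y => f y - c.

Lemma diff_sub f g x : differentiable f x -> differentiable g x ->
  differentiable (fsub f g) x /\
  forall v, dif (fsub f g) x v = dif f x v - dif g x v.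
Proof.
move=> df dg; have [A A0 fA] := dif_bound df; have [B B0 gB] := dif_bound dg.
apply: (@hasder_dif _ _ (fun v => dif f x v - dif g x v) (A + B)).
- by move=> a u v; rewrite (difP f) (difP g); ring.
- by move=> h; apply: le_trans (nrmB _ _) _; rewrite mulrDl lerD.
move=> e e0; have e2 : 0 < e / 2 by rewrite divr_gt0.
have [a a0 ah] := dif_hasder df e2; have [b b0 bh] := dif_hasder dg e2.
exists (Num.min a b); first by rewrite lt_min a0.
move=> h; rewrite lt_min => /andP[/ah h1 /bh h2].
have -> : fsub f g (x + h) - fsub f g x - (dif f x h - dif g x h) =
  (f (x + h) - f x - dif f x h) - (g (x + h) - g x - dif g x h) by rewrite /fsub; ring.
by apply: le_trans (nrmB _ _) _; apply: le_trans (lerD h1 h2) _; lra.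
Qed.

Lemma diff_subc f x (c : C) : differentiable f x ->
  differentiable (fsubc f c) x /\ forall v, dif (fsubc f c) x v = dif f x v.
Proof.
move=> df; have [A A0 fA] := dif_bound df.
apply: (@hasder_dif _ _ (dif f x) A) => // [a u v|]; first exact: difP.
move=> e /(dif_hasder df)[d d0 dh]; exists d => // h /dh.
by have -> : fsubc f c (x + h) - fsubc f c x = f (x + h) - f x by rewrite /fsubc; ring.
Qed.

Lemma holB f g x r : hol f x r -> hol g x r -> hol (fsub f g) x r.
Proof. by move=> hf hg y yr; exact: (diff_sub (hf y yr) (hg y yr)).1. Qed.

Lemma weier f x r : 0 < r ->
  (forall e, 0 < e -> exists2 g, hol g x r & forall y, nrm (y - x) < r -> nrm (g y - f y) <= e) ->
  differentiable f x.
Proof.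
move=> r0 H.
have xx s : 0 < s -> nrm (x - x) < s by rewrite subrr nrm0.
have [g0 hg0 gf0] := H 1 ltr01.
have [s s0 [M sM]] := diff_bounded (hg0 x (xx r r0)).
pose r1 := Num.min r s; have r10 : 0 < r1 by rewrite lt_min r0.
have fM y : nrm (y - x) < r1 -> nrm (f y) <= M + 1.
  rewrite lt_min => /andP[yr ys].
  have -> : f y = g0 y - (g0 y - f y) by rewrite opprB addrC subrK.
  by apply: le_trans (nrmB _ _) _; rewrite lerD // ?sM // gf0.
have P k : exists g, hol g x r1 /\ forall y, nrm (y - x) < r1 -> nrm (g y - f y) <= (2 ^+ k)^-1.
  have k0 : (0 : R) < (2 ^+ k)^-1 by rewrite invr_gt0 exprn_gt0.
  have [g h1 h2] := H _ k0.
  by exists g; split=> y; rewrite lt_min => /andP[yr ys]; [exact: h1|exact: h2].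
have [G GP] := choice P.
have Gd k : differentiable (G k) x by apply: (GP k).1; exact: xx.
have p2 k : (0 : R) < 2 ^+ k by rewrite exprn_gt0.
have Gdiff k v : nrm (dif (G k.+1) x v - dif (G k) x v) <= 64 / r1 * nrm v / 2 ^+ k.
  have hh := holB (GP k.+1).1 (GP k).1.
  have hb y : nrm (y - x) < r1 -> nrm (G k.+1 y - G k y) <= 2 / 2 ^+ k.
    move=> yr; have -> : G k.+1 y - G k y = (G k.+1 y - f y) - (G k y - f y) by ring.
    apply: le_trans (nrmB _ _) _.
    have -> : 2 / 2 ^+ k = (2 ^+ k)^-1 + (2 ^+ k)^-1 :> R by field; rewrite gt_eqF.
    rewrite lerD ?(GP k).2 //; apply: le_trans ((GP k.+1).2 y yr) _.
    by rewrite lef_pV2 ?posrE // exprS ler_peMl ?ler1n // ltW.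
  have [h1 _] := cauchyV r10 hh hb v.
  have E : dif (fsub (G k.+1) (G k)) x v = dif (G k.+1) x v - dif (G k) x v.
    exact: (diff_sub (Gd k.+1) (Gd k)).2.
  rewrite -E; apply: le_trans h1 _; rewrite le_eqVlt; apply/orP; left; apply/eqP.
  by field; rewrite !gt_eqF.
have lim v : exists l, forall k, nrm (dif (G k) x v - l) <= 4 * (64 / r1 * nrm v) / 2 ^+ k.
  by apply: complete_cplx => k; exact: Gdiff.
have [L LP] := choice lim.
have small (u : C) (B : R) : (forall k, nrm u <= B / 2 ^+ k) -> u = 0.
  move=> hu; apply: nrm_lt_eps => e e0; have [k hk] := small_pow B e0.
  exact: le_trans (hu k) (ltW hk).
have linL a u v : L (a *: u + v) = a * L u + L v.
  apply/eqP; rewrite -subr_eq0; apply/eqP.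
  apply: (small _ (4 * (64 / r1 * nrm (a *: u + v)) + nrm a * (4 * (64 / r1 * nrm u)) + 4 * (64 / r1 * nrm v))) => k.
  have -> : L (a *: u + v) - (a * L u + L v) =
     - (dif (G k) x (a *: u + v) - L (a *: u + v)) + (a * (dif (G k) x u - L u) + (dif (G k) x v - L v)).
    rewrite difP; ring.
  apply: le_trans (nrmD _ _) _; rewrite nrmN.
  rewrite -(addrA (4 * (64 / r1 * nrm (a *: u + v)))) [leRHS]mulrDl; apply: lerD; first exact: LP.
  apply: le_trans (nrmD _ _) _; rewrite [leRHS]mulrDl; apply: lerD; last exact: LP.
  by rewrite nrmM -mulrA ler_wpM2l ?nrm_ge0 // LP.
have M0 : 0 <= M + 1 by apply: le_trans (nrm_ge0 _) (fM x _); exact: xx.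
have GM k y : nrm (y - x) < r1 -> nrm (G k y) <= M + 2.
  move=> yr; have -> : G k y = f y + (G k y - f y) by rewrite addrC subrK.
  have -> : M + 2 = M + 1 + 1 by ring.
  apply: le_trans (nrmD _ _) _; rewrite lerD ?fM //; apply: le_trans ((GP k).2 y yr) _.
  by rewrite invf_le1 // exprn_ege1 // ler1n.
have Lq v : nrm v <= r1 / 8 -> nrm (f (x + v) - f x - L v) <= 1024 * (M + 2) / r1 ^+ 2 * nrm v ^+ 2.
  move=> vr; apply/ler_addgt0Pl => e e0.
  have [k hk] := small_pow (2 + 4 * (64 / r1 * nrm v)) e0.
  have [_ /(_ vr) h2] := cauchyV r10 (GP k).1 (GM k) v.
  have -> : f (x + v) - f x - L v = (- (G k (x + v) - f (x + v)) + (G k x - f x) + (dif (G k) x v - L v)) +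
       (G k (x + v) - G k x - dif (G k) x v) by ring.
  apply: le_trans (nrmD _ _) _; rewrite lerD //; apply: le_trans (ltW hk).
  have -> : (2 + 4 * (64 / r1 * nrm v)) / 2 ^+ k = (2 ^+ k)^-1 + (2 ^+ k)^-1 + 4 * (64 / r1 * nrm v) / 2 ^+ k.
    by ring.
  have xv : nrm (x + v - x) < r1 by rewrite [x + v]addrC addrK; apply: le_lt_trans vr _; lra.
  apply: le_trans (nrmD _ _) _; rewrite lerD ?LP //.
  by apply: le_trans (nrmD _ _) _; rewrite nrmN lerD // (GP k).2 // xx.
have LB v : nrm (L v) <= (32 * (M + 2) / r1 + 4 * (64 / r1)) * nrm v.
  have [h1 _] := cauchyV r10 (GP 0%N).1 (GM 0%N) v.
  have h2 := LP v 0%N; rewrite divr1 in h2.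
  have -> : L v = dif (G 0%N) x v - (dif (G 0%N) x v - L v) by rewrite opprB addrC subrK.
  apply: le_trans (nrmB _ _) _; apply: le_trans (lerD h1 h2) _.
  by rewrite le_eqVlt; apply/orP; left; apply/eqP; ring.
set Q := 1024 * (M + 2) / r1 ^+ 2 in Lq.
suff hL : hasder f x L by exact: (hasder_dif linL LB hL).1.
move=> e e0; have Q0 : 0 < `|Q| + 1 by rewrite ltr_wpDl.
exists (Num.min (r1 / 8) (e / (`|Q| + 1))); first by rewrite lt_min !divr_gt0.
move=> h; rewrite lt_min => /andP[h1' h2]; rewrite ltr_pdivlMr // in h2.
have h1 := Lq _ (ltW h1').
apply: le_trans h1 _; rewrite expr2 mulrA ler_wpM2r ?nrm_ge0 //.
apply: le_trans (ltW h2); rewrite mulrC ler_wpM2l ?nrm_ge0 //.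
by apply: le_trans (ler_norm _) _; rewrite lerDl.
Qed.

Lemma differentiable_shift f x w : differentiable f (x + w) ->
  differentiable (fun y => f (y + w)) x.
Proof.
move=> df; have [B B0 fB] := dif_bound df.
have [] // := @hasder_dif (fun y => f (y + w)) x (dif f (x + w)) B _ fB _.
  by move=> a u v; exact: difP.
by move=> e /(dif_hasder df)[d d0 dh]; exists d => // h /dh; rewrite [x + w + h]addrAC.
Qed.

Lemma hol_sub f x r y s : hol f x r -> nrm (y - x) + s <= r -> hol f y s.
Proof.
move=> hf ys z zy; apply: hf; apply: le_lt_trans (nrm_tri z y x) _.
by apply: lt_le_trans ys; rewrite addrC ltrD2l.
Qed.

Lemma diff_diff f x r v : 0 < r -> hol f x r -> differentiable (fun y => dif f y v) x.
Proof.
move=> r0 hf.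
have xx s : 0 < s -> nrm (x - x) < s by rewrite subrr nrm0.
have [s s0 [M sM]] := diff_bounded (hf x (xx r r0)).
pose q := Num.min r s / 4; have q0 : 0 < q by rewrite divr_gt0 // lt_min r0.
have q4r : 4 * q <= r by rewrite /q mulrC divfK // ge_min lexx.
have q4s : 4 * q <= s by rewrite /q mulrC divfK // ge_min lexx orbT.
have N0 : 0 < nrm v + 1 by rewrite ltr_wpDl ?nrm_ge0.
have M0 : 0 <= M by apply: le_trans (nrm_ge0 _) (sM x _); exact: xx.
set Q := 1024 * M / q ^+ 2 * (nrm v) ^+ 2.
have Q0 : 0 <= Q.
  apply: mulr_ge0; last exact: exprn_ge0 (nrm_ge0 _).
  by apply: divr_ge0; [apply: mulr_ge0 (ler0n _ _) M0|exact: exprn_ge0 (ltW q0)].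
apply: (@weier _ _ q) => // e e0.
pose t := Num.min (q / 8 / (nrm v + 1)) (e / (Q + 1)).
have Q1 : 0 < Q + 1 by apply: ltr_wpDl.
have t0 : 0 < t by rewrite lt_min; apply/andP; split; apply: divr_gt0 => //; exact: divr_gt0.
have t1 : t * (nrm v + 1) <= q / 8 by rewrite -ler_pdivlMr // ge_min lexx.
have t2 : t * (Q + 1) <= e by rewrite -ler_pdivlMr ?ltr_wpDl // ge_min lexx orbT.
have tv : nrm (rc t *: v) <= q / 8.
  by rewrite nrmZ nrm_rc gtr0_norm //; apply: le_trans t1; rewrite ler_wpM2l ?lerDl ?ltW.
exists (fun y => (rc t)^-1 * (f (y + rc t *: v) - f y)).
  move=> y yq; have d1 : differentiable f y by apply: hf; lra.
  have d2 : differentiable (fun y => f (y + rc t *: v)) y.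
    apply/differentiable_shift/hf; apply: le_lt_trans (nrm_tri _ y _) _.
    rewrite [y + _]addrC addrK; lra.
  have h := (diff_sub d2 d1).1.
  exact: (@differentiableZ _ _ _ _ (rc t)^-1 y h).
move=> y yq.
have hy : hol f y q by apply: hol_sub hf _; lra.
have My z : nrm (z - y) < q -> nrm (f z) <= M.
  by move=> zy; apply: sM; apply: le_lt_trans (nrm_tri _ y _) _; lra.
have [_ /(_ tv)] := cauchyV q0 hy My (rc t *: v).
rewrite difZ => h1.
have rt0 : rc t != 0 by rewrite rc_eq0 gt_eqF.
have -> : (rc t)^-1 * (f (y + rc t *: v) - f y) - dif f y v =
  (rc t)^-1 * (f (y + rc t *: v) - f y - rc t * dif f y v) by field.
rewrite nrmM nrmV nrm_rc gtr0_norm // ler_pdivrMl //.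
apply: le_trans h1 _; rewrite nrmZ nrm_rc gtr0_norm //.
set X := (leLHS); have -> : X = t * (t * Q) by rewrite /X /Q exprMn; ring.
by rewrite ler_wpM2l ?(ltW t0) //; apply: le_trans t2; rewrite ler_wpM2l ?(ltW t0) ?lerDl.
Qed.

Lemma mv_seg f x v M : (forall t : R, 0 <= t <= 1 -> differentiable f (x + rc t *: v) /\
    nrm (dif f (x + rc t *: v) v) <= M) -> nrm (f (x + v) - f x) <= M.
Proof.
move=> H; pose g (s : C) := f (x + s *: v).
have E t : cpt 0 (1 : C) t = rc t by rewrite /cpt subr0 mulr1 add0r.
have h : hasI (fun s : C => dif f (x + s *: v) v) 0 1 (g 1 - g 0).
  by apply: hasI_primitive => t /H[h1 h2]; rewrite E; exact: line_cder.
have := hasI_bound h (M := M); rewrite /g scale1r scale0r addr0 subr0 nrm1 mulr1.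
by apply=> t /H[_]; rewrite E.
Qed.

Lemma dif_dif f x w : differentiable f x ->
  differentiable (dif f x) w /\ forall v, dif (dif f x) w v = dif f x v.
Proof.
move=> /dif_bound[B B0 fB]; apply: (@hasder_dif _ _ (dif f x) B) => //; first exact: difP.
move=> e e0; exists 1 => // h _; rewrite difD [dif f x w + _]addrC addrK subrr nrm0.
by rewrite mulr_ge0 ?nrm_ge0 // ltW.
Qed.

Lemma strict_diff f x r : 0 < r -> hol f x r -> forall e, 0 < e -> exists2 d, 0 < d &
  forall y z, nrm (y - x) < d -> nrm (z - x) < d ->
    nrm (f y - f z - dif f x (y - z)) <= e * nrm (y - z).
Proof.
move=> r0 hf e e0.
have xx s : 0 < s -> nrm (x - x) < s by rewrite subrr nrm0.
have dfx := hf x (xx r r0).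
have [s s0 [M sM]] := diff_bounded dfx.
pose q := Num.min r s; have q0 : 0 < q by rewrite lt_min r0.
have qr : q <= r by rewrite ge_min lexx.
have qs : q <= s by rewrite ge_min lexx orbT.
have hq : hol f x q by move=> y yq; apply: hf; lra.
have Mq y : nrm (y - x) < q -> nrm (f y) <= M by move=> yq; apply: sM; lra.
have M0 : 0 <= M by apply: le_trans (nrm_ge0 _) (sM x _); exact: xx.
set Q := 1024 * M / q ^+ 2.
have Q0 : 0 <= Q.
  by apply: divr_ge0; [apply: mulr_ge0 (ler0n _ _) M0|exact: exprn_ge0 (ltW q0)].
have Qf v : nrm v <= q / 8 -> nrm (f (x + v) - f x - dif f x v) <= Q * nrm v ^+ 2.
  by move=> h; have [_] := cauchyV q0 hq Mq v; exact.
pose d := Num.min (q / 16) (e / (128 * Q + 1)).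
have N0 : 0 < 128 * Q + 1 by rewrite ltr_wpDl // mulr_ge0.
have d0 : 0 < d by rewrite lt_min !divr_gt0.
have d1 : d <= q / 16 by rewrite ge_min lexx.
have d2 : d * (128 * Q + 1) <= e by rewrite -ler_pdivlMr // ge_min lexx orbT.
exists d => // y z yd zd.
have Ld w := (dif_dif w dfx).1; have LE w := (dif_dif w dfx).2.
pose g := fsubc (fsub f (dif f x)) (f x - dif f x x).
have gd w : nrm (w - x) < r -> differentiable g w.
  by move=> wr; exact: (diff_subc _ (diff_sub (hf w wr) (Ld w)).1).1.
have gE w v : nrm (w - x) < r -> dif g w v = dif f w v - dif f x v.
  move=> wr; have dw := hf w wr.
  apply: etrans ((diff_subc _ (diff_sub dw (Ld w)).1).2 v) _.
  apply: etrans ((diff_sub dw (Ld w)).2 v) _; congr (_ - _).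
  exact: LE.
have gv w : g w = f w - f x - (dif f x w - dif f x x) by rewrite /g /fsubc /fsub; ring.
have gq w : nrm (w - x) <= q / 8 -> nrm (g w) <= Q * nrm (w - x) ^+ 2.
  by move=> /Qf; rewrite [x + _]addrC subrK difB gv.
have gder w v : nrm (w - x) < d -> nrm (dif g w v) <= 128 * Q * d * nrm v.
  move=> wd.
  have hg : hol g w d.
    by move=> u ud; apply: gd; apply: le_lt_trans (nrm_tri _ w _) _; lra.
  have Mg u : nrm (u - w) < d -> nrm (g u) <= Q * (2 * d) ^+ 2.
    move=> ud; have u2 : nrm (u - x) <= 2 * d by apply: le_trans (nrm_tri _ w _) _; lra.
    apply: le_trans (gq _ _) _; first by lra.
    by rewrite ler_wpM2l // lerXn2r ?nnegrE ?nrm_ge0 // mulr_ge0 // ltW.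
  have [h _] := cauchyV d0 hg Mg v; apply: le_trans h _.
  rewrite le_eqVlt; apply/orP; left; apply/eqP; field.
  by rewrite gt_eqF.
have -> : f y - f z - dif f x (y - z) = g (z + (y - z)) - g z.
  rewrite [z + _]addrC subrK difB !gv; ring.
apply: le_trans (_ : 128 * Q * d * nrm (y - z) <= _); last first.
  by rewrite ler_wpM2r ?nrm_ge0 //; lra.
apply: mv_seg => t /andP[t0 t1].
have h : nrm (z + rc t *: (y - z) - x) < d.
  have -> : z + rc t *: (y - z) - x = rc (1 - t) *: (z - x) + rc t *: (y - x).
    rewrite rcB rc1 scalerBl scale1r addrAC -[RHS]addrA; congr (_ + _).
    by rewrite addrC -scalerBr opprB addrA subrK.
  apply: le_lt_trans (nrmD _ _) _; rewrite !nrmZ !nrm_rc !ger0_norm ?subr_ge0 //.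
  have [t00|tp] := leP t 0.
    have -> : t = 0 by apply/le_anti; rewrite t00.
    by rewrite subr0 mul1r mul0r addr0.
  have : t * nrm (y - x) < t * d by rewrite ltr_pM2l.
  have : (1 - t) * nrm (z - x) <= (1 - t) * d by rewrite ler_wpM2l ?subr_ge0 ?(ltW zd).
  lra.
by split; [apply: gd; lra|exact: gder].
Qed.

End SeveralVariables.

(** * Zeros of functions of one variable *)

Section OneVariable.
Variable R : realType.
Notation C := (Cplx R).
Implicit Types (f g F : C -> C) (a b c v w z : C) (h s m M r : R).

Lemma hol1P f c r : hol1 f c r <-> hol f c r.
Proof. by split=> H z /H /differentiable_ex_cder. Qed.

Lemma cder_difE f z d : cder f z d -> dif f z 1 = d.
Proof. by rewrite dif.unlock => /cder_differentiable[]. Qed.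

Lemma hol1_cder f c r z : hol1 f c r -> nrm (z - c) < r -> cder f z (dif f z 1).
Proof. by move=> hf /hf[d hd]; rewrite (cder_difE hd). Qed.

Lemma hol1_dif f c r : 0 < r -> hol1 f c r -> hol1 (fun z => dif f z 1) c r.
Proof.
move=> r0 /hol1P hf z zr; apply/differentiable_ex_cder.
apply: (@diff_diff R C f z (r - nrm (z - c)) 1); first by rewrite subr_gt0.
by apply: hol_sub hf _; rewrite addrC subrK.
Qed.

Definition sa c s : C := c - rc (s / 2) - rc (s / 2) * ci.

Lemma saE c s z : re (z - sa c s) = re (z - c) + s / 2 /\ im (z - sa c s) = im (z - c) + s / 2.
Proof. by rewrite /sa !reB !imB reM imM !re_rc !im_rc re_ci im_ci; split; ring. Qed.

Lemma sa_ball c s z : sqr (sa c s) s z -> nrm (z - c) <= s.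
Proof.
move=> [/andP[]]; have [-> ->] := saE c s z => h1 h2 /andP[h3 h4].
apply: le_trans (nrm_le_reim _) _.
have : `|re (z - c)| <= s / 2 by rewrite ler_norml; apply/andP; split; lra.
have : `|im (z - c)| <= s / 2 by rewrite ler_norml; apply/andP; split; lra.
lra.
Qed.

Lemma sa_bd c s w : bd (sa c s) s w -> s / 2 <= nrm (w - c).
Proof.
move=> [_ H]; have := re_le (w - c); have := im_le (w - c); move: H; have [-> ->] := saE c s w.
rewrite !ler_norml => H /andP[q1 q2] /andP[q3 q4]; case: H; lra.
Qed.

Lemma sa_inside c s z : 0 < s -> nrm (z - c) <= s / 4 -> inside (sa c s) s z.
Proof.
move=> s0 zs; have := le_trans (re_le (z - c)) zs; have := le_trans (im_le (z - c)) zs.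
rewrite !ler_norml => /andP[? ?] /andP[? ?]; have [h1 h2] := saE c s z.
by split; rewrite ?h1 ?h2; apply/andP; split; lra.
Qed.

Definition hol_near (K : C -> Prop) f := forall w, K w -> exists2 r, 0 < r & hol1 f w r.

Lemma cauchy_self f c s z : 0 < s -> hol_near (sqr (sa c s) s) f -> inside (sa c s) s z ->
  f z * W s = K1 f (sa c s) s z.
Proof.
move=> s0 hf; apply: (@cauchy_prim R f (fun z => dif f z 1)) => // w /hf[r r0 hr].
  by exists r => // u; exact: hol1_cder.
by apply: (hol1_dif r0 hr); rewrite subrr nrm0.
Qed.

Lemma maxbd f c s M : 0 < s -> hol_near (sqr (sa c s) s) f ->
  (forall w, bd (sa c s) s w -> nrm (f w) <= M) ->
  forall z, nrm (z - c) <= s / 4 -> nrm (f z) <= 4 * M.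
Proof.
move=> s0 hf fM z zs; have E := cauchy_self s0 hf (sa_inside s0 zs).
have m0 : 0 < s / 4 by rewrite divr_gt0.
have zm w : bd (sa c s) s w -> s / 4 <= nrm (w - z).
  move=> /sa_bd sw; have := nrm_sub (w - c) (z - c).
  have -> : w - c - (z - c) = w - z by ring.
  lra.
have cf : cts_bd f (sa c s) s.
  by move=> w [/hf[r r0 hr] _]; have [|d] := hr w; rewrite ?subrr ?nrm0 //; exact: cder_continuous.
have := K1_bound (ltW s0) m0 cf fM zm; rewrite -E nrmM => k1.
have k2 : nrm (f z) * 4 <= nrm (f z) * nrm (W s) by rewrite ler_wpM2l ?nrm_ge0 // W_ge.
have := le_trans k2 k1.
have -> : 4 * s * (M / (s / 4)) = 4 * M * 4 by field; rewrite gt_eqF.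
by rewrite ler_pM2r.
Qed.

(* Otherwise 1/f violates the maximum principle [maxbd]. *)
Lemma hurwitz f c s m : 0 < s -> 0 < m -> hol_near (sqr (sa c s) s) f ->
  (forall w, bd (sa c s) s w -> m <= nrm (f w)) -> 4 * nrm (f c) < m ->
  exists2 z, nrm (z - c) <= s & f z = 0.
Proof.
move=> s0 m0 hf fm fc; apply: contrapT => H.
have nz z : sqr (sa c s) s z -> f z != 0.
  by move=> /sa_ball zs; apply/eqP => fz; apply: H; exists z.
pose g z := (f z)^-1.
have hg : hol_near (sqr (sa c s) s) g.
  move=> w sw; have [r r0 hr] := hf w sw; have fw := nz w sw.
  have [d hd] : exists d, cder f w d by apply: hr; rewrite subrr nrm0.
  have fw0 : 0 < nrm (f w) by rewrite nrmc_gt0.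
  have [e e0 he] := (cvg_nrm f w).1 (cder_continuous hd) _ fw0.
  exists (Num.min r e); first by rewrite lt_min r0.
  move=> z; rewrite lt_min => /andP[/hr[d' hd'] /he hz].
  have fz : f z != 0.
    by apply/eqP => fz; move: hz; rewrite fz sub0r nrmN ltxx.
  by eexists; exact: cderV hd' fz.
have gM w : bd (sa c s) s w -> nrm (g w) <= m^-1.
  move=> bw; rewrite /g nrmV lef_pV2 ?posrE ?fm //.
  by apply: lt_le_trans m0 _; exact: fm.
have cc : nrm (c - c) <= s / 4 by rewrite subrr nrm0 divr_ge0 // ltW.
have := maxbd s0 hg gM cc; rewrite /g nrmV.
have fc0 : 0 < nrm (f c).
  rewrite nrmc_gt0; apply: nz; have [/andP[x1 x2] /andP[x3 x4]] := sa_inside s0 cc.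
  by split; apply/andP; split; apply: ltW.
rewrite -div1r ler_pdivrMr // mulrAC ler_pdivlMr // mul1r; lra.
Qed.

(* The maximum principle bounds f(z)/(z - c)^k by M (2/s)^k, a bound that tends to 0 after multiplying
   back by (z - c)^k with |z - c| <= s/4. *)
Lemma flat_zero f c r M : 0 < r -> hol1 f c r -> (forall z, nrm (z - c) < r -> nrm (f z) <= M) ->
  (forall k : nat, exists B, exists2 q, 0 < q & forall z, nrm (z - c) < q -> nrm (f z) <= B * nrm (z - c) ^+ k) ->
  forall z, nrm (z - c) <= r / 8 -> f z = 0.
Proof.
move=> r0 hf fM fl z zr.
pose s := r / 2; have s0 : 0 < s by rewrite divr_gt0.
have sr w : sqr (sa c s) s w -> nrm (w - c) < r.
  by move=> /sa_ball h; apply: le_lt_trans h _; rewrite /s; lra.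
have cr : nrm (c - c) < r by rewrite subrr nrm0.
have fc : f c = 0.
  have [B [q q0 /(_ c)]] := fl 1%N; rewrite subrr nrm0 expr0n mulr0 => /(_ q0) h.
  by apply/eqP; rewrite -nrm_eq0; apply/eqP/le_anti; rewrite h nrm_ge0.
have [->//|zc] := eqVneq z c.
pose g k w := f w / (w - c) ^+ k.
have M0 : 0 <= M by apply: le_trans (nrm_ge0 _) (fM c cr).
have gh k : hol_near (sqr (sa c s) s) (g k).
  suff H : hol1 (g k) c r.
    move=> w /sr wr; exists (r - nrm (w - c)); first by rewrite subr_gt0.
    move=> u uw; apply: H; apply: le_lt_trans (nrm_tri _ w _) _; lra.
  move=> w wr; have [->|wc] := eqVneq w c; last first.
    have [d hd] := hf w wr; have w0 : (w - c) ^+ k != 0 by rewrite expf_neq0 // subr_eq0.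
    by eexists; exact: cderM hd (cderV (cderX k (cder_sub c w)) w0).
  have [B [q q0 Bq]] := fl k.+2.
  exists 0; apply: (@quad_cder _ _ _ _ B (q / 2)); first by rewrite divr_gt0.
  move=> u uq; rewrite /g fc mul0r mulr0 !subr0 [c + u]addrC addrK.
  have [->|u0] := eqVneq u 0.
    by rewrite add0r fc mul0r nrm0 expr0n mulr0.
  rewrite nrmM nrmV nrmX ler_pdivrMr ?exprn_gt0 ?nrmc_gt0 //.
  have := Bq (u + c); rewrite addrK => /(_ _).
  rewrite -mulrA -exprD add2n; apply; apply: le_lt_trans uq _; lra.
have gM k w : bd (sa c s) s w -> nrm (g k w) <= M * (2 / s) ^+ k.
  move=> bw; have := sa_bd bw => h1; have s2 : 0 < s / 2 by rewrite divr_gt0.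
  rewrite nrmM nrmV nrmX; apply: ler_pM; rewrite ?nrm_ge0 ?invr_ge0 ?exprn_ge0 ?nrm_ge0 //.
    by apply: fM; apply: sr; case: bw.
  have -> : 2 / s = (s / 2)^-1 by field; rewrite gt_eqF.
  rewrite exprVn lef_pV2 ?posrE ?exprn_gt0 //; last by apply: lt_le_trans h1.
  by rewrite lerXn2r ?nnegrE ?nrm_ge0 // ltW.
have zs : nrm (z - c) <= s / 4 by rewrite /s; lra.
have zp : 0 < nrm (z - c) by rewrite nrmc_gt0 subr_eq0.
apply: nrm_lt_eps => e e0; have [k hk] := small_pow (4 * M) e0.
apply: le_trans (ltW hk).
have := maxbd s0 (gh k) (gM k) zs; rewrite /g nrmM nrmV nrmX ler_pdivrMr ?exprn_gt0 //.
move/le_trans; apply; rewrite -!mulrA ler_wpM2l // ler_wpM2l // -exprMn -exprVn.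
rewrite lerXn2r ?nnegrE ?mulr_ge0 ?invr_ge0 ?(ltW s0) ?(ltW zp) //.
apply: (@le_trans _ _ (2 / s * (s / 4))); first by rewrite ler_wpM2l // divr_ge0 // ltW.
by rewrite le_eqVlt; apply/orP; left; apply/eqP; field; rewrite gt_eqF.
Qed.

Definition quot f a z : C := if z == a then dif f a 1 else (f z - f a) / (z - a).

Lemma quot_hol1 f c r a : hol1 f c r -> nrm (a - c) < r -> hol1 (quot f a) c r.
Proof.
move=> hf ar z zr; have r0 : 0 < r by apply: le_lt_trans ar; exact: nrm_ge0.
have [->|za] := eqVneq z a.
  have [d hd] := hol1_dif r0 hf ar.
  have ra : 0 < r - nrm (a - c) by rewrite subr_gt0.
  have Hf w : nrm (w - a) < r - nrm (a - c) -> cder f w (dif f w 1).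
    by move=> wa; apply: (hol1_cder hf); apply: le_lt_trans (nrm_tri _ a _) _; lra.
  by eexists; exact: cder_quotient ra Hf hd.
have z0 : z - a != 0 by rewrite subr_eq0.
have [d hd] := hf z zr.
have dq := cderM (cderB hd (cder_cst (f a) z)) (cderV (cder_sub a z) z0).
eexists; apply: (@hasder_ext _ _ _ _ _ _ _ (nrm (z - a))) dq; first by rewrite nrmc_gt0.
move=> y; rewrite /quot; case: eqP => [->|//].
by rewrite nrmC ltxx.
Qed.

Lemma seg_min g p q : cts_seg g p q -> (forall t, 0 <= t <= 1 -> g (cpt p q t) != 0) ->
  exists2 m, 0 < m & forall t, 0 <= t <= 1 -> m <= nrm (g (cpt p q t)).
Proof.
move=> cg g0; pose u (t : R) := nrm (g (cpt p q t)).
have cu : {within `[0, 1], continuous u}.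
  apply: continuous_in_subspaceT => t /set_mem; rewrite /= in_itv /= => t01.
  apply/cvgrPdist_lt => e e0.
  have [d d0 dh] := (cvg_nrm g _).1 (cg t t01) e e0.
  have N0 : 0 < nrm (q - p) + 1 by rewrite ltr_wpDl ?nrm_ge0.
  exists (d / (nrm (q - p) + 1)) => /=; first exact: divr_gt0.
  move=> x /=; rewrite ltr_pdivlMr // => tx.
  have /dh : nrm (cpt p q x - cpt p q t) < d.
    rewrite nrm_cpt distrC; apply: le_lt_trans tx.
    by rewrite ler_wpM2l // lerDl.
  rewrite /u => h1; apply: le_lt_trans h1; rewrite ler_norml.
  have := nrm_sub (g (cpt p q x)) (g (cpt p q t)); have := nrm_sub (g (cpt p q t)) (g (cpt p q x)).
  rewrite [nrm (g (cpt p q t) - _)]nrmC; move=> ? ?; apply/andP; split; lra.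
have [t0 t01 H] := EVT_min ler01 cu.
have t01' : 0 <= t0 <= 1 by move: t01; rewrite in_itv.
exists (u t0); first by rewrite nrmc_gt0; apply: g0.
by move=> t tt; apply: H; rewrite in_itv.
Qed.

Lemma bd_min g a h : 0 <= h -> (forall w, bd a h w -> {for w, continuous g}) ->
  (forall w, bd a h w -> g w != 0) -> exists2 m, 0 < m & forall w, bd a h w -> m <= nrm (g w).
Proof.
move=> h0 cg g0.
have seg p q : (forall t, 0 <= t <= 1 -> bd a h (cpt p q t)) ->
    exists2 m, 0 < m & forall t, 0 <= t <= 1 -> m <= nrm (g (cpt p q t)).
  by move=> B; apply: seg_min => t /B; [exact: cg|exact: g0].
have [m1 m10 h1] := seg _ _ (fun t t01 => let: And4 e _ _ _ := edge_bd a h0 t01 in e).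
have [m2 m20 h2] := seg _ _ (fun t t01 => let: And4 _ e _ _ := edge_bd a h0 t01 in e).
have [m3 m30 h3] := seg _ _ (fun t t01 => let: And4 _ _ e _ := edge_bd a h0 t01 in e).
have [m4 m40 h4] := seg _ _ (fun t t01 => let: And4 _ _ _ e := edge_bd a h0 t01 in e).
exists (Num.min (Num.min m1 m2) (Num.min m3 m4)); first by rewrite !lt_min m10 m20 m30.
move=> w bw; suff : exists t, 0 <= t <= 1 /\ [\/ w = cpt a (a + rc h) t,
    w = cpt (a + rc h) (a + rc h + rc h * ci) t,
    w = cpt (a + rc h + rc h * ci) (a + rc h * ci) t | w = cpt (a + rc h * ci) a t].
  move=> [t [t01 []] ->]; rewrite !ge_min.
  - by rewrite h1.
  - by rewrite h2 // orbT.
  - by rewrite h3 // !orbT.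
  - by rewrite h4 // !orbT.
move: bw => [[/andP[x0 x1] /andP[y0 y1]] E]; rewrite !reB !imB in x0 x1 y0 y1 E.
have [hz|hp] := eqVneq h 0.
  exists 0; rewrite lexx ler01; split => //; constructor 1.
  by apply: c_eq; rewrite ?(cptE _ _ _).1 ?(cptE _ _ _).2 ?reD ?imD; rewrite hz in x1 y1; lra.
have hp' : 0 < h by rewrite lt_def hp.
have t01 x : 0 <= x <= h -> 0 <= x / h <= 1.
  by move=> /andP[? ?]; rewrite divr_ge0 //= ler_pdivrMr // mul1r.
have t01' x : 0 <= x <= h -> 0 <= 1 - x / h <= 1 by move=> /t01 /andP[? ?]; apply/andP; split; lra.
have simp := (reD, imD, reM, imM, re_rc, im_rc, @re_ci R, @im_ci R).
case: E => E.
- exists (1 - (im w - im a) / h); split; first by apply: t01'; apply/andP; split.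
  by constructor 4; apply: c_eq; rewrite ?(cptE _ _ _).1 ?(cptE _ _ _).2 !simp; [lra|field].
- exists ((im w - im a) / h); split; first by apply: t01; apply/andP; split.
  by constructor 2; apply: c_eq; rewrite ?(cptE _ _ _).1 ?(cptE _ _ _).2 !simp; [lra|field].
- exists ((re w - re a) / h); split; first by apply: t01; apply/andP; split.
  by constructor 1; apply: c_eq; rewrite ?(cptE _ _ _).1 ?(cptE _ _ _).2 !simp; [field|lra].
- exists (1 - (re w - re a) / h); split; first by apply: t01'; apply/andP; split.
  by constructor 3; apply: c_eq; rewrite ?(cptE _ _ _).1 ?(cptE _ _ _).2 !simp; [field|lra].
Qed.

(* If f'(c) = 0, Hurwitz's theorem applied to the difference quotient of f at a nearby point z1 with
   f'(z1) <> 0 gives z <> z1 with f z = f z1. *)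
Lemma inj_cder_neq0 f c r : 0 < r -> hol1 f c r ->
  (forall x y, nrm (x - c) < r -> nrm (y - c) < r -> f x = f y -> x = y) -> dif f c 1 != 0.
Proof.
move=> r0 hf inj; apply/eqP => d0.
have cr : nrm (c - c) < r by rewrite subrr nrm0.
pose s := r / 2; have s0 : 0 < s by rewrite divr_gt0.
have sr w : sqr (sa c s) s w -> nrm (w - c) < r.
  by move=> /sa_ball h; apply: le_lt_trans h _; rewrite /s; lra.
have [m m0 hm] : exists2 m, 0 < m & forall w, bd (sa c s) s w -> m <= nrm (f w - f c).
  apply: (bd_min (ltW s0)) => w bw.
    have [d hd] := hf w (sr w bw.1).
    exact: cder_continuous (cderB hd (cder_cst (f c) w)).
  rewrite subr_eq0; apply/eqP => /(inj _ _ (sr w bw.1) cr) wc.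
  by have := sa_bd bw; rewrite wc subrr nrm0; lra.
have hc := hol1_cder hf cr; rewrite d0 in hc.
have e0 : 0 < Num.min (m / 2 / r) (m / (32 * r)) by rewrite lt_min !divr_gt0 // mulr_gt0.
have [q q0 hq] := hc _ e0.
set e := Num.min _ _ in e0 hq.
have e1 : e * r <= m / 2 by rewrite -ler_pdivlMr // ge_min lexx.
have e2 : e * (32 * r) <= m by rewrite -ler_pdivlMr ?mulr_gt0 // ge_min lexx orbT.
pose q' := Num.min q (r / 8).
have q'0 : 0 < q' by rewrite lt_min q0 divr_gt0.
have [z1 z1q dz1] : exists2 z1, nrm (z1 - c) < q' & dif f z1 1 != 0.
  apply: contrapT => H.
  have const z : nrm (z - c) < q' -> f z = f c.
    move=> zq; apply: cder_zero_const => t /andP[t0 t1].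
    have hz : nrm (cpt c z t - c) < q'.
      have -> : cpt c z t - c = rc t * (z - c) by rewrite /cpt; ring.
      by rewrite nrmM nrm_rc ger0_norm //; apply: le_lt_trans zq; rewrite ler_piMl ?nrm_ge0.
    have hr : nrm (cpt c z t - c) < r.
      apply: lt_trans hz _; apply: (@le_lt_trans _ _ (r / 8)); last by lra.
      by rewrite ge_min lexx orbT.
    have -> : 0 = dif f (cpt c z t) 1.
      by apply/esym/eqP; apply: contrapT => /negP nz; apply: H; exists (cpt c z t).
    exact: hol1_cder hf hr.
  have zq : nrm (c + rc (q' / 2) - c) < q'.
    by rewrite [c + _]addrC addrK nrm_rc gtr0_norm ?divr_gt0 //; lra.
  have zr : nrm (c + rc (q' / 2) - c) < r.
    apply: lt_trans zq _; apply: (@le_lt_trans _ _ (r / 8)); last by lra.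
    by rewrite ge_min lexx orbT.
  have /(congr1 (fun x => x - c)) := inj _ _ zr cr (const _ zq).
  rewrite [c + _]addrC addrK subrr => /eqP; rewrite rc_eq0 => /eqP; lra.
have z1c : z1 != c by apply: contraNneq dz1 => ->; rewrite d0.
have [z1q1 z1q2] : nrm (z1 - c) < q /\ nrm (z1 - c) < r / 8.
  by move: z1q; rewrite lt_min => /andP[].
have z1r : nrm (z1 - c) < r by lra.
have fz1 : nrm (f z1 - f c) <= e * nrm (z1 - c).
  by have := hq (z1 - c) z1q1; rewrite [c + _]addrC subrK mulr0 subr0.
have hv := quot_hol1 hf z1r.
have hvn : hol_near (sqr (sa c s) s) (quot f z1).
  move=> w /sr wr; exists (r - nrm (w - c)); first by rewrite subr_gt0.
  move=> u uw; apply: hv; apply: le_lt_trans (nrm_tri _ w _) _; lra.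
have m1 : 0 < m / 2 / (2 * r) by rewrite !divr_gt0 // mulr_gt0.
have [||z zs] := hurwitz s0 m1 hvn.
- move=> w bw; have wr := sr w bw.1.
  have wz : w != z1.
    apply/eqP => E; have := sa_bd bw; rewrite E /s; lra.
  rewrite /quot (negbTE wz) nrmM nrmV.
  have w1 : nrm (w - z1) <= 2 * r.
    apply: le_trans (nrm_tri _ c _) _; rewrite [nrm (c - _)]nrmC; lra.
  have wp : 0 < nrm (w - z1) by rewrite nrmc_gt0 subr_eq0.
  apply: ler_pM; rewrite ?divr_ge0 ?(ltW m0) ?invr_ge0 ?mulr_ge0 ?(ltW r0) //; last first.
    by rewrite lef_pV2 ?posrE ?mulr_gt0.
  have := nrm_sub (f w - f c) (f z1 - f c); have := hm w bw.
  have -> : f w - f c - (f z1 - f c) = f w - f z1 by ring.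
  have : e * nrm (z1 - c) <= e * r by rewrite ler_wpM2l ?(ltW e0) // ltW.
  lra.
- rewrite /quot eq_sym (negbTE z1c) nrmM nrmV [nrm (c - z1)]nrmC [nrm (f c - _)]nrmC.
  have zp : 0 < nrm (z1 - c) by rewrite nrmc_gt0 subr_eq0.
  have : nrm (f z1 - f c) / nrm (z1 - c) <= e by rewrite ler_pdivrMr.
  have -> : m / 2 / (2 * r) = m / (4 * r) by field; rewrite gt_eqF.
  have : e * 8 <= m / (4 * r).
    rewrite ler_pdivlMr ?mulr_gt0 //; lra.
  lra.
have zr : nrm (z - c) < r by rewrite /s in zs; lra.
rewrite /quot; case: eqP => [_ /eqP|/eqP zz /eqP]; first by rewrite (negbTE dz1).
rewrite mulf_eq0 invr_eq0 subr_eq0 => /orP[/eqP /(inj _ _ zr z1r) /eqP|].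
  by rewrite (negbTE zz).
by rewrite subr_eq0 (negbTE zz).
Qed.

Definition entire1 f := forall z, exists d, cder f z d.

Lemma entire1_hol1 f c r : entire1 f -> hol1 f c r.
Proof. by move=> hf z _; exact: hf. Qed.

Lemma entire1_quot f a : entire1 f -> entire1 (quot f a).
Proof.
move=> hf z; apply: (@quot_hol1 f a (nrm (z - a) + 1) a); rewrite ?subrr ?nrm0.
- exact: entire1_hol1.
- by rewrite ltr_wpDl ?nrm_ge0.
- by rewrite ltrDl.
Qed.

Lemma entire1_prim f : entire1 f -> exists F, forall z, cder F z (f z).
Proof.
move=> hf; exists (segI f 0) => z.
pose r := nrm z + 1; have r0 : 0 < r by rewrite ltr_wpDl ?nrm_ge0.
have sq w : nrm w < r -> sqr (sa 0 (2 * r)) (2 * r) w.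
  move=> wr; have := le_trans (re_le w) (ltW wr); have := le_trans (im_le w) (ltW wr).
  rewrite !ler_norml => /andP[? ?] /andP[? ?]; have [h1 h2] := saE 0 (2 * r) w.
  by split; rewrite ?h1 ?h2 subr0; apply/andP; split; lra.
apply: (@segI_cder R (sqr (sa 0 (2 * r)) (2 * r)) f 0 z 1) => //.
- exact: sqr_convex.
- by apply: sq; rewrite nrm0.
- move=> w wz; apply: sq; have := nrm_sub w z; rewrite /r; lra.
Qed.

End OneVariable.

(** * Compactness *)

Section Compactness.
Variable R : realType.
Notation C := (Cplx R).

Lemma compact_eps (T : topologicalType) (K : set T) (P : R -> T -> Prop) : compact K ->
  (forall e e' x, 0 < e' -> e' <= e -> P e x -> P e' x) ->
  (forall x, K x -> exists2 e, 0 < e & nbhs x [set y | P e y]) ->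
  exists2 e, 0 < e & forall x, K x -> P e x.
Proof.
move=> /compact_near_coveringP cK mono loc.
have inv0 n : (0 : R) < n.+1%:R^-1 by rewrite invr_gt0 ltr0n.
have H : \forall n \near \oo, K `<=` [set x | P (n.+1%:R^-1) x].
  apply: (cK nat \oo (fun n x => P (n.+1%:R^-1) x)) => x /loc[e e0 ex].
  exists ([set y | P e y], [set n | (Num.truncn e^-1 <= n)%N]) => /=.
    by split => //; exists (Num.truncn e^-1).
  move=> [y n] /= [Py hn]; apply: mono Py => //.
  rewrite -[e]invrK lef_pV2 ?posrE ?invr_gt0 ?ltr0n //.
  by apply: le_trans (ltW (truncnS_gt _)) _; rewrite ler_nat ltnS.
have [N _ HN] := H; exists (N.+1%:R^-1) => // x Kx.
exact: (HN N (leqnn N)).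
Qed.

Lemma compact_bound (T : topologicalType) (K : set T) (u : T -> R) : compact K ->
  (forall x, K x -> exists M, nbhs x [set y | u y <= M]) ->
  exists2 M, 0 < M & forall x, K x -> u x <= M.
Proof.
move=> cK loc; have [|x Kx|e e0 H] := compact_eps (P := fun e x => u x <= e^-1) cK.
- move=> e e' x e'0 ee' h; apply: le_trans h _; rewrite lef_pV2 ?posrE //.
  exact: lt_le_trans ee'.
- have [M HM] := loc x Kx; have N0 : 0 < `|M| + 1 by rewrite ltr_wpDl.
  exists (`|M| + 1)^-1; first by rewrite invr_gt0.
  apply: filterS HM => y /= h; rewrite invrK; apply: le_trans h _.
  by apply: le_trans (ler_norm _) _; rewrite lerDl.
by exists e^-1; rewrite ?invr_gt0.
Qed.

Lemma compact_lower (T : topologicalType) (K : set T) (u : T -> R) : compact K ->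
  (forall x, K x -> exists2 e, 0 < e & nbhs x [set y | e <= u y]) ->
  exists2 e, 0 < e & forall x, K x -> e <= u x.
Proof.
move=> cK; apply: (compact_eps (P := fun e x => e <= u x)) cK _.
by move=> e e' x _; exact: le_trans.
Qed.

Lemma closed_nrm (V : normedModType C) (K : set V) :
  (forall x, (forall e : R, 0 < e -> exists2 y, K y & nrm (y - x) < e) -> K x) -> closed K.
Proof.
move=> H x clx; apply: H => e e0.
have : nbhs x [set y | nrm (y - x) < e] by apply/nbhs_nrm; exists e.
by move=> /clx[y [Ky ye]]; exists y.
Qed.

Lemma nrm_closed (V : normedModType C) (K : set V) x : closed K ->
  (forall e : R, 0 < e -> exists2 y, K y & nrm (y - x) < e) -> K x.
Proof.
move=> clK H; apply: clK => B /nbhs_nrm[e e0 eB].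
by have [y Ky ye] := H e e0; exists y; split => //; apply: eB.
Qed.

Lemma box_compact (M : R) : compact [set z : C | `|re z| <= M /\ `|im z| <= M].
Proof.
pose f (p : R * R) : C := rc p.1 + rc p.2 * ci.
have ref p : re (f p) = p.1.
  by rewrite /f reD reM !re_rc im_rc re_ci im_ci mulr0 mul0r subr0 addr0.
have imf p : im (f p) = p.2.
  by rewrite /f imD imM !im_rc re_rc re_ci im_ci mulr1 mul0r addr0 add0r.
have -> : [set z : C | `|re z| <= M /\ `|im z| <= M] = f @` (`[- M, M] `*` `[- M, M]).
  apply/seteqP; split=> [z [h1 h2]|z [[x y] /= [h1 h2] <-]].
    exists (re z, im z); last by rewrite /f /= -crect.
    by split; rewrite /= in_itv /= -ler_norml.
  rewrite ref imf.
  by move: h1 h2; rewrite !in_itv /= -!ler_norml.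
apply: continuous_compact; last by apply: compact_setX; exact: segment_compact.
apply: continuous_subspaceT => p.
move=> B /nbhs_nrm[e e0 eB].
have e2 : 0 < e / 2 by rewrite divr_gt0.
exists ([set x | `|p.1 - x| < e / 2], [set x | `|p.2 - x| < e / 2]) => /=.
  by split; exact: nbhsx_ballx.
move=> [x y] /= [h1 h2]; apply: eB; apply: le_lt_trans (nrm_le_reim _) _.
rewrite !reB !imB !ref !imf /=.
by rewrite [`|x - _|]distrC [`|y - _|]distrC; lra.
Qed.

Lemma cplx_compact (K : set C) (M : R) : closed K -> (forall z, K z -> nrm z <= M) -> compact K.
Proof.
move=> clK KM; have sub : K `<=` [set z : C | `|re z| <= M /\ `|im z| <= M].
  by move=> z /KM zM; split; apply: le_trans zM; [exact: re_le|exact: im_le].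
exact: (subclosed_compact clK (@box_compact M) sub).
Qed.

Lemma cont_nrm (T : topologicalType) (f : T -> C) x : {for x, continuous f} ->
  forall e, 0 < e -> nbhs x [set y | nrm (f y - f x) < e].
Proof.
move=> cf e e0; have /cf : nbhs (f x) [set w | nrm (w - f x) < e] by apply/nbhs_nrm; exists e.
by [].
Qed.

Lemma compact_cont_bound (T : topologicalType) (K : set T) (f : T -> C) : compact K ->
  (forall x, K x -> {for x, continuous f}) -> exists2 M, 0 < M & forall x, K x -> nrm (f x) <= M.
Proof.
move=> cK cf; apply: (compact_bound cK) => x Kx.
exists (nrm (f x) + 1); apply: filterS (cont_nrm (cf x Kx) ltr01) => y /= yx.
have -> : f y = f x + (f y - f x) by rewrite addrC subrK.
by apply: le_trans (nrmD _ _) _; rewrite lerD2l ltW.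
Qed.

End Compactness.

(** * Separation of polynomial hulls *)

Section Grid.
Variable R : realType.
Notation C := (Cplx R).

(* The sum over the cells of a grid selected by [chi] of the oriented sums over the four edges of
   the cell; the interior edges cancel, so only those separating selected from other cells matter. *)
Definition Sm m (chi : nat -> nat -> bool) (H E : nat -> nat -> C) : C :=
  \sum_(i < m) \sum_(j < m) (if chi i j then H i j + E i.+1 j - H i j.+1 - E i j else 0).

Lemma telescope_jump (chi : nat -> bool) (D : nat -> C) m :
  (forall j, chi j.+1 != chi j -> D j.+1 = 0) -> chi 0%N = false -> chi m = false ->
  \sum_(j < m) (if chi j then D j - D j.+1 else 0) = 0.
Proof.
move=> HD c0 cm.
have E n : \sum_(j < n) (if chi j then D j - D j.+1 else 0) = - (if chi n then D n else 0).
  elim: n => [|n ih]; first by rewrite big_ord0 c0 oppr0.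
  rewrite big_ord_recr /= ih; have := HD n.
  case: (chi n.+1); case: (chi n) => /= h.
  - ring.
  - by rewrite h //; ring.
  - by rewrite h //; ring.
  - ring.
by rewrite E cm oppr0.
Qed.

Definition frame0 m (chi : nat -> nat -> bool) := forall i,
  [/\ chi i 0%N = false, chi i m = false, chi 0%N i = false & chi m i = false].

Lemma Sm_jump m chi H E : frame0 m chi ->
  (forall i j, chi i j.+1 != chi i j -> H i j.+1 = 0) ->
  (forall i j, chi i.+1 j != chi i j -> E i.+1 j = 0) -> Sm m chi H E = 0.
Proof.
move=> fr hH hE.
have -> : Sm m chi H E =
  \sum_(i < m) \sum_(j < m) (if chi i j then H i j - H i j.+1 else 0) -
  \sum_(j < m) \sum_(i < m) (if chi i j then E i j - E i.+1 j else 0).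
  rewrite [X in _ - X]exchange_big /= -sumrB; apply: eq_bigr => i _.
  rewrite -sumrB; apply: eq_bigr => j _; case: (chi i j); ring.
rewrite big1 ?sub0r; last first.
  by move=> i _; have [c1 c2 _ _] := fr i; apply: telescope_jump => // j; exact: hH.
rewrite big1 ?oppr0 // => j _; have [_ _ c1 c2] := fr j.
by apply: (@telescope_jump (fun i => chi i j) (fun i => E i j)) => // i; exact: hE.
Qed.

Lemma SmB m chi H E H' E' : Sm m chi H E - Sm m chi H' E' =
  Sm m chi (fun i j => H i j - H' i j) (fun i j => E i j - E' i j).
Proof.
rewrite /Sm -sumrB; apply: eq_bigr => i _; rewrite -sumrB; apply: eq_bigr => j _.
case: (chi i j); ring.
Qed.

Lemma Sm_agree m chi H E H' E' : frame0 m chi ->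
  (forall i j, chi i j.+1 != chi i j -> H i j.+1 = H' i j.+1) ->
  (forall i j, chi i.+1 j != chi i j -> E i.+1 j = E' i.+1 j) -> Sm m chi H E = Sm m chi H' E'.
Proof.
move=> fr hH hE; apply/eqP; rewrite -subr_eq0 SmB; apply/eqP/Sm_jump => //.
- by move=> i j /hH ->; rewrite subrr.
- by move=> i j /hE ->; rewrite subrr.
Qed.

Lemma Sm_pot m chi (L : nat -> nat -> C) :
  Sm m chi (fun i j => L i.+1 j - L i j) (fun i j => L i j.+1 - L i j) = 0.
Proof. by rewrite /Sm big1 // => i _; rewrite big1 // => j _; case: (chi i j); ring. Qed.

Lemma Sm_bound m chi H E (e : R) : (forall i j, nrm (H i j) <= e) -> (forall i j, nrm (E i j) <= e) ->
  nrm (Sm m chi H E) <= m%:R * (m%:R * (4 * e)).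
Proof.
move=> hH hE; have e0 : 0 <= e by apply: le_trans (hH 0%N 0%N); exact: nrm_ge0.
have sumc (n : nat) (a : R) : \sum_(i < n) a = n%:R * a.
  by rewrite sumr_const card_ord mulr_natl.
apply: le_trans (nrm_sum _ _ _) _; rewrite -sumc; apply: ler_sum => i _.
apply: le_trans (nrm_sum _ _ _) _; rewrite -sumc; apply: ler_sum => j _.
case: (chi i j); last by rewrite nrm0 mulr_ge0.
have := hH i j; have := hH i j.+1; have := hE i j; have := hE i.+1 j.
have := nrmB (H i j + E i.+1 j - H i j.+1) (E i j); have := nrmB (H i j + E i.+1 j) (H i j.+1).
have := nrmD (H i j) (E i.+1 j); lra.
Qed.

Variables (o : C) (h : R).
Hypothesis h0 : 0 < h.
Definition gv (i j : nat) : C := o + rc (i%:R * h) + rc (j%:R * h) * ci.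

Lemma re_gv i j : re (gv i j) = re o + i%:R * h.
Proof. by rewrite /gv !reD reM !re_rc im_rc re_ci im_ci mulr0 mul0r subr0 addr0. Qed.
Lemma im_gv i j : im (gv i j) = im o + j%:R * h.
Proof. by rewrite /gv !imD imM im_rc !im_rc re_rc re_ci im_ci mulr1 mul0r !addr0. Qed.
Lemma gvSl i j : gv i.+1 j = gv i j + rc h.
Proof. by rewrite /gv [i.+1%:R]mulrS mulrDl mul1r rcD; ring. Qed.
Lemma gvSr i j : gv i j.+1 = gv i j + rc h * ci.
Proof. by rewrite /gv [j.+1%:R]mulrS mulrDl mul1r rcD; ring. Qed.

Definition gH (f : C -> C) i j := segI f (gv i j) (gv i.+1 j).
Definition gE (f : C -> C) i j := segI f (gv i j) (gv i j.+1).

Lemma qI_grid f i j : cts_bd f (gv i j) h ->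
  qI f (gv i j) h = gH f i j + gE f i.+1 j - gH f i j.+1 - gE f i j.
Proof.
move=> cf; have [v1 [v2 [v3 [v4 [h1 h2 h3 h4 ->]]]]] := qI_has (ltW h0) cf.
rewrite -gvSl -gvSr in h1 h2 h3 h4.
have e2 : gv i j + rc h + rc h * ci = gv i.+1 j.+1 by rewrite gvSr gvSl.
have e1 : gv i j + rc h = gv i.+1 j by rewrite gvSl.
have e3 : gv i j + rc h * ci = gv i j.+1 by rewrite gvSr.
rewrite ?e2 ?e1 ?e3 in h1 h2 h3 h4.
rewrite /gH /gE (segIE h1) (segIE h2) (segIE (hasI_rev h3)) (segIE (hasI_rev h4)); ring.
Qed.

Lemma sqr_gv i j z : sqr (gv i j) h z <->
  (i%:R * h <= re z - re o <= i.+1%:R * h) /\ (j%:R * h <= im z - im o <= j.+1%:R * h).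
Proof.
rewrite /sqr reB imB re_gv im_gv ![_.+1%:R]mulrS !mulrDl !mul1r.
by split=> -[/andP[? ?] /andP[? ?]]; split; apply/andP; split; lra.
Qed.

Lemma inside_gv i j z : inside (gv i j) h z <->
  (i%:R * h < re z - re o < i.+1%:R * h) /\ (j%:R * h < im z - im o < j.+1%:R * h).
Proof.
rewrite /inside reB imB re_gv im_gv ![_.+1%:R]mulrS !mulrDl !mul1r.
by split=> -[/andP[? ?] /andP[? ?]]; split; apply/andP; split; lra.
Qed.

Lemma inside_sqr_eq i j i' j' z : inside (gv i j) h z -> sqr (gv i' j') h z -> i' = i /\ j' = j.
Proof.
move=> /inside_gv[/andP[x1 x2] /andP[y1 y2]] /sqr_gv[/andP[x3 x4] /andP[y3 y4]].
have := le_lt_trans x3 x2; have := lt_le_trans x1 x4.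
have := le_lt_trans y3 y2; have := lt_le_trans y1 y4.
rewrite !ltr_pM2r // !ltr_nat !ltnS => a1 a2 a3 a4.
by split; apply/eqP; rewrite eqn_leq ?a1 ?a2 ?a3 ?a4.
Qed.

Lemma grid_sum m chi z i j : (i < m)%N -> (j < m)%N -> inside (gv i j) h z ->
  Sm m chi (gH (fun w => 1 / (w - z) ^+ 1)) (gE (fun w => 1 / (w - z) ^+ 1)) =
  if chi i j then W h else 0.
Proof.
move=> im jm zi; set f := fun w => _.
have nb i' j' w : bd (gv i' j') h w -> w != z.
  move=> bw; apply/eqP => wz; rewrite wz in bw.
  have [e1 e2] := inside_sqr_eq zi bw.1; rewrite e1 e2 in bw.
  by have [d d0 /(_ _ bw)] := inside_dist zi; rewrite subrr nrm0; lra.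
have Q i' j' : gH f i' j' + gE f i'.+1 j' - gH f i' j'.+1 - gE f i' j' = wnd (gv i' j') h z.
  rewrite -qI_grid //; apply: kernel_cts; last exact: nb.
  exact: cst_cts.
have Q' (i' j' : 'I_m) : (if chi i' j' then gH f i' j' + gE f i'.+1 j' - gH f i' j'.+1 - gE f i' j' else 0) =
   if (i' == Ordinal im) && (j' == Ordinal jm) then (if chi i j then W h else 0) else 0.
  rewrite Q; have [->|ni] := eqVneq i' (Ordinal im); last first.
    rewrite /= wnd_out ?if_same ?(ltW h0) // => /(inside_sqr_eq zi)[/eqP].
    by rewrite -(inj_eq val_inj) /= in ni; rewrite (negbTE ni).
  have [->|nj] := eqVneq j' (Ordinal jm); last first.
    rewrite /= wnd_out ?if_same ?(ltW h0) // => /(inside_sqr_eq zi)[_ /eqP].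
    by rewrite -(inj_eq val_inj) /= in nj; rewrite (negbTE nj).
  by rewrite /= wnd_in.
rewrite /Sm; under eq_bigr => i' _ do under eq_bigr => j' _ do rewrite Q'.
rewrite (bigD1 (Ordinal im)) //= [X in _ + X]big1 ?addr0; last first.
  by move=> i' /negbTE ->; rewrite big1.
rewrite (bigD1 (Ordinal jm)) //= big1 ?addr0 ?eqxx //.
by move=> j' /negbTE ->; rewrite andbF.
Qed.

Lemma sqr_diam a x y : sqr a h x -> sqr a h y -> nrm (x - y) <= 2 * h.
Proof.
move=> [/andP[x1 x2] /andP[x3 x4]] [/andP[y1 y2] /andP[y3 y4]].
rewrite !(reB, imB) in x1 x2 x3 x4 y1 y2 y3 y4.
apply: le_trans (nrm_le_reim _) _; rewrite reB imB.
have : `|re x - re y| <= h by rewrite ler_norml; apply/andP; split; lra.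
have : `|im x - im y| <= h by rewrite ler_norml; apply/andP; split; lra.
lra.
Qed.

Lemma hedge i j t : 0 <= t <= 1 -> sqr (gv i j) h (cpt (gv i j.+1) (gv i.+1 j.+1) t) /\
  sqr (gv i j.+1) h (cpt (gv i j.+1) (gv i.+1 j.+1) t).
Proof.
move=> /andP[t0 t1]; have t2 : t * h <= h by rewrite ler_piMl // ltW.
have t3 : 0 <= t * h by rewrite mulr_ge0 // ltW.
split; apply/sqr_gv; rewrite (cptE _ _ _).1 (cptE _ _ _).2 !re_gv !im_gv ![_.+1%:R]mulrS;
 by split; apply/andP; split; lra.
Qed.

Lemma vedge i j t : 0 <= t <= 1 -> sqr (gv i j) h (cpt (gv i.+1 j) (gv i.+1 j.+1) t) /\
  sqr (gv i.+1 j) h (cpt (gv i.+1 j) (gv i.+1 j.+1) t).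
Proof.
move=> /andP[t0 t1]; have t2 : t * h <= h by rewrite ler_piMl // ltW.
have t3 : 0 <= t * h by rewrite mulr_ge0 // ltW.
split; apply/sqr_gv; rewrite (cptE _ _ _).1 (cptE _ _ _).2 !re_gv !im_gv ![_.+1%:R]mulrS;
 by split; apply/andP; split; lra.
Qed.

Definition touch (G : C -> Prop) i j := `[< exists2 g, G g & sqr (gv i j) h g >].

Definition jump_edge (G : C -> Prop) p q := exists A B,
  [/\ forall t, 0 <= t <= 1 -> sqr A h (cpt p q t) /\ sqr B h (cpt p q t),
      exists2 g, G g & sqr A h g, forall g, G g -> ~ sqr B h g & nrm (q - p) = h].

Lemma jump_h G i j : touch G i j.+1 != touch G i j -> jump_edge G (gv i j.+1) (gv i.+1 j.+1).
Proof.
have l : nrm (gv i.+1 j.+1 - gv i j.+1) = h.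
  by rewrite gvSl [_ + rc h]addrC addrK nrm_rc gtr0_norm.
case E1 : (touch G i j.+1); case E2 : (touch G i j) => // _.
  exists (gv i j.+1), (gv i j); split=> //.
  - by move=> t /(hedge i j)[].
  - exact/asboolP.
  - by move=> g Gg sg; move/asboolPn: E2; apply; exists g.
exists (gv i j), (gv i j.+1); split=> //.
- by move=> t /(hedge i j)[].
- exact/asboolP.
- by move=> g Gg sg; move/asboolPn: E1; apply; exists g.
Qed.

Lemma jump_v G i j : touch G i.+1 j != touch G i j -> jump_edge G (gv i.+1 j) (gv i.+1 j.+1).
Proof.
have l : nrm (gv i.+1 j.+1 - gv i.+1 j) = h.
  by rewrite gvSr [_ + rc h * _]addrC addrK nrmM nrm_rc nrm_ci mulr1 gtr0_norm.
case E1 : (touch G i.+1 j); case E2 : (touch G i j) => // _.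
  exists (gv i.+1 j), (gv i j); split=> //.
  - by move=> t /(vedge i j)[].
  - exact/asboolP.
  - by move=> g Gg sg; move/asboolPn: E2; apply; exists g.
exists (gv i j), (gv i.+1 j); split=> //.
- by move=> t /(vedge i j)[].
- exact/asboolP.
- by move=> g Gg sg; move/asboolPn: E1; apply; exists g.
Qed.

Lemma jump_near G p q t : jump_edge G p q -> 0 <= t <= 1 ->
  ~ G (cpt p q t) /\ exists2 g, G g & nrm (cpt p q t - g) <= 2 * h.
Proof.
move=> [A [B [h1 [g Gg gA] h3 _]]] /h1[tA tB]; split; first by move=> /h3.
by exists g => //; exact: sqr_diam tA gA.
Qed.

End Grid.

Section Separation.
Variable R : realType.
Notation C := (Cplx R).
Implicit Types (X Y : C -> Prop) (f g : C -> C) (a b z : C).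

Lemma entire1_cst (c : C) : entire1 (fun=> c).
Proof. by move=> z; exists 0; exact: cder_cst. Qed.
Lemma entire1D f g : entire1 f -> entire1 g -> entire1 (fun z => f z + g z).
Proof. by move=> hf hg z; have [d ?] := hf z; have [d' ?] := hg z; exists (d + d'); exact: cderD. Qed.
Lemma entire1M f g : entire1 f -> entire1 g -> entire1 (fun z => f z * g z).
Proof. by move=> hf hg z; have [d h] := hf z; have [d' h'] := hg z; eexists; exact: cderM h h'. Qed.
Lemma entire1X f n : entire1 f -> entire1 (fun z => f z ^+ n).
Proof. by move=> hf z; have [d h] := hf z; eexists; exact: cderX n h. Qed.
Lemma entire1_sum n (F : nat -> C -> C) : (forall i, entire1 (F i)) ->
  entire1 (fun z => \sum_(i < n) F i z).
Proof.
move=> hF; elim: n => [|n ih].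
  have -> : (fun z => \sum_(i < 0) F i z) = (fun=> 0) by apply/funext => z; rewrite big_ord0.
  exact: entire1_cst.
have -> : (fun z => \sum_(i < n.+1) F i z) = (fun z => \sum_(i < n) F i z + F n z).
  by apply/funext => z; rewrite big_ord_recr.
exact: entire1D.
Qed.
Lemma entire1_sub c : entire1 (fun z => z - c).
Proof. by move=> z; exists 1; exact: cder_sub. Qed.

Lemma entire1_cts f z e : entire1 f -> 0 < e ->
  exists2 d, 0 < d & forall w, nrm (w - z) < d -> nrm (f w - f z) < e.
Proof. by move=> hf e0; have [d hd] := hf z; exact: (cvg_nrm f z).1 (cder_continuous hd) e e0. Qed.

Definition hullE X a := forall f, entire1 f -> forall M, (forall x, X x -> nrm (f x) <= M) -> nrm (f a) <= M.

Lemma hullE_sub X a : X a -> hullE X a. Proof. by move=> Xa f _ M; apply. Qed.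

Lemma nhullP X b : ~ hullE X b -> exists f (rho : R),
  [/\ entire1 f, 0 <= rho, rho < 1, f b = 1 & forall x, X x -> nrm (f x) <= rho].
Proof.
move=> /existsNP[f /not_implyP[hf /existsNP[M /not_implyP[XM /negP]]]]; rewrite -ltNge => Mb.
have [M0|M0] := ltP M 0.
  exists (fun=> 1), 0; split=> //; first exact: entire1_cst.
  by move=> x /XM /le_lt_trans /(_ M0); rewrite ltNge nrm_ge0.
have fb0 : 0 < nrm (f b) by exact: le_lt_trans Mb.
have fb : f b != 0 by rewrite -nrmc_gt0.
exists (fun z => (f b)^-1 * f z), (M / nrm (f b)); split.
- by apply: entire1M => //; exact: entire1_cst.
- exact: divr_ge0 (ltW fb0).
- by rewrite ltr_pdivrMr // mul1r.
- by rewrite mulVf.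
- by move=> x /XM xM; rewrite nrmM nrmV mulrC ler_wpM2r // invr_ge0 ltW.
Qed.

(* With |f| < 1 on a set X, the functions u k tend uniformly on X to 1/(z - b). *)
Lemma resolvent f b : entire1 f -> f b = 1 -> exists u : nat -> C -> C,
  forall k, entire1 (u k) /\ forall z, (z - b) * u k z = 1 - f z ^+ k.
Proof.
move=> hf fb; exists (fun k z => - quot f b z * \sum_(i < k) f z ^+ i) => k; split.
  apply: entire1M; last first.
    by apply: (@entire1_sum k (fun i z => f z ^+ i)) => i; exact: entire1X.
  have -> : (fun z => - quot f b z) = (fun z => -1 * quot f b z) by apply/funext => z; rewrite mulN1r.
  by apply: entire1M; [exact: entire1_cst|exact: entire1_quot].
move=> z; rewrite mulrA mulrN.
have -> : (z - b) * quot f b z = f z - 1.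
  rewrite /quot; have [->|zb] := eqVneq z b; first by rewrite fb subrr mul0r subrr.
  by rewrite fb; field; rewrite subr_eq0.
by rewrite opprB -opprB mulNr -subrX1 opprB.
Qed.

Lemma nhull_dist X b : ~ hullE X b -> exists2 d, 0 < d & forall x, X x -> d <= nrm (x - b).
Proof.
move=> /nhullP[f [rho [hf r0 r1 fb fX]]].
have r1' : 0 < 1 - rho by rewrite subr_gt0.
have [d d0 dh] := entire1_cts b hf r1'; exists d => // x /fX fx.
rewrite leNgt; apply/negP => /dh; rewrite fb => h.
by have := nrm_sub 1 (f x); rewrite nrmC nrm1; lra.
Qed.

Lemma nhull_open X b : ~ hullE X b -> exists2 d, 0 < d & forall a, nrm (a - b) < d -> ~ hullE X a.
Proof.
move=> /nhullP[f [rho [hf r0 r1 fb fX]]].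
have r1' : 0 < 1 - rho by rewrite subr_gt0.
have [d d0 dh] := entire1_cts b hf r1'; exists d => // a /dh; rewrite fb => h.
by move=> /(_ f hf rho fX); have := nrm_sub 1 (f a); rewrite nrmC nrm1; lra.
Qed.

Lemma hull_hull X f rho : entire1 f -> (forall x, X x -> nrm (f x) <= rho) ->
  forall x, hullE X x -> nrm (f x) <= rho.
Proof. by move=> hf fX x /(_ f hf rho fX). Qed.

Lemma hull_bounded X (B : R) : (forall x, X x -> nrm x <= B) -> forall x, hullE X x -> nrm x <= B.
Proof. by apply: (@hull_hull X id); move=> z; exists 1; exact: cder_id. Qed.

Lemma hull_closed X : closed (hullE X : set C).
Proof.
apply: closed_nrm => x H; apply: contrapT => /nhull_open[d d0 dh].
by have [y hy yx] := H d d0; exact: (dh y yx).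
Qed.

Lemma hull_compact X (B : R) : (forall x, X x -> nrm x <= B) -> compact (hullE X : set C).
Proof. by move=> XB; apply: (cplx_compact (@hull_closed X)) => z; exact: hull_bounded XB z. Qed.

Lemma hull_boundary X a d : hullE X a -> 0 < d -> (forall x, X x -> d <= nrm (x - a)) ->
  forall b, nrm (b - a) < d / 4 -> hullE X b.
Proof.
move=> ha d0 hd b bd'; apply: contrapT => nb.
have [f [rho [hf r0 r1 fb fX]]] := nhullP nb.
have [u hu] := resolvent hf fb.
have ab : b != a by apply/eqP => E; apply: nb; rewrite E.
have ab0 : 0 < nrm (a - b) by rewrite nrmc_gt0 subr_eq0 eq_sym.
have fa := hull_hull hf fX ha.
have [k hk] : exists k : nat, rho ^+ k < 4^-1.
  have [->|rp] := eqVneq rho 0; first by exists 1%N; rewrite expr1 invr_gt0.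
  have rp' : 0 < rho by rewrite lt_def rp.
  have : (fun n => rho ^+ n) @ \oo --> 0 by apply: cvg_expr; rewrite ger0_norm.
  move=> /cvgrPdist_lt /(_ 4^-1) []; first by rewrite invr_gt0.
  move=> N _ /(_ N (leqnn N)); rewrite sub0r normrN ger0_norm ?exprn_ge0 // => ?.
  by exists N.
have rk0 : 0 <= rho ^+ k by rewrite exprn_ge0.
have [uk ukE] := hu k.
have bX x : X x -> nrm (u k x) <= (1 + rho ^+ k) / (d - nrm (b - a)).
  move=> Xx; have xb : d - nrm (b - a) <= nrm (x - b).
    have := nrm_tri x b a; have := hd x Xx; lra.
  have dp : 0 < d - nrm (b - a) by lra.
  rewrite ler_pdivlMr //; apply: (@le_trans _ _ (nrm (x - b) * nrm (u k x))).
    by rewrite mulrC ler_wpM2r ?nrm_ge0.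
  rewrite -nrmM ukE; apply: le_trans (nrmB _ _) _; rewrite nrm1 lerD2l nrmX.
  by rewrite lerXn2r ?nnegrE ?nrm_ge0 // fX.
have := ha _ uk _ bX.
have dp : 0 < d - nrm (b - a) by lra.
rewrite ler_pdivlMr // => h1.
have h2 : 1 - rho ^+ k <= nrm (a - b) * nrm (u k a).
  rewrite -nrmM ukE; apply: le_trans (nrm_sub _ _); rewrite nrm1 lerD2l lerN2 nrmX.
  by rewrite lerXn2r ?nnegrE ?nrm_ge0.
have h3 : 3 * nrm (a - b) <= d - nrm (b - a) by rewrite [nrm (a - b)]nrmC; lra.
have : nrm (u k a) * (3 * nrm (a - b)) <= nrm (u k a) * (d - nrm (b - a)) by rewrite ler_wpM2l ?nrm_ge0.
lra.
Qed.

Lemma crossing (P : R -> Prop) : P 0 -> ~ P 1 -> exists2 t, 0 <= t <= 1 &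
  forall e, 0 < e -> (exists2 s, 0 <= s <= 1 /\ `|s - t| < e & P s) /\
                     (exists2 s, 0 <= s <= 1 /\ `|s - t| < e & ~ P s).
Proof.
move=> P0 P1; pose A := [set s : R | 0 <= s <= 1 /\ P s].
have A0 : A 0 by split => //; rewrite lexx ler01.
have Aub : has_sup A by split; [exists 0|exists 1 => s [/andP[]]].
have t0 : 0 <= sup A by apply: ub_le_sup => //; exists 1 => s [/andP[]].
have t1 : sup A <= 1 by apply: ge_sup; [exists 0|move=> s [/andP[]]].
exists (sup A); first by rewrite t0.
move=> e e0; split.
  have [s [s01 Ps] hs] := sup_adherent e0 Aub.
  exists s => //; split=> //; have : s <= sup A by apply: ub_le_sup => //; exists 1 => x [/andP[]].
  by rewrite ltr_norml => ?; apply/andP; split; lra.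
have [h|h] := leP 1 (sup A + e / 2).
  exists 1 => //; split; first by rewrite ler01 lexx.
  by rewrite ltr_norml; apply/andP; split; lra.
exists (sup A + e / 2); first by split; [apply/andP; split; lra|rewrite ltr_norml; apply/andP; split; lra].
move=> Ps; have : sup A + e / 2 <= sup A.
  apply: ub_le_sup; first by exists 1 => x [/andP[]].
  by split => //; apply/andP; split; lra.
lra.
Qed.

Lemma compact_dist (K L : set C) : compact K -> closed L -> (forall x, K x -> ~ L x) ->
  exists2 d, 0 < d & forall x y, K x -> L y -> d <= nrm (x - y).
Proof.
move=> cK cL KL.
have [|x Kx|d d0 H] := compact_eps (P := fun (e : R) x => forall y, L y -> e <= nrm (x - y)) cK.
- by move=> e e' x _ ee' h y /h; exact: le_trans.
- have [e e0 eL] : exists2 e, 0 < e & forall y, L y -> e <= nrm (x - y).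
    apply: contrapT => H; apply: (KL x Kx); apply: (nrm_closed cL) => e e0.
    apply: contrapT => H'; apply: H; exists e => // y Ly.
    by rewrite leNgt nrmC; apply/negP => yx; apply: H'; exists y.
  exists (e / 2); first by rewrite divr_gt0.
  apply/nbhs_nrm; exists (e / 2); first by rewrite divr_gt0.
  by move=> z zx y Ly; have := eL y Ly; have := nrm_tri x z y; rewrite [nrm (x - z)]nrmC; lra.
by exists d => // x y Kx; exact: H.
Qed.

Lemma compact_thick (K : set C) f rho : compact K -> entire1 f -> (forall x, K x -> nrm (f x) <= rho) ->
  rho < 1 -> exists2 d, 0 < d & forall x z, K x -> nrm (z - x) < d -> nrm (f z) <= (1 + rho) / 2.
Proof.
move=> cK hf fK r1.
have [|x Kx|d d0 H] := compact_eps (P := fun (e : R) x => forall z, nrm (z - x) < e -> nrm (f z) <= (1 + rho) / 2) cK.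
- by move=> e e' x _ ee' h y hy; apply: h; exact: lt_le_trans ee'.
- have r2 : 0 < (1 - rho) / 2 by rewrite divr_gt0 // subr_gt0.
  have [e e0 eL] := entire1_cts x hf r2.
  exists (e / 2); first by rewrite divr_gt0.
  apply/nbhs_nrm; exists (e / 2); first by rewrite divr_gt0.
  move=> y yx z zy; have /eL : nrm (z - x) < e by apply: le_lt_trans (nrm_tri _ y _) _; lra.
  by have := nrm_sub (f z) (f x); have := fK x Kx; lra.
by exists d => // x y Kx; exact: H.
Qed.

Lemma pow_small (rho e : R) : 0 <= rho -> rho < 1 -> 0 < e -> exists k : nat, rho ^+ k < e.
Proof.
move=> r0 r1 e0.
have : (fun n => rho ^+ n) @ \oo --> 0 by apply: cvg_expr; rewrite ger0_norm.
move=> /cvgrPdist_lt /(_ e e0) [N _ /(_ N (leqnn N))].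
by rewrite sub0r normrN ger0_norm ?exprn_ge0 // => ?; exists N.
Qed.

Lemma grid_cover (B h : R) : 0 < h -> exists k : nat, B + 2 * h < k%:R * h.
Proof.
move=> h0; exists (Num.truncn `|(B + 2 * h) / h|).+1.
rewrite -ltr_pdivrMr //; apply: le_lt_trans (ler_norm _) _; exact: truncnS_gt.
Qed.

Lemma union_hull X Y (B : R) : (forall x, X x -> nrm x <= B) -> (forall y, Y y -> nrm y <= B) ->
  (forall a, hullE X a -> hullE Y a -> False) ->
  forall a, hullE (fun z => X z \/ Y z) a -> hullE X a \/ hullE Y a.
Proof.
move=> XB YB XY a; set S := hullE (fun z => X z \/ Y z) => Sa.
apply: contrapT => /not_orP[nXa nYa].
have SB z : S z -> nrm z <= B by apply: hull_bounded => w [/XB|/YB].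
pose G z := S z /\ ~ hullE X z /\ ~ hullE Y z.
have Gopen z : G z -> exists2 r, 0 < r & forall w, nrm (w - z) < r -> G w.
  move=> [Sz [nXz nYz]].
  have [dx dx0 hx] := nhull_open nXz; have [dy dy0 hy] := nhull_open nYz.
  pose d := Num.min dx dy; have d0 : 0 < d by rewrite lt_min dx0.
  exists (d / 4); first by rewrite divr_gt0.
  move=> w wz; have wd : nrm (w - z) < d by lra.
  move: (wd); rewrite lt_min => /andP[w1 w2].
  split; last by split; [exact: hx|exact: hy].
  apply: (hull_boundary Sz d0 _ wz) => x xXY; rewrite leNgt; apply/negP.
  rewrite lt_min => /andP[x1 x2]; case: xXY => [Xx|Yx].
    exact: (hx x x1) (hullE_sub Xx).
  exact: (hy x x2) (hullE_sub Yx).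
have [fX [rX [hfX rX0 rX1 fXa fXX]]] := nhullP nXa.
have [fY [rY [hfY rY0 rY1 fYa fYY]]] := nhullP nYa.
have cX := hull_compact XB; have cY := hull_compact YB.
have [dX dX0 hdX] := compact_thick cX hfX (hull_hull hfX fXX) rX1.
have [dY dY0 hdY] := compact_thick cY hfY (hull_hull hfY fYY) rY1.
have [d d0 hd] := compact_dist cX (@hull_closed Y) (fun x h1 h2 => XY x h1 h2).
pose h := Num.min (Num.min dX dY) d / 16.
have mm : 0 < Num.min (Num.min dX dY) d by rewrite !lt_min dX0 dY0.
have h0 : 0 < h by rewrite divr_gt0.
have [hX [hY hD]] : 16 * h <= dX /\ 16 * h <= dY /\ 16 * h <= d.
  have -> : 16 * h = Num.min (Num.min dX dY) d by rewrite /h mulrC divfK.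
  by rewrite !ge_min !lexx !orbT.
clearbody h; clear mm.
have [k hk] := grid_cover (B + nrm a) h0.
pose o : C := a - rc (k%:R * h + h / 2) - rc (k%:R * h + h / 2) * ci.
have oE z : re z - re o = re (z - a) + k%:R * h + h / 2 /\ im z - im o = im (z - a) + k%:R * h + h / 2.
  by rewrite /o !(reB, imB) reM imM !re_rc !im_rc re_ci im_ci; split; ring.
have [m km mh] : exists2 m : nat, (k < m)%N & m%:R * h = 2 * (k%:R * h) + h.
  exists (2 * k).+1; first by rewrite ltnS leq_pmull.
  by rewrite mulrS natrM; ring.
pose chi := touch o h G.
have Gr z : G z -> nrm (z - a) <= B + nrm a.
  by move=> [/SB zB _]; apply: le_trans (nrmB _ _) _; rewrite lerD2r.
have fr : frame0 m chi.
  have rng z : G z -> `|re (z - a)| <= B + nrm a /\ `|im (z - a)| <= B + nrm a.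
    by move=> /Gr zz; split; apply: le_trans zz; [exact: re_le|exact: im_le].
  move=> i; split; apply/asboolPn => -[g /rng[]]; rewrite !ler_norml => /andP[r1 r2] /andP[r3 r4] /sqr_gv[];
    have [-> ->] := oE g; move=> /andP[u1 u2] /andP[u3 u4]; lra.
have ain : inside (gv o h k k) h a.
  have kS : k.+1%:R * h = k%:R * h + h by rewrite mulrS; ring.
  by apply/inside_gv; have [-> ->] := oE a; rewrite subrr re0 im0 kS !add0r;
    split; apply/andP; split; lra.
have chik : chi k k.
  apply/asboolP; exists a; first by [].
  by case: ain => [/andP[? ?] /andP[? ?]]; split; apply/andP; split; apply: ltW.
pose f := fun w : C => 1 / (w - a) ^+ 1.
have SmW : Sm m chi (gH o h f) (gE o h f) = W h by rewrite (grid_sum h0 chi km km ain) chik.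
have Ga : G a by [].
have [r r0 hr] := Gopen a Ga.
have far p q t : jump_edge h G p q -> 0 <= t <= 1 -> r <= nrm (cpt p q t - a).
  by move=> J /(jump_near J)[nG _]; rewrite leNgt; apply/negP => /hr.
have nearT p q t : jump_edge h G p q -> 0 <= t <= 1 ->
    exists2 b, hullE X b \/ hullE Y b & nrm (cpt p q t - b) <= 2 * h.
  move=> J t01; have [nG [g Gg dg]] := jump_near J t01.
  set z := cpt p q t in nG dg *.
  have [||s s01 hs] := crossing (P := fun s => G (cpt g z s)); rewrite ?cpt0 ?cpt1 //.
  set b := cpt g z s in hs.
  have N0 : 0 < nrm (z - g) + 1 by rewrite ltr_wpDl ?nrm_ge0.
  have clo s' e : `|s' - s| < e / (nrm (z - g) + 1) -> nrm (cpt g z s' - b) < e.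
    rewrite ltr_pdivlMr // nrm_cpt; apply: le_lt_trans; by rewrite ler_wpM2l // lerDl.
  exists b; last first.
    have -> : z - b = rc (1 - s) * (z - g) by rewrite /b /cpt rcB rc1; ring.
    case/andP: s01 => s0 s1; rewrite nrmM nrm_rc ger0_norm ?subr_ge0 //.
    by apply: le_trans dg; rewrite ler_piMl ?nrm_ge0 // gerBl.
  apply: contrapT => /not_orP[nX nY].
  have Sb : S b.
    apply: contrapT => /nhull_open[e e0 he].
    have [[s' [_ /clo h1] [h2 _]] _] := hs _ (divr_gt0 e0 N0).
    exact: he h1 h2.
  have [e e0 he] := Gopen b (conj Sb (conj nX nY)).
  have [_ [s' [_ /clo h1]]] := hs _ (divr_gt0 e0 N0).
  by apply; exact: he.
have [uX huX] := resolvent hfX fXa; have [uY huY] := resolvent hfY fYa.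
pose rho := Num.max ((1 + rX) / 2) ((1 + rY) / 2).
have rho0 : 0 <= rho by rewrite le_max divr_ge0 // addr_ge0.
have rho1 : rho < 1 by rewrite gt_max !ltr_pdivrMr // !mul1r !ltrD2l rX1.
have rhoX : (1 + rX) / 2 <= rho by rewrite le_max lexx.
have rhoY : (1 + rY) / 2 <= rho by rewrite le_max lexx orbT.
clearbody rho.
have main K : nrm (W h) <= m%:R * (m%:R * (4 * (rho ^+ K / r * h))).
  have [PX hPX] := entire1_prim (huX K).1; have [PY hPY] := entire1_prim (huY K).1.
  pose L v := if `[< exists2 x, hullE X x & nrm (v - x) < 4 * h >] then PX v else PY v.
  have edge p q : jump_edge h G p q -> nrm (segI f p q - (L q - L p)) <= rho ^+ K / r * h.
    move=> J; have [_ [_ [_ _ _ lpq]]] := J.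
    have fz t : 0 <= t <= 1 -> cpt p q t - a != 0.
      by move=> t01; rewrite -nrmc_gt0; apply: lt_le_trans r0 (far _ _ _ J t01).
    have cf : cts_seg f p q.
      move=> t t01; apply: contM; first exact: cder_continuous (cder_cst 1 _).
      have hc := cderX 1 (cder_sub a (cpt p q t)).
      by apply: (cder_continuous (cderV hc _)); rewrite expr1 fz.
    have pq t : 0 <= t <= 1 -> nrm (cpt p q t - p) <= h.
      move=> /andP[t0 t1]; have -> : cpt p q t - p = rc t * (q - p) by rewrite /cpt; ring.
      by rewrite nrmM nrm_rc ger0_norm // lpq ler_piMl // ltW.
    have t00 : 0 <= (0 : R) <= 1 by rewrite lexx ler01.
    have t11 : 0 <= (1 : R) <= 1 by rewrite ler01 lexx.
    have [b hb bp] := nearT p q 0 J t00; rewrite cpt0 in bp.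
    have b3 t : 0 <= t <= 1 -> nrm (cpt p q t - b) <= 3 * h.
      by move=> /pq ?; apply: le_trans (nrm_tri _ p _) _; lra.
    have bq := b3 1 t11; rewrite cpt1 in bq.
    have key (u F P : C -> C) : (forall z, (z - a) * u z = 1 - F z ^+ K) -> (forall z, cder P z (u z)) ->
        (forall z, nrm (z - b) <= 3 * h -> nrm (F z) <= rho) -> L q = P q -> L p = P p ->
        nrm (segI f p q - (L q - L p)) <= rho ^+ K / r * h.
      move=> hu hP hF -> ->; rewrite -[X in _ <= _ * X]lpq.
      have HP : hasI u p q (P q - P p) by apply: hasI_primitive => t _; exact: hP.
      have := hasI_lin (-1) HP (segI_has cf); rewrite mulN1r [X in hasI _ _ _ X]addrC => HH.
      apply: (hasI_bound HH) => t t01.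
      have -> : -1 * u (cpt p q t) + f (cpt p q t) = F (cpt p q t) ^+ K / (cpt p q t - a).
        have z0 := fz t t01; have := hu (cpt p q t); rewrite /f; set z := cpt p q t in z0 * => E.
        have -> : F z ^+ K = 1 - (z - a) * u z by rewrite E; ring.
        by field.
      rewrite nrmM nrmV nrmX; apply: ler_pM; rewrite ?exprn_ge0 ?invr_ge0 ?nrm_ge0 //.
        by rewrite lerXn2r ?nnegrE ?nrm_ge0 //; apply/hF/b3.
      rewrite lef_pV2 ?posrE //; first exact: far J t01.
      by apply: lt_le_trans r0 (far _ _ _ J t01).
    have h34 : 3 * h < 4 * h by rewrite ltr_pM2r // ltr_nat.
    have h23 : 2 * h <= 3 * h by rewrite ler_pM2r // ler_nat.
    have h24 := le_lt_trans h23 h34.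
    case: hb => hb.
      apply: (key _ _ _ (huX K).2 hPX).
      - by move=> z zb; apply: le_trans rhoX; apply: (hdX b z hb); lra.
      - by rewrite /L asboolT //; exists b => //; exact: le_lt_trans bq h34.
      - by rewrite /L asboolT //; exists b => //; exact: le_lt_trans bp h24.
    have nX v : nrm (v - b) <= 3 * h -> ~ exists2 x, hullE X x & nrm (v - x) < 4 * h.
      move=> vb [x hx vx]; have := hd x b hx hb; have := nrm_tri x v b.
      rewrite [nrm (x - v)]nrmC; lra.
    apply: (key _ _ _ (huY K).2 hPY).
    - by move=> z zb; apply: le_trans rhoY; apply: (hdY b z hb); lra.
    - by rewrite /L asboolF //; apply: nX.
    - by rewrite /L asboolF //; apply: nX; exact: le_trans bp h23.
  pose Lg i j := L (gv o h i j).
  pose HD i j := gH o h f i j - (Lg i.+1 j - Lg i j).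
  pose ED i j := gE o h f i j - (Lg i j.+1 - Lg i j).
  pose HJ i j := if j is j'.+1 then (if chi i j'.+1 != chi i j' then HD i j'.+1 else 0) else 0.
  pose EJ i j := if i is i'.+1 then (if chi i'.+1 j != chi i' j then ED i'.+1 j else 0) else 0.
  have e0 : 0 <= rho ^+ K / r * h.
    by rewrite mulr_ge0 ?(ltW h0) // divr_ge0 ?(ltW r0) // exprn_ge0.
  rewrite -SmW -[X in nrm X]subr0 -(Sm_pot m chi Lg) SmB.
  rewrite (@Sm_agree _ m chi _ _ HJ EJ fr).
  - apply: Sm_bound => i j.
    + rewrite /HJ; case: j => [|j]; first by rewrite nrm0.
      by case: ifP => [/(jump_h h0)/edge//|]; rewrite nrm0.
    + rewrite /EJ; case: i => [|i]; first by rewrite nrm0.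
      by case: ifP => [/(jump_v h0)/edge//|]; rewrite nrm0.
  - by move=> i j /= ->.
  - by move=> i j /= ->.
have T0 : 0 < m%:R * (m%:R * (4 * h)) / r + 1.
  apply: ltr_wpDl => //; apply: divr_ge0; last exact: ltW.
  by do 2![apply: mulr_ge0; first exact: ler0n]; apply: mulr_ge0; [exact: ler0n|exact: ltW].
have [K hK] := pow_small rho0 rho1 (divr_gt0 (ltr0n R 4) T0).
have := main K; have := W_ge h0; move: hK; rewrite ltr_pdivlMr // => hK.
have -> : m%:R * (m%:R * (4 * (rho ^+ K / r * h))) = rho ^+ K * (m%:R * (m%:R * (4 * h)) / r) by ring.
have := exprn_ge0 K rho0; lra.
Qed.

End Separation.

Section Idempotent.
Variable R : realType.
Notation C := (Cplx R).
Implicit Types (X Y : C -> Prop) (f g u : C -> C) (a b z p q : C).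

Definition apprx X u := forall e : R, 0 < e -> exists2 v, entire1 v & forall x, X x -> nrm (u x - v x) <= e.

Lemma apprx0 X : apprx X (fun=> 0).
Proof. by move=> e e0; exists (fun=> 0); [exact: entire1_cst|move=> x _; rewrite subrr nrm0 ltW]. Qed.

Lemma apprxD X u v : apprx X u -> apprx X v -> apprx X (fun z => u z + v z).
Proof.
move=> hu hv e e0; have e2 : 0 < e / 2 by rewrite divr_gt0.
have [u' hu' H1] := hu _ e2; have [v' hv' H2] := hv _ e2.
exists (fun z => u' z + v' z); first exact: entire1D.
move=> x Xx; have -> : u x + v x - (u' x + v' x) = (u x - u' x) + (v x - v' x) by ring.
by apply: le_trans (nrmD _ _) _; have := H1 x Xx; have := H2 x Xx; lra.
Qed.

Lemma apprxZ X u (c : C) : apprx X u -> apprx X (fun z => c * u z).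
Proof.
move=> hu e e0; have N0 : 0 < nrm c + 1 by rewrite ltr_wpDl ?nrm_ge0.
have [u' hu' H1] := hu _ (divr_gt0 e0 N0).
exists (fun z => c * u' z); first by apply: entire1M => //; exact: entire1_cst.
move=> x Xx; rewrite -mulrBr nrmM; apply: le_trans (_ : (nrm c + 1) * (e / (nrm c + 1)) <= _).
  by apply: ler_pM; rewrite ?nrm_ge0 ?lerDl ?H1.
by rewrite mulrC divfK // gt_eqF.
Qed.

Lemma apprx_sum X n (F : 'I_n -> C -> C) : (forall i, apprx X (F i)) ->
  apprx X (fun z => \sum_(i < n) F i z).
Proof.
elim: n F => [|n ih] F hF.
  have -> : (fun z => \sum_(i < 0) F i z) = (fun=> 0) by apply/funext => z; rewrite big_ord0.
  exact: apprx0.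
have -> : (fun z => \sum_(i < n.+1) F i z) =
    (fun z => \sum_(i < n) F (widen_ord (leqnSn n) i) z + F ord_max z).
  by apply/funext => z; rewrite big_ord_recr.
by apply: apprxD => //; apply: ih.
Qed.

Lemma apprx_inv X b : ~ hullE X b -> apprx X (fun z => (z - b)^-1).
Proof.
move=> nb e e0; have [f [rho [hf r0 r1 fb fX]]] := nhullP nb.
have [d d0 hd] := nhull_dist nb; have [u hu] := resolvent hf fb.
have [k hk] := pow_small r0 r1 (mulr_gt0 e0 d0).
exists (u k); first by case: (hu k).
move=> x Xx; have xd := hd x Xx.
have xb0 : 0 < nrm (x - b) by exact: lt_le_trans xd.
have xb : x - b != 0 by rewrite -nrmc_gt0.
have -> : (x - b)^-1 - u k x = f x ^+ k / (x - b).
  have -> : f x ^+ k = 1 - (x - b) * u k x by rewrite (hu k).2; ring.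
  by field.
rewrite nrmM nrmV nrmX ler_pdivrMr //.
apply: (@le_trans _ _ (rho ^+ k)); first by rewrite lerXn2r ?nnegrE ?nrm_ge0 // fX.
by apply: le_trans (ltW hk) _; rewrite ler_wpM2l // ltW.
Qed.

Definition kf z : C -> C := fun w => 1 / (w - z) ^+ 1.

Lemma kf_cts z p q : (forall t, 0 <= t <= 1 -> cpt p q t - z != 0) -> cts_seg (kf z) p q.
Proof.
move=> fz t t01; apply: contM; first exact: cder_continuous (cder_cst 1 _).
by apply: (cder_continuous (cderV (cderX 1 (cder_sub z (cpt p q t))) _)); rewrite expr1 fz.
Qed.

Lemma apprx_edge X (d : R) k : 0 < d -> forall p q,
  (forall t, 0 <= t <= 1 -> ~ hullE X (cpt p q t)) ->
  (forall t x, 0 <= t <= 1 -> X x -> d <= nrm (cpt p q t - x)) ->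
  forall e, 0 < e -> exists2 v, entire1 v & forall x, X x ->
    nrm (segI (kf x) p q - v x) <= nrm (q - p) ^+ 2 / (d ^+ 2 * 2 ^+ k) + e.
Proof.
move=> d0; elim: k => [|k ih] p q nX dX e e0.
  have t00 : 0 <= (0 : R) <= 1 by rewrite lexx ler01.
  have nXp : ~ hullE X p by have := nX 0 t00; rewrite cpt0.
  have [v hv hve] := apprxZ (- (q - p)) (apprx_inv nXp) e0.
  exists v => // x Xx.
  have fz t : 0 <= t <= 1 -> cpt p q t - x != 0.
    by move=> t01; rewrite -nrmc_gt0; apply: lt_le_trans d0 (dX _ _ t01 Xx).
  have px0 : p - x != 0 by have := fz 0 t00; rewrite cpt0.
  have xp0 : x - p != 0 by rewrite -opprB oppr_eq0.
  have -> : segI (kf x) p q - v x =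
    (segI (kf x) p q - (q - p) / (p - x)) + (- (q - p) * (x - p)^-1 - v x).
    have -> : (q - p) / (p - x) = - (q - p) * (x - p)^-1 by field; rewrite px0 xp0.
    by rewrite addrA subrK.
  apply: le_trans (nrmD _ _) _; apply: lerD; last exact: hve.
  have HC : hasI (fun=> (p - x)^-1) p q ((q - p) / (p - x)).
    have := @hasI_primitive R (fun w => (p - x)^-1 * w) (fun=> (p - x)^-1) p q.
    have -> : (p - x)^-1 * q - (p - x)^-1 * p = (q - p) / (p - x) by ring.
    by apply=> t _; rewrite -{2}[(p - x)^-1]mulr1; apply: cderZ; exact: cder_id.
  have := hasI_lin (-1) HC (segI_has (kf_cts fz)); rewrite !mulN1r [X in hasI _ _ _ X]addrC => HH.
  rewrite expr0 mulr1; have -> : nrm (q - p) ^+ 2 / d ^+ 2 = (nrm (q - p) / d ^+ 2) * nrm (q - p) by ring.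
  apply: (hasI_bound HH) => t t01; have z0 := fz t t01.
  have -> : - (p - x)^-1 + kf x (cpt p q t) = (p - cpt p q t) / ((cpt p q t - x) * (p - x)).
    by rewrite /kf; field; rewrite px0 z0.
  rewrite nrmM nrmV nrmM.
  have h1 : nrm (p - cpt p q t) <= nrm (q - p).
    case/andP: t01 => t0 t1; have -> : p - cpt p q t = - (rc t * (q - p)) by rewrite /cpt; ring.
    by rewrite nrmN nrmM nrm_rc ger0_norm // ler_piMl ?nrm_ge0.
  apply: ler_pM; rewrite ?nrm_ge0 ?invr_ge0 ?mulr_ge0 ?nrm_ge0 //.
  have h2 := dX t x t01 Xx; have h3 := dX 0 x t00 Xx; rewrite cpt0 in h3.
  rewrite lef_pV2 ?posrE ?exprn_gt0 ?mulr_gt0 //; [|exact: lt_le_trans h2|exact: lt_le_trans h3].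
  by rewrite expr2; apply: ler_pM; rewrite ?(ltW d0).
have e2 : 0 < e / 2 by rewrite divr_gt0.
have E1 t : cpt p (mid p q) t = cpt p q (t / 2) by rewrite midE /cpt rcM rcV rc_nat; field.
have E2 t : cpt (mid p q) q t = cpt p q (1 / 2 + t / 2).
  by rewrite midE /cpt rcD !rcM rcV rc_nat rc1; field.
have T1 (t : R) : 0 <= t <= 1 -> 0 <= t / 2 <= 1 by move=> /andP[? ?]; apply/andP; split; lra.
have T2 (t : R) : 0 <= t <= 1 -> 0 <= 1 / 2 + t / 2 <= 1 by move=> /andP[? ?]; apply/andP; split; lra.
have [||v1 hv1 H1] := ih p (mid p q) _ _ _ e2.
- by move=> t /T1; rewrite E1; exact: nX.
- by move=> t x /T1; rewrite E1; exact: dX.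
have [||v2 hv2 H2] := ih (mid p q) q _ _ _ e2.
- by move=> t /T2; rewrite E2; exact: nX.
- by move=> t x /T2; rewrite E2; exact: dX.
exists (fun z => v1 z + v2 z); first exact: entire1D.
move=> x Xx; have fz t : 0 <= t <= 1 -> cpt p q t - x != 0.
  by move=> t01; rewrite -nrmc_gt0; apply: lt_le_trans d0 (dX _ _ t01 Xx).
rewrite (segI_mid (kf_cts fz)).
set s1 := segI _ _ _; set s2 := segI _ _ _.
have -> : s1 + s2 - (v1 x + v2 x) = (s1 - v1 x) + (s2 - v2 x) by ring.
apply: le_trans (nrmD _ _) _; apply: le_trans (lerD (H1 x Xx) (H2 x Xx)) _.
have -> : mid p q - p = (q - p) / 2 by rewrite midE; field.
have -> : q - mid p q = (q - p) / 2 by rewrite midE; field.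
rewrite nrm_half [2 ^+ k.+1]exprS le_eqVlt; apply/orP; left; apply/eqP; field.
by rewrite gt_eqF ?exprn_gt0 // gt_eqF.
Qed.

Lemma apprx_segI X p q (d : R) : 0 < d ->
  (forall t, 0 <= t <= 1 -> ~ hullE X (cpt p q t)) ->
  (forall t x, 0 <= t <= 1 -> X x -> d <= nrm (cpt p q t - x)) ->
  apprx X (fun x => segI (kf x) p q).
Proof.
move=> d0 nX dX e e0; have e2 : 0 < e / 2 by rewrite divr_gt0.
have [k hk] := small_pow (nrm (q - p) ^+ 2 / d ^+ 2) e2.
have [v hv H] := apprx_edge k d0 nX dX e2; exists v => // x /H h; apply: le_trans h _.
have -> : nrm (q - p) ^+ 2 / (d ^+ 2 * 2 ^+ k) = nrm (q - p) ^+ 2 / d ^+ 2 / 2 ^+ k by rewrite invfM mulrA.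
lra.
Qed.

Lemma edge_dist (S : set C) p q : compact S -> (forall t, 0 <= t <= 1 -> ~ S (cpt p q t)) ->
  exists2 d, 0 < d & forall t x, 0 <= t <= 1 -> S x -> d <= nrm (cpt p q t - x).
Proof.
move=> cS nS.
have [|x Sx|d d0 H] := compact_eps (P := fun (e : R) x => forall t, 0 <= t <= 1 -> e <= nrm (cpt p q t - x)) cS.
- by move=> e e' x _ ee' h t /h; exact: le_trans.
- have [|t t01|m m0 hm] := @seg_min R (fun w => w - x) p q.
  + by move=> t _; exact: cder_continuous (cder_sub x _).
  + by rewrite subr_eq0; apply/eqP => E; apply: (nS t t01); rewrite E.
  exists (m / 2); first by rewrite divr_gt0.
  apply/nbhs_nrm; exists (m / 2); first by rewrite divr_gt0.
  move=> y yx t /hm h1; have := nrm_tri (cpt p q t) y x; lra.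
by exists d => // t x t01 /H; exact.
Qed.

Definition vanish (F : R -> C) := forall e, 0 < e -> exists2 s, 0 < s &
  forall t, 0 < t < s -> nrm (F t) <= e.

Lemma vanish0 : vanish (fun=> 0).
Proof. by move=> e e0; exists 1 => // t _; rewrite nrm0 ltW. Qed.

Lemma vanishD F G : vanish F -> vanish G -> vanish (fun t => F t + G t).
Proof.
move=> hF hG e e0; have e2 : 0 < e / 2 by rewrite divr_gt0.
have [a a0 H1] := hF _ e2; have [b b0 H2] := hG _ e2.
exists (Num.min a b); first by rewrite lt_min a0.
move=> t; rewrite lt_min => /and3P[t0 ta tb].
apply: le_trans (nrmD _ _) _; have := H1 t; have := H2 t; rewrite t0 ta tb.
by move=> /(_ isT) ? /(_ isT) ?; lra.
Qed.

Lemma vanishN F : vanish F -> vanish (fun t => - F t).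
Proof. by move=> hF e /hF[s s0 H]; exists s => // t /H; rewrite nrmN. Qed.

Lemma vanish_sum n (F : 'I_n -> R -> C) : (forall i, vanish (F i)) ->
  vanish (fun t => \sum_(i < n) F i t).
Proof.
elim: n F => [|n ih] F hF.
  have -> : (fun t => \sum_(i < 0) F i t) = (fun=> 0) by apply/funext => z; rewrite big_ord0.
  exact: vanish0.
have -> : (fun t => \sum_(i < n.+1) F i t) =
    (fun t => \sum_(i < n) F (widen_ord (leqnSn n) i) t + F ord_max t).
  by apply/funext => z; rewrite big_ord_recr.
by apply: vanishD => //; apply: ih.
Qed.

Lemma vanish_segI p q z : (forall t, 0 <= t <= 1 -> cpt p q t - z != 0) ->
  vanish (fun s => segI (kf (z + rc s * (1 + ci))) p q - segI (kf z) p q).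
Proof.
move=> nz e e0.
have [|m m0 hm] := @seg_min R (fun w => w - z) p q _ nz.
  by move=> t _; exact: cder_continuous (cder_sub z _).
have N0 : 0 < 4 * (nrm (q - p) + 1) / m ^+ 2.
  by rewrite divr_gt0 ?exprn_gt0 // mulr_gt0 // ltr_wpDl ?nrm_ge0.
exists (Num.min (m / 4) (e / (4 * (nrm (q - p) + 1) / m ^+ 2))).
  by rewrite lt_min; apply/andP; split; apply: divr_gt0.
move=> s; rewrite lt_min => /and3P[s0 sm se].
set z1 := z + _.
have z1z : nrm (z1 - z) <= 2 * s.
  rewrite /z1 [z + _]addrC addrK nrmM nrm_rc gtr0_norm // mulrC ler_wpM2r ?(ltW s0) //.
  by apply: le_trans (nrmD _ _) _; rewrite nrm1 nrm_ci.
have h1 t : 0 <= t <= 1 -> m / 2 <= nrm (cpt p q t - z1).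
  move=> /hm ?; have := nrm_tri (cpt p q t) z1 z; lra.
have nz1 t : 0 <= t <= 1 -> cpt p q t - z1 != 0.
  by move=> /h1 h; rewrite -nrmc_gt0; apply: lt_le_trans h; rewrite divr_gt0.
have := hasI_lin (-1) (segI_has (kf_cts nz)) (segI_has (kf_cts nz1)).
rewrite mulN1r [X in hasI _ _ _ X]addrC => HH.
apply: le_trans (hasI_bound HH (M := 4 * s / m ^+ 2) _) _.
  move=> t t01; have a0 := nz t t01; have a1 := nz1 t t01.
  have -> : -1 * kf z (cpt p q t) + kf z1 (cpt p q t) = (z1 - z) / ((cpt p q t - z) * (cpt p q t - z1)).
    by rewrite /kf; field; rewrite a0 a1.
  rewrite nrmM nrmV nrmM.
  have -> : 4 * s / m ^+ 2 = (2 * s) * (m * (m / 2))^-1 by field; rewrite gt_eqF.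
  apply: ler_pM; rewrite ?nrm_ge0 ?invr_ge0 ?mulr_ge0 ?nrm_ge0 //.
  have m2 : 0 < m / 2 by rewrite divr_gt0.
  have g1 := hm t t01; have g2 := h1 t t01.
  rewrite lef_pV2 ?posrE ?mulr_gt0 //; [|exact: lt_le_trans g1|exact: lt_le_trans g2].
  by apply: ler_pM; rewrite ?(ltW m0) ?(ltW m2).
move: se; rewrite ltr_pdivlMr // => /ltW se; apply: le_trans se.
have -> : s * (4 * (nrm (q - p) + 1) / m ^+ 2) = 4 * s / m ^+ 2 * (nrm (q - p) + 1) by ring.
by rewrite ler_wpM2l ?lerDl // divr_ge0 ?exprn_ge0 ?(ltW m0) // mulr_ge0 // ltW.
Qed.

(* Cauchy kernel integrals over the horizontal and vertical edges across which [chi] jumps. *)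
Definition HJ (chi : nat -> nat -> bool) (o : C) (h : R) z (i j : nat) : C :=
  if j is j'.+1 then (if chi i j'.+1 != chi i j' then gH o h (kf z) i j'.+1 else 0) else 0.
Definition EJ (chi : nat -> nat -> bool) (o : C) (h : R) z (i j : nat) : C :=
  if i is i'.+1 then (if chi i'.+1 j != chi i' j then gE o h (kf z) i'.+1 j else 0) else 0.

Lemma Sm_apprx X m chi o h : (forall i j, apprx X (fun z => HJ chi o h z i j)) ->
  (forall i j, apprx X (fun z => EJ chi o h z i j)) ->
  apprx X (fun z => Sm m chi (HJ chi o h z) (EJ chi o h z)).
Proof.
move=> hH hE; apply: apprx_sum => i; apply: apprx_sum => j.
case: (chi i j); last exact: apprx0.
have N u : apprx X u -> apprx X (fun z => - u z).
  by move=> /(apprxZ (-1)); congr apprx; apply/funext => z; rewrite mulN1r.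
by do ?apply: apprxD => //; apply: N.
Qed.

Theorem separation X Y (B : R) : (forall x, X x -> nrm x <= B) -> (forall y, Y y -> nrm y <= B) ->
  (forall a, hullE X a -> hullE Y a -> False) ->
  forall e, 0 < e -> exists2 v, entire1 v &
    (forall x, X x -> nrm (v x) <= e) /\ (forall y, Y y -> nrm (v y - 1) <= e).
Proof.
move=> XB YB XY.
have cX := hull_compact XB; have cY := hull_compact YB.
set S := hullE (fun z => X z \/ Y z).
have SB z : S z -> nrm z <= B by apply: hull_bounded => w [/XB|/YB].
have cS : compact (S : set C) by apply: (@hull_compact R _ B) => w [/XB|/YB].
have [d d0 hd] := compact_dist cX (@hull_closed _ Y) (fun x h1 h2 => XY x h1 h2).
pose h := d / 16; have h0 : 0 < h by rewrite divr_gt0.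
have hD : 16 * h = d by rewrite /h mulrC divfK.
clearbody h.
have [k hk] := grid_cover B h0.
pose o : C := - rc (k%:R * h) - rc (k%:R * h) * ci.
have oE z : re z - re o = re z + k%:R * h /\ im z - im o = im z + k%:R * h.
  by rewrite /o !(reB, imB, reN, imN) reM imM !re_rc !im_rc re_ci im_ci; split; ring.
have [m mh] : exists m : nat, m%:R * h = 2 * (k%:R * h).
  by exists (2 * k)%N; rewrite natrM; ring.
pose chi := touch o h (hullE Y).
have rng z : nrm z <= B -> `|re z| <= B /\ `|im z| <= B.
  by move=> zz; split; apply: le_trans zz; [exact: re_le|exact: im_le].
have fr : frame0 m chi.
  move=> i; split; apply/asboolPn => -[g /(hull_bounded YB)/rng[]]; rewrite !ler_norml => /andP[r1 r2] /andP[r3 r4] /sqr_gv[];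
    have [-> ->] := oE g; move=> /andP[u1 u2] /andP[u3 u4]; lra.
pose E z := Sm m chi (HJ chi o h z) (EJ chi o h z).
have nS p q : jump_edge h (hullE Y) p q -> forall t, 0 <= t <= 1 -> ~ S (cpt p q t).
  move=> J t t01 St; have [nY [g Yg gh]] := jump_near J t01.
  have [hX|//] := union_hull XB YB XY St.
  have := hd _ _ hX Yg; lra.
have aJ p q : jump_edge h (hullE Y) p q -> apprx (fun z => X z \/ Y z) (fun z => segI (kf z) p q).
  move=> J; have [r r0 hr] := edge_dist cS (nS p q J).
  by apply: (apprx_segI r0 (nS p q J)) => t x t01 xXY; apply: hr => //; exact: hullE_sub.
have Eap : apprx (fun z => X z \/ Y z) E.
  apply: Sm_apprx => i j.
    case: j => [|j]; first exact: apprx0.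
    rewrite /HJ; case: (boolP (chi i j.+1 != chi i j)) => J; last exact: apprx0.
    exact: aJ (jump_h h0 J).
  case: i => [|i]; first exact: apprx0.
  rewrite /EJ; case: (boolP (chi i.+1 j != chi i j)) => J; last exact: apprx0.
  exact: aJ (jump_v h0 J).
have idx (x : R) : `|x| <= B -> exists2 i : nat, (i < m)%N & i%:R * h <= x + k%:R * h < i.+1%:R * h.
  rewrite ler_norml => /andP[x1 x2]; have x3 : 0 <= (x + k%:R * h) / h by rewrite divr_ge0 ?(ltW h0) //; lra.
  have /andP[t1 t2] := truncn_itv x3.
  exists (Num.truncn ((x + k%:R * h) / h)); last by rewrite -ler_pdivlMr // -ltr_pdivrMr // t1.
  rewrite -(ltr_nat R); apply: le_lt_trans t1 _; rewrite ltr_pdivrMr // mh; lra.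
have Eval z : X z \/ Y z -> exists i j, sqr (gv o h i j) h z /\ E z = if chi i j then W h else 0.
  move=> zXY; have Sz : S z by exact: hullE_sub.
  have [zr zi] := rng _ (SB _ Sz).
  have [i iM /andP[i1 i2]] := idx _ zr; have [j jM /andP[j1 j2]] := idx _ zi.
  exists i, j; have zs : sqr (gv o h i j) h z.
    by apply/sqr_gv; have [-> ->] := oE z; split; apply/andP; split; lra.
  split=> //.
  pose zt s := z + rc s * (1 + ci).
  have van : vanish (fun s => E (zt s) - E z).
    have -> : (fun s => E (zt s) - E z) = (fun s => Sm m chi
         (fun i j => HJ chi o h (zt s) i j - HJ chi o h z i j)
         (fun i j => EJ chi o h (zt s) i j - EJ chi o h z i j)).
      by apply/funext => s; rewrite /E SmB.
    have vH i' j' : vanish (fun s => HJ chi o h (zt s) i' j' - HJ chi o h z i' j').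
      rewrite /HJ; case: j' => [|j'].
        by rewrite (_ : (fun s => 0 - 0) = (fun=> 0)); [exact: vanish0|apply/funext => s; rewrite subrr].
      case: (boolP (chi i' j'.+1 != chi i' j')) => [/(jump_h h0) J|_]; last first.
        by rewrite (_ : (fun s => 0 - 0) = (fun=> 0)); [exact: vanish0|apply/funext => s; rewrite subrr].
      apply: vanish_segI => t t01; rewrite subr_eq0; apply/eqP => tz.
      by apply: (nS _ _ J t t01); rewrite tz.
    have vE i' j' : vanish (fun s => EJ chi o h (zt s) i' j' - EJ chi o h z i' j').
      rewrite /EJ; case: i' => [|i'].
        by rewrite (_ : (fun s => 0 - 0) = (fun=> 0)); [exact: vanish0|apply/funext => s; rewrite subrr].
      case: (boolP (chi i'.+1 j' != chi i' j')) => [/(jump_v h0) J|_]; last first.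
        by rewrite (_ : (fun s => 0 - 0) = (fun=> 0)); [exact: vanish0|apply/funext => s; rewrite subrr].
      apply: vanish_segI => t t01; rewrite subr_eq0; apply/eqP => tz.
      by apply: (nS _ _ J t t01); rewrite tz.
    apply: vanish_sum => i'; apply: vanish_sum => j'.
    case: (chi i' j'); last exact: vanish0.
    by do ?apply: vanishD => //; apply: vanishN.
  apply/eqP; rewrite eq_sym -subr_eq0; apply/eqP/nrm_lt_eps => e e0.
  have [s s0 hs] := van e e0.
  pose g := Num.min s (Num.min (i.+1%:R * h - (re z + k%:R * h)) (j.+1%:R * h - (im z + k%:R * h))) / 2.
  have mm : 0 < Num.min s (Num.min (i.+1%:R * h - (re z + k%:R * h)) (j.+1%:R * h - (im z + k%:R * h))).
    by rewrite !lt_min s0 !subr_gt0 i2 j2.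
  have g0 : 0 < g by rewrite divr_gt0.
  have [gs [gi gj]] : g < s /\ g < i.+1%:R * h - (re z + k%:R * h) /\ g < j.+1%:R * h - (im z + k%:R * h).
    have gm : g < Num.min s (Num.min (i.+1%:R * h - (re z + k%:R * h)) (j.+1%:R * h - (im z + k%:R * h))).
      by rewrite /g ltr_pdivrMr // ltr_pMr // ltr1n.
    by move: gm; rewrite !lt_min => /and3P[].
  clearbody g.
  have zti : inside (gv o h i j) h (zt g).
    apply/inside_gv; have [-> ->] := oE (zt g); rewrite /zt !reD !imD reM imM !reD !imD re1 im1 re_ci im_ci re_rc im_rc.
    by split; apply/andP; split; lra.
  have -> : (if chi i j then W h else 0) = E (zt g).
    rewrite -(grid_sum h0 chi iM jM zti); apply: Sm_agree fr _ _ => i' j' /= hJ; by rewrite hJ.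
  by apply: hs; rewrite g0.
have EX x : X x -> E x = 0.
  move=> Xx; have [i [j [sx ->]]] := Eval x (or_introl Xx).
  rewrite /chi /touch asboolF // => -[y Yy sy].
  have := sqr_diam sx sy; have := hd _ _ (hullE_sub Xx) Yy; lra.
have EY y : Y y -> E y = W h.
  move=> Yy; have [i [j [sy ->]]] := Eval y (or_intror Yy).
  by rewrite /chi /touch asboolT //; exists y => //; exact: hullE_sub.
move=> e e0; have [v hv H] := apprxZ (W h)^-1 Eap e0.
exists v => //; split=> [x Xx|y Yy].
  by have := H x (or_introl Xx); rewrite EX // mulr0 sub0r nrmN.
by have := H y (or_intror Yy); rewrite EY // mulVf ?W_neq0 // nrmC.
Qed.

End Idempotent.

(** * The inverse function theorem *)

Section RowVectors.
Variable R : realType.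
Notation C := (Cplx R).

Lemma nrm_entry n (v : 'rV[C]_n) j : nrm (v 0 j) <= nrm v.
Proof.
have E : `|v| = mx_norm v by [].
rewrite -rc_le -!normE E mx_normE.
rewrite -[leLHS]nngE num_le.
exact: (le_bigmax _ (fun i : 'I_1 * 'I_n => (`|v i.1 i.2|%:nng)) (0, j)).
Qed.

Lemma nrm_rV_le n (v : 'rV[C]_n) (M : R) : 0 <= M -> (forall j, nrm (v 0 j) <= M) -> nrm v <= M.
Proof.
move=> M0 vM; have E : `|v| = mx_norm v by [].
rewrite -rc_le -normE E mx_normE.
have M0' : 0 <= rc M by rewrite -rc0 rc_le.
have -> : rc M = (NngNum M0')%:num by [].
rewrite num_le; apply/bigmax_leP; split=> // -[i j] _ /=.
by rewrite -num_le /= (ord1 i) normE rc_le.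
Qed.

Lemma nrm_dist (V : normedZmodType C) (v w : V) : `|nrm v - nrm w| <= nrm (v - w).
Proof. by rewrite ler_norml nrm_sub andbT lerNl opprB [nrm (v - w)]nrmC nrm_sub. Qed.

Lemma ball_compact n (c : 'rV[C]_n) (r : R) : 0 <= r -> compact [set v | nrm (v - c) <= r].
Proof.
move=> r0.
have -> : [set v | nrm (v - c) <= r] =
    [set v : 'rV[C]_n | forall i, [set z : C | nrm (z - c 0 i) <= r] (v ord0 i)].
  apply/seteqP; split=> v /=.
    by move=> h i; apply: le_trans h; have := nrm_entry (v - c) i; rewrite !mxE.
  by move=> h; apply: nrm_rV_le => // j; rewrite !mxE.
apply: (@rV_compact C n (fun i => [set z : C | nrm (z - c 0 i) <= r])) => i.
apply: (@cplx_compact R _ (r + nrm (c 0 i))).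
  apply: closed_nrm => x H /=; apply/ler_addgt0Pr => e /H[y /= yc yx].
  by have := nrm_tri x y (c 0 i); rewrite [nrm (x - y)]nrmC; lra.
by move=> z /= h; have := nrm_sub z (c 0 i); lra.
Qed.

Definition ej n (j : 'I_n) : 'rV[C]_n := delta_mx 0 j.

Lemma ej_sum n (v : 'rV[C]_n) : v = \sum_j v 0 j *: ej j.
Proof. by rewrite {1}[v]matrix_sum_delta big_ord1. Qed.

Lemma lin_rV n (L : 'rV[C]_n -> C) : (forall a u v, L (a *: u + v) = a * L u + L v) ->
  forall v, L v = \sum_j v 0 j * L (ej j).
Proof.
move=> lin v; rewrite {1}[v]ej_sum.
have L0 : L 0 = 0 by have := lin (-1) 0 0; rewrite scaler0 addr0 mulN1r addNr.
elim/big_rec2: _ => [|j x y _ <-]; first exact: L0.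
exact: lin.
Qed.

Lemma lin_rV_bound n (L : 'rV[C]_n -> C) : (forall a u v, L (a *: u + v) = a * L u + L v) ->
  exists2 B, 0 < B & forall v, nrm (L v) <= B * nrm v.
Proof.
move=> lin; exists (\sum_j nrm (L (ej j)) + 1).
  by rewrite ltr_wpDl // sumr_ge0 // => j _; exact: nrm_ge0.
move=> v; rewrite (lin_rV lin v); apply: le_trans (nrm_sum _ _ _) _.
apply: (@le_trans _ _ ((\sum_j nrm (L (ej j))) * nrm v)); last first.
  by rewrite ler_wpM2r ?nrm_ge0 // lerDl.
rewrite mulr_suml; apply: ler_sum => j _; rewrite nrmM mulrC ler_wpM2l ?nrm_ge0 //.
exact: nrm_entry.
Qed.

Lemma lin_rV_dif n (f : 'rV[C]_n -> C) x L : (forall a u v, L (a *: u + v) = a * L u + L v) ->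
  hasder f x L -> differentiable f x /\ forall v, dif f x v = L v.
Proof. by move=> lin; have [B _ LB] := lin_rV_bound lin; exact: hasder_dif lin LB. Qed.

Lemma mxbound m n (A : 'M[C]_(m, n)) : exists2 B, 0 < B & forall v : 'rV[C]_m, nrm (v *m A) <= B * nrm v.
Proof.
have H j : exists B, 0 < B /\ forall v : 'rV[C]_m, nrm ((v *m A) 0 j) <= B * nrm v.
  have [|B B0 HB] := @lin_rV_bound m (fun v => (v *m A) 0 j).
    by move=> a u v; rewrite mulmxDl -scalemxAl !mxE.
  by exists B.
have [B HB] := choice H; have B0 j : 0 <= B j := ltW (HB j).1.
have S0 : 0 <= \sum_j B j by apply: sumr_ge0 => j _; exact: B0.
exists (\sum_j B j + 1); first by rewrite ltr_wpDl.
move=> v; apply: nrm_rV_le.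
  by rewrite mulr_ge0 ?nrm_ge0 // addr_ge0.
move=> j; apply: le_trans ((HB j).2 v) _; rewrite ler_wpM2r ?nrm_ge0 //.
rewrite (bigD1 j) //= -addrA lerDl addr_ge0 //; apply: sumr_ge0 => i _; exact: B0.
Qed.

Lemma compact_min (T : topologicalType) (K : set T) (u : T -> R) x0 : compact K -> K x0 ->
  (forall x e, K x -> 0 < e -> nbhs x [set y | `|u y - u x| < e]) ->
  exists2 x, K x & forall y, K y -> u x <= u y.
Proof.
move=> cK K0 cu.
have loc x : K x -> exists M, nbhs x [set y | - u y <= M].
  move=> Kx; exists (- u x + 1); apply: filterS (cu x 1 Kx ltr01) => y /=.
  by rewrite ltr_norml => /andP[]; lra.
have [M M0 HM] := @compact_bound R T K (fun x => - u x) cK loc.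
pose A := [set u x | x in K].
have hA : has_inf A.
  by split; [exists (u x0), x0|exists (- M) => _ [x Kx <-]; have := HM x Kx; lra].
apply: contrapT => H.
have H' x : K x -> inf A < u x.
  move=> Kx; rewrite lt_neqAle; apply/andP; split; last by apply: ge_inf; [exact: hA.2|exists x].
  apply/eqP => E; apply: H; exists x => // y Ky; rewrite -E; apply: ge_inf; [exact: hA.2|by exists y].
have loc' x : K x -> exists2 e, 0 < e & nbhs x [set y | e <= u y - inf A].
  move=> Kx; exists ((u x - inf A) / 2); first by rewrite divr_gt0 // subr_gt0 H'.
  have h2 : 0 < (u x - inf A) / 2 by rewrite divr_gt0 // subr_gt0 H'.
  apply: filterS (cu x _ Kx h2) => y /=.
  by rewrite ltr_norml => /andP[]; lra.
have [e e0 he] := @compact_lower R T K (fun x => u x - inf A) cK loc'.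
have [_ [x Kx <-]] := inf_adherent e0 hA.
by have := he x Kx; lra.
Qed.

Definition D n m (F : 'I_m -> 'rV[C]_n -> C) (x : 'rV[C]_n) : 'M[C]_(n, m) :=
  \matrix_(k, i) dif (F i) x (ej k).
Definition vec n m (F : 'I_m -> 'rV[C]_n -> C) (x : 'rV[C]_n) : 'rV[C]_m := \row_i F i x.

Lemma DE n m (F : 'I_m -> 'rV[C]_n -> C) x v : v *m D F x = \row_i dif (F i) x v.
Proof.
apply/rowP => i; rewrite !mxE (lin_rV (difP (F i) x)); apply: eq_bigr => k _.
by rewrite !mxE.
Qed.

Lemma vec_hasder n m (F : 'I_m -> 'rV[C]_n -> C) x : (forall i, differentiable (F i) x) ->
  hasder (vec F) x (fun v => v *m D F x).
Proof.
move=> dF e e0.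
have H i : exists d, 0 < d /\ forall h, nrm h < d -> nrm (F i (x + h) - F i x - dif (F i) x h) <= e * nrm h.
  by have [d d0 dh] := dif_hasder (dF i) e0; exists d.
have [d Hd] := choice H.
have [dm dm0 dmP] : exists2 dm, 0 < dm & forall i, dm <= d i.
  exists (\big[Num.min/1]_i d i).
    by elim/big_rec: _ => // i y _ y0; rewrite lt_min y0 (Hd i).1.
  by move=> i; exact: bigmin_le_cond.
exists dm => // h hd; apply: nrm_rV_le; first by rewrite mulr_ge0 ?nrm_ge0 // ltW.
by move=> i; rewrite DE !mxE; apply: (Hd i).2; apply: lt_le_trans hd (dmP i).
Qed.

Lemma chain n m (G : 'I_m -> 'rV[C]_n -> C) (f : 'rV[C]_m -> C) x :
  (forall i, differentiable (G i) x) -> differentiable f (vec G x) ->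
  differentiable (fun y => f (vec G y)) x /\
  forall v, dif (fun y => f (vec G y)) x v = dif f (vec G x) (v *m D G x).
Proof.
move=> dG df; apply: lin_rV_dif.
  by move=> a u v; rewrite mulmxDl -scalemxAl difP.
have [A A0 HA] := mxbound (D G x); have [B B0 HB] := dif_bound df.
move=> e e0.
have A1 : 0 < A + 1 by rewrite addr_gt0.
have [b b0 bh] := dif_hasder df (divr_gt0 e0 (mulr_gt0 (ltr0n R 2) A1)).
have m0 : 0 < Num.min 1 (e / (2 * B)) by rewrite lt_min ltr01 divr_gt0 // mulr_gt0.
have [c c0 ch] := vec_hasder dG m0.
exists (Num.min c (b / (A + 1))); first by rewrite lt_min c0 divr_gt0.
move=> h; rewrite lt_min ltr_pdivlMr // => /andP[/ch h1 hb].
have h0 := nrm_ge0 h.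
set k := vec G (x + h) - vec G x in h1 *.
have k1 : nrm k <= (A + 1) * nrm h.
  have -> : k = (k - h *m D G x) + h *m D G x by rewrite subrK.
  apply: le_trans (nrmD _ _) _; rewrite addrC mulrDl; apply: lerD; first exact: HA.
  by apply: le_trans h1 _; rewrite ler_wpM2r // ge_min lexx.
have k2 : nrm k < b by apply: le_lt_trans k1 _; rewrite mulrC.
have := bh _ k2; have -> : vec G x + k = vec G (x + h) by rewrite /k addrC subrK.
move=> k3.
have -> : f (vec G (x + h)) - f (vec G x) - dif f (vec G x) (h *m D G x) =
  (f (vec G (x + h)) - f (vec G x) - dif f (vec G x) k) + dif f (vec G x) (k - h *m D G x).
  by rewrite (difB f (vec G x) k); ring.
apply: le_trans (nrmD _ _) _.
have -> : e * nrm h = e / (2 * (A + 1)) * ((A + 1) * nrm h) + B * (e / (2 * B) * nrm h).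
  by field; rewrite !gt_eqF.
apply: lerD.
  by apply: le_trans k3 _; rewrite ler_wpM2l // divr_ge0 ?mulr_ge0 // ltW.
apply: le_trans (HB _) _; rewrite ler_wpM2l ?(ltW B0) //; apply: le_trans h1 _.
by rewrite ler_wpM2r // ge_min lexx orbT.
Qed.

Lemma coord_dif n (i : 'I_n) (x : 'rV[C]_n) : differentiable (fun y : 'rV[C]_n => y 0 i) x /\
  forall v, dif (fun y : 'rV[C]_n => y 0 i) x v = v 0 i.
Proof.
apply: lin_rV_dif; first by move=> a u v; rewrite !mxE.
move=> e e0; exists 1 => // h _; rewrite mxE [x 0 i + _]addrC addrK subrr nrm0.
by rewrite mulr_ge0 ?nrm_ge0 // ltW.
Qed.

Definition inj_der n m (F : 'I_m -> 'rV[C]_n -> C) (x : 'rV[C]_n) :=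
  forall v, (forall i, dif (F i) x v = 0) -> v = 0.
Definition inj_ball n m (F : 'I_m -> 'rV[C]_n -> C) (q : 'rV[C]_n) (s : R) :=
  forall x y, nrm (x - q) < s -> nrm (y - q) < s -> (forall i, F i x = F i y) -> x = y.

Lemma inj_der_unit n (F : 'I_n -> 'rV[C]_n -> C) x : inj_der F x -> D F x \in unitmx.
Proof.
move=> inj; rewrite unitmxE unitfE; apply/negP => /det0P[v v0 vD].
move/eqP: v0; apply; apply: inj => i.
by have /rowP/(_ i) := vD; rewrite DE !mxE.
Qed.

Section InverseFunction.
Variables (n : nat) (F : 'I_n -> 'rV[C]_n -> C) (q : 'rV[C]_n) (s : R).
Hypotheses (s0 : 0 < s) (hF : forall i, hol (F i) q s) (iF : inj_ball F q s)
  (dF : forall x, nrm (x - q) < s -> inj_der F x).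

Lemma lower_bound x : nrm (x - q) < s -> exists2 B, 0 < B & exists2 d, 0 < d &
  forall h, nrm h < d -> nrm h <= B * nrm (vec F (x + h) - vec F x).
Proof.
move=> xs; have uD := inj_der_unit (dF xs).
have [B B0 HB] := mxbound (invmx (D F x)).
have B2 : 0 < (2 * B)^-1 by rewrite invr_gt0 mulr_gt0.
have [d d0 dh] := vec_hasder (fun i => hF i xs) B2.
exists (2 * B); first by rewrite mulr_gt0.
exists d => // h /dh h1; set k := vec F (x + h) - vec F x in h1 *.
have h2 : nrm h <= B * nrm (h *m D F x) by have := HB (h *m D F x); rewrite mulmxK.
have h3 : nrm (h *m D F x) <= nrm k + (2 * B)^-1 * nrm h.
  have -> : h *m D F x = k - (k - h *m D F x) by rewrite opprB addrC subrK.
  by apply: le_trans (nrmB _ _) _; rewrite lerD2l.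
have h4 : B * nrm (h *m D F x) <= B * (nrm k + (2 * B)^-1 * nrm h) by rewrite ler_wpM2l // ltW.
have : B * ((2 * B)^-1 * nrm h) = nrm h / 2 by field; rewrite gt_eqF.
lra.
Qed.

Lemma open_map x e : nrm (x - q) < s -> 0 < e -> exists2 d, 0 < d &
  forall y, nrm (y - vec F x) < d -> exists2 z, nrm (z - x) < e /\ nrm (z - q) < s & vec F z = y.
Proof.
move=> xs e0; have [B B0 [d d0 low]] := lower_bound xs.
pose r := Num.min (Num.min e d) (s - nrm (x - q)) / 2.
have mm : 0 < Num.min (Num.min e d) (s - nrm (x - q)) by rewrite !lt_min e0 d0 subr_gt0.
have r0 : 0 < r by rewrite divr_gt0.
have [re' [rd rs]] : r < e /\ r < d /\ r < s - nrm (x - q).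
  have : r < Num.min (Num.min e d) (s - nrm (x - q)) by rewrite /r ltr_pdivrMr // ltr_pMr // ltr1n.
  by rewrite !lt_min => /andP[/andP[]].
clearbody r.
have inS z : nrm (z - x) <= r -> nrm (z - q) < s.
  by move=> zr; apply: le_lt_trans (nrm_tri _ x _) _; lra.
exists (r / (2 * B)); first by rewrite divr_gt0 // mulr_gt0.
move=> y hy.
pose K := [set z | nrm (z - x) <= r].
have Kx : K x by rewrite /K /= subrr nrm0 ltW.
pose u z := nrm (vec F z - y).
have cu z e' : K z -> 0 < e' -> nbhs z [set w | `|u w - u z| < e'].
  move=> Kz e'0; have zs := inS z Kz.
  have [A A0 HA] := mxbound (D F z).
  have cF : {for z, continuous (vec F)}.
    exact: hasder_continuous HA (vec_hasder (fun i => hF i zs)).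
  apply/nbhs_nrm; have [a a0 ah] := (cvg_nrm (vec F) z).1 cF e' e'0.
  exists a => // w /ah wz; rewrite /= /u; apply: le_lt_trans (nrm_dist _ _) _.
  by rewrite opprB addrA subrK.
have [z Kz minz] := compact_min (@ball_compact n x r (ltW r0)) Kx cu.
exists z; first by split; [exact: le_lt_trans re'|exact: inS].
have ux : u x < r / (2 * B) by rewrite /u nrmC.
have uz : u z < r / (2 * B) by apply: le_lt_trans (minz x Kx) ux.
have zr : nrm (z - x) < r.
  rewrite lt_neqAle; apply/andP; split; last exact: Kz.
  apply/eqP => zr; have zd : nrm (z - x) < d by rewrite zr.
  have := low _ zd; rewrite [x + _]addrC subrK zr.
  have : nrm (vec F z - vec F x) <= u z + u x.
    have -> : vec F z - vec F x = (vec F z - y) - (vec F x - y) by rewrite opprB addrA subrK.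
    exact: nrmB.
  move=> h1 h2; have h3 : B * nrm (vec F z - vec F x) <= B * (u z + u x) by rewrite ler_wpM2l // ltW.
  have : B * (u z + u x) < B * (r / (2 * B) + r / (2 * B)) by rewrite ltr_pM2l // ltrD.
  have -> : B * (r / (2 * B) + r / (2 * B)) = r by field; rewrite gt_eqF.
  by move=> h4; have := lt_le_trans (le_lt_trans h3 h4) h2; rewrite ltxx.
apply/eqP; rewrite -subr_eq0; apply: contrapT => /negP nz.
have zs := inS z Kz; have uD := inj_der_unit (dF zs).
set w := vec F z - y in nz *; have w0 : 0 < nrm w by rewrite nrm_gt0.
pose v := - w *m invmx (D F z).
have vD : v *m D F z = - w by rewrite mulmxKV.
have v2 : nrm v < 2 * (nrm v + 1).
  by rewrite mulrDr mulr1 mulr_natl mulr2n -addrA ltrDl ltr_wpDl ?nrm_ge0.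
have N0 : 0 < 2 * (nrm v + 1) by rewrite mulr_gt0 // ltr_wpDl ?nrm_ge0.
have [a a0 ah] := vec_hasder (fun i => hF i zs) (divr_gt0 w0 N0).
pose t := Num.min 1 (Num.min (a / (2 * (nrm v + 1))) ((r - nrm (z - x)) / (2 * (nrm v + 1)))).
have t0 : 0 < t by rewrite !lt_min ltr01 !divr_gt0 // subr_gt0.
have t1 : t <= 1 by rewrite ge_min lexx.
have ta : t * (2 * (nrm v + 1)) <= a by rewrite -ler_pdivlMr // !ge_min lexx orbT.
have tr : t * (2 * (nrm v + 1)) <= r - nrm (z - x) by rewrite -ler_pdivlMr // !ge_min lexx !orbT.
clearbody t.
have ntv : nrm (rc t *: v) = t * nrm v by rewrite nrmZ nrm_rc gtr0_norm.
have tv2 : t * nrm v < t * (2 * (nrm v + 1)).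
  by rewrite ltr_pM2l.
have /ah : nrm (rc t *: v) < a by rewrite ntv; exact: lt_le_trans tv2 ta.
have Kt : K (z + rc t *: v).
  rewrite /K /= addrAC; apply: le_trans (nrmD _ _) _.
  by rewrite ntv -lerBrDl; apply: ltW; exact: lt_le_trans tv2 tr.
rewrite -scalemxAl vD ntv => h1; have := minz _ Kt; rewrite /u -/w.
have -> : vec F (z + rc t *: v) - y = (vec F (z + rc t *: v) - vec F z - rc t *: - w) + rc (1 - t) *: w.
  rewrite scalerN opprK rcB rc1 scalerBl scale1r -addrA [rc t *: w + _]addrC subrK /w.
  by rewrite addrA subrK.
have h2 := nrmD (vec F (z + rc t *: v) - vec F z - rc t *: - w) (rc (1 - t) *: w).
rewrite nrmZ nrm_rc ger0_norm ?subr_ge0 // in h2.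
have : nrm w / (2 * (nrm v + 1)) * (t * nrm v) < t * nrm w.
  have -> : nrm w / (2 * (nrm v + 1)) * (t * nrm v) = (t * nrm w) * (nrm v / (2 * (nrm v + 1))) by ring.
  have tw : 0 < t * nrm w by exact: mulr_gt0.
  by rewrite (gtr_pMr _ tw) (ltr_pdivrMr _ _ N0) mul1r.
move=> h3 h4; have := le_trans h4 (le_trans h2 (lerD h1 (lexx _))).
rewrite mulrBl mul1r addrCA lerDl subr_ge0 => h5.
by have := lt_le_trans h3 h5; rewrite ltxx.
Qed.

Theorem inverse_function : exists2 r, 0 < r & exists psi : 'rV[C]_n -> 'rV[C]_n,
  psi (vec F q) = q /\ forall y, nrm (y - vec F q) < r ->
  [/\ nrm (psi y - q) < s, vec F (psi y) = y & forall j, differentiable (fun z => psi z 0 j) y].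
Proof.
have qs : nrm (q - q) < s by rewrite subrr nrm0.
have [r r0 H] := open_map qs s0.
have ex y : exists z, nrm (y - vec F q) < r -> nrm (z - q) < s /\ vec F z = y.
  have [yr|yr] := ltP (nrm (y - vec F q)) r; last by exists 0.
  by have [z [_ zs] zy] := H y yr; exists z.
have [psi Hpsi] := choice ex.
have uniq x y : nrm (x - q) < s -> nrm (y - q) < s -> vec F x = vec F y -> x = y.
  by move=> xs ys E; apply: iF => // i; have /rowP/(_ i) := E; rewrite !mxE.
exists r => //; exists psi; split.
  have [|h1 h2] := Hpsi (vec F q); first by rewrite subrr nrm0.
  exact: uniq.
move=> y yr; have [xs xy] := Hpsi y yr; split=> // j.
set x := psi y in xs xy *.
have uD := inj_der_unit (dF xs).
pose L (h : 'rV[C]_n) : C := (h *m invmx (D F x)) 0 j.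
have lin : forall a u v, L (a *: u + v) = a * L u + L v.
  by move=> a u v; rewrite /L mulmxDl -scalemxAl !mxE.
suff hd : hasder (fun z => psi z 0 j) y L by have [] := lin_rV_dif lin hd.
move=> e e0.
have [A A0 HA] := mxbound (invmx (D F x)).
have [B B0 [d d0 low]] := lower_bound xs.
have [c c0 ch] := vec_hasder (fun i => hF i xs) (divr_gt0 e0 (mulr_gt0 A0 B0)).
have m0 : 0 < Num.min d c by rewrite lt_min d0.
have [g g0 gh] := open_map xs m0.
exists (Num.min g (r - nrm (y - vec F q))); first by rewrite lt_min g0 subr_gt0.
move=> h; rewrite lt_min => /andP[hg hr].
have yhr : nrm (y + h - vec F q) < r.
  by rewrite addrAC; apply: le_lt_trans (nrmD _ _) _; lra.
have [zs zy] := Hpsi _ yhr.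
have [|z' [z'm z's] z'y] := gh (y + h); first by rewrite xy addrAC subrr add0r.
have E : psi (y + h) = z' by apply: uniq => //; rewrite zy.
rewrite E; set k := z' - x.
have kE : x + k = z' by rewrite /k addrC subrK.
have [kd kc] : nrm k < d /\ nrm k < c by move: z'm; rewrite lt_min => /andP[].
have hE : vec F (x + k) - vec F x = h by rewrite kE z'y xy addrAC subrr add0r.
have k1 : nrm k <= B * nrm h by have := low _ kd; rewrite hE.
have k2 : nrm (h - k *m D F x) <= e / (A * B) * nrm k by have := ch _ kc; rewrite hE.
have -> : z' 0 j - x 0 j - L h = ((k *m D F x - h) *m invmx (D F x)) 0 j.
  by rewrite mulmxBl mulmxK // /L /k !mxE.
apply: le_trans (nrm_entry _ _) _; apply: le_trans (HA _) _.
rewrite nrmC; apply: le_trans (_ : A * (e / (A * B) * (B * nrm h)) <= _).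
  rewrite ler_wpM2l ?(ltW A0) //; apply: le_trans k2 _.
  by rewrite ler_wpM2l // divr_ge0 ?mulr_ge0 // ltW.
by rewrite le_eqVlt; apply/orP; left; apply/eqP; field; rewrite !gt_eqF.
Qed.

End InverseFunction.
End RowVectors.

(** * Injective holomorphic maps (Osgood) *)

Section Osgood.
Variable R : realType.
Notation C := (Cplx R).

Lemma dif_near (V : normedModType C) (f g : V -> C) x d : 0 < d ->
  (forall y, nrm (y - x) < d -> f y = g y) -> differentiable f x ->
  differentiable g x /\ forall v, dif g x v = dif f x v.
Proof.
move=> d0 fg df; have [B B0 fB] := dif_bound df.
apply: (@hasder_dif _ _ g x (dif f x) B) => //; first exact: difP.
move=> e /(dif_hasder df)[c c0 ch].
exists (Num.min c d); first by rewrite lt_min c0.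
move=> h; rewrite lt_min => /andP[/ch h1 hd].
by rewrite -!fg ?subrr ?nrm0 // [x + h]addrC addrK.
Qed.

Lemma dif_cst (V : normedModType C) (f : V -> C) x d : 0 < d ->
  (forall y, nrm (y - x) < d -> f y = f x) -> differentiable f x /\ forall v, dif f x v = 0.
Proof.
move=> d0 fc; apply: (@hasder_dif _ _ f x (fun=> 0) 0).
- by move=> a u v; rewrite mulr0 addr0.
- by move=> h; rewrite nrm0 mul0r.
move=> e e0; exists d => // h hd; rewrite fc ?subrr ?subr0 ?nrm0; last by rewrite [x + h]addrC addrK.
by rewrite mulr_ge0 ?nrm_ge0 // ltW.
Qed.

Lemma nrm_ej n (j : 'I_n) : nrm (ej R j) <= 1.
Proof.
apply: nrm_rV_le => // k; rewrite mxE eqxx /=; case: (k == j); first by rewrite nrm1.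
by rewrite nrm0.
Qed.

Lemma ej_neq0 n (j : 'I_n) : ej R j != 0.
Proof.
apply/eqP => /rowP/(_ j); rewrite !mxE !eqxx /= => /eqP; by rewrite oner_eq0.
Qed.

Lemma diff_det (V : normedModType C) n (A : V -> 'M[C]_n) x :
  (forall i j, differentiable (fun y => A y i j) x) -> differentiable (fun y => \det (A y)) x.
Proof.
move=> dA; rewrite /determinant.
have S (I : Type) (s : seq I) (f : I -> V -> C) : (forall i, differentiable (f i) x) ->
    differentiable (fun y => \sum_(i <- s) f i y) x.
  move=> df; elim: s => [|i s IH].
    by rewrite (_ : (fun _ => _) = cst 0) // funeqE => y; rewrite big_nil.
  rewrite (_ : (fun _ => _) = f i + fun y => \sum_(i <- s) f i y); first exact: differentiableD.
  by rewrite funeqE => y; rewrite big_cons.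
have P (I : Type) (s : seq I) (f : I -> V -> C) : (forall i, differentiable (f i) x) ->
    differentiable (fun y => \prod_(i <- s) f i y) x.
  move=> df; elim: s => [|i s IH].
    by rewrite (_ : (fun _ => _) = cst 1) // funeqE => y; rewrite big_nil.
  rewrite (_ : (fun _ => _) = f i * fun y => \prod_(i <- s) f i y); first exact: differentiableM.
  by rewrite funeqE => y; rewrite big_cons.
apply: (S _ _ (fun (s : {perm 'I_n}) y => (-1) ^+ s * \prod_i A y i (s i))) => s.
have h : differentiable (fun y => \prod_i A y i (s i)) x by apply: P.
exact: (@differentiableZ _ _ _ _ ((-1) ^+ s) x h).
Qed.

Section Coordinates.
Variables (n : nat) (j : 'I_n.+1).
Definition del (x : 'rV[C]_n.+1) : 'rV[C]_n := \row_k x 0 (lift j k).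
Definition insf (t : C) (k : 'I_n.+1) (y : 'rV[C]_n) : C := if unlift j k is Some i then y 0 i else t.
Definition ins t := vec (insf t).

Lemma del_ins t y : del (ins t y) = y.
Proof. by apply/rowP => k; rewrite !mxE /insf liftK. Qed.
Lemma ins_j t y : ins t y 0 j = t.
Proof. by rewrite mxE /insf unlift_none. Qed.
Lemma del_ext x y : del x = del y -> x 0 j = y 0 j -> x = y.
Proof.
move=> /rowP E h; apply/rowP => k; have [i ->|->] := unliftP j k => //.
by have := E i; rewrite !mxE.
Qed.
Lemma ins_del (x : 'rV[C]_n.+1) : ins (x 0 j) (del x) = x.
Proof. by apply: del_ext; rewrite ?del_ins ?ins_j. Qed.
Lemma delB x y : del (x - y) = del x - del y.
Proof. by apply/rowP => k; rewrite !mxE. Qed.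
Lemma insB t s x y : ins t x - ins s y = ins (t - s) (x - y).
Proof.
apply: del_ext; rewrite ?delB ?del_ins //.
by rewrite [LHS]mxE [X in _ + X]mxE !ins_j.
Qed.
Lemma nrm_ins t y : nrm (ins t y) <= nrm t + nrm y.
Proof.
apply: nrm_rV_le => [|k]; first by rewrite addr_ge0 ?nrm_ge0.
rewrite mxE /insf; case: unliftP => [i _|_]; last by rewrite lerDl nrm_ge0.
by apply: le_trans (nrm_entry _ _) _; rewrite lerDr nrm_ge0.
Qed.
Lemma del0_ej x : del x = 0 -> x = x 0 j *: ej R j.
Proof.
move=> x0; apply: del_ext; last by rewrite !mxE !eqxx mulr1.
rewrite x0; apply/rowP => k; rewrite !mxE eqxx eq_sym (negbTE (neq_lift _ _)) /=; exact/esym/mulr0.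
Qed.
Lemma insf_diff t k y : differentiable (insf t k) y.
Proof.
rewrite /insf; case: unliftP => [i _|_]; first exact: (coord_dif i y).1.
exact: differentiable_cst.
Qed.
Lemma ins_shift (q : 'rV[C]_n.+1) t : ins (q 0 j + t) (del q) = q + t *: ej R j.
Proof.
apply: del_ext; last by rewrite ins_j !mxE !eqxx mulr1.
rewrite del_ins; apply/rowP => k; rewrite !mxE eqxx eq_sym (negbTE (neq_lift _ _)) /= ?mulr0n mulr0 addr0.
by [].
Qed.
End Coordinates.

(* The inverse function theorem applied to x |-> (x with its j-th entry replaced by h x). *)
Lemma implicit n (h : 'rV[C]_n.+1 -> C) q (j : 'I_n.+1) r : 0 < r -> hol h q r -> h q = 0 ->
  dif h q (ej R j) != 0 ->
  exists2 d, 0 < d & exists2 r', 0 < r' <= r & exists2 s : 'rV[C]_n -> 'rV[C]_n.+1,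
    s (del j q) = q /\
    (forall x, nrm (x - q) < r' -> h x = 0 -> nrm (del j x - del j q) < d -> x = s (del j x)) &
    forall y, nrm (y - del j q) < d -> [/\ nrm (s y - q) < r', h (s y) = 0, del j (s y) = y &
      forall k, differentiable (fun z => s z 0 k) y].
Proof.
move=> r0 hh hq0 hj.
pose F (k : 'I_n.+1) (x : 'rV[C]_n.+1) : C := if k == j then h x else x 0 k.
have vF x : vec F x = ins j (h x) (del j x).
  apply/rowP => k; rewrite !mxE /F /insf; case: unliftP => [i ->|->]; last by rewrite eqxx.
  by rewrite eq_sym (negbTE (neq_lift _ _)) mxE.
have c0 : 0 < nrm (dif h q (ej R j)) by rewrite nrm_gt0.
have c2 : 0 < nrm (dif h q (ej R j)) / 2 by rewrite divr_gt0.
have [a a0 ah] := strict_diff r0 hh c2.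
have /differentiable_continuous/cvg_nrm/(_ _ c0)[b b0 bh] := diff_diff (ej R j) r0 hh.
pose s0 := Num.min r (Num.min a b).
have s00 : 0 < s0 by rewrite !lt_min r0 a0.
have s0r : s0 <= r by rewrite ge_min lexx.
have hF k : hol (F k) q s0.
  move=> x; rewrite lt_min => /andP[xr _].
  by rewrite /F; case: (k == j); [exact: hh|exact: (coord_dif k x).1].
have Fdel x y : (forall k, F k x = F k y) -> del j x = del j y /\ h x = h y.
  move=> E; split; last by have := E j; rewrite /F eqxx.
  by apply/rowP => k; have := E (lift j k); rewrite !mxE /F eq_sym (negbTE (neq_lift _ _)).
have iF : inj_ball F q s0.
  move=> x y; rewrite !lt_min => /andP[_ /andP[xa _]] /andP[_ /andP[ya _]] /Fdel[E1 E2].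
  have := ah x y xa ya; rewrite E2 subrr sub0r nrmN.
  have D0 : del j (x - y) = 0 by rewrite delB E1 subrr.
  rewrite (del0_ej D0) difZ [nrm (_ * _)]nrmM nrmZ => H.
  apply/eqP; rewrite -subr_eq0 (del0_ej D0); apply/eqP.
  suff -> : (x - y) 0 j = 0 by rewrite scale0r.
  apply: contrapT => /eqP; rewrite -nrm_gt0 => z0.
  move: H; rewrite [leRHS]mulrCA ler_pM2l // => H.
  have : nrm (dif h q (ej R j)) / 2 * nrm (ej R j) <= nrm (dif h q (ej R j)) / 2.
    by rewrite ler_piMr ?(ltW c2) // nrm_ej.
  by move: c0 H; lra.
have dF x : nrm (x - q) < s0 -> inj_der F x.
  rewrite !lt_min => /andP[_ /andP[_ xb]] v vF0.
  have D0 : del j v = 0.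
    apply/rowP => k; rewrite !mxE -[RHS](vF0 (lift j k)) /F eq_sym (negbTE (neq_lift _ _)).
    by rewrite (coord_dif _ x).2.
  have := vF0 j; rewrite /F eqxx (del0_ej D0) difZ => /eqP; rewrite mulf_eq0 => /orP[/eqP ->|].
    by rewrite scale0r.
  move=> /eqP E; have := bh x xb.
  by rewrite E sub0r nrmN ltxx.
have [d d0 [psi [psi0 psiP]]] := inverse_function s00 hF iF dF.
have q0 : vec F q = ins j 0 (del j q) by rewrite vF hq0.
have insd y : nrm (y - del j q) < d -> nrm (ins j 0 y - vec F q) < d.
  rewrite q0 insB subrr; apply: le_lt_trans; apply: le_trans (nrm_ins _ _ _) _.
  by rewrite nrm0 add0r.
have del_s y : nrm (y - del j q) < d -> h (psi (ins j 0 y)) = 0 /\ del j (psi (ins j 0 y)) = y.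
  move=> /insd/psiP[_]; rewrite vF => E _; split.
    by rewrite -(ins_j j (h _) (del j (psi (ins j 0 y)))) E ins_j.
  by rewrite -(del_ins j (h (psi (ins j 0 y))) (del j (psi (ins j 0 y)))) E del_ins.
exists d => //; exists s0; first by rewrite s00.
exists (fun y => psi (ins j 0 y)); first split.
- by rewrite -q0.
- move=> x xs hx xd; have [xs' _ _] := psiP _ (insd _ xd).
  have [h1 h2] := del_s _ xd.
  apply: iF => // k; rewrite /F; case: eqP => [_|/eqP kj]; first by rewrite h1.
  have [i ->|E] := unliftP j k; last by rewrite E eqxx in kj.
  by have /rowP/(_ i) := h2; rewrite !mxE.
move=> y yd; have [h1 h2 h3] := psiP _ (insd _ yd); have [h4 h5] := del_s _ yd.
split=> // k.
exact: (@chain R n n.+1 (insf j 0) (fun z => psi z 0 k) y (insf_diff j 0 ^~ y) (h3 k)).1.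
Qed.


Definition osgood n := forall (F : 'I_n -> 'rV[C]_n -> C) p r, 0 < r ->
  (forall i, hol (F i) p r) -> inj_ball F p r -> inj_der F p.

(* Where some derivative is nonzero, slicing along a level set of one component
   reduces the dimension by one. *)
Lemma osgood_slice n (F : 'I_n.+1 -> 'rV[C]_n.+1 -> C) p r q i v : osgood n ->
  (forall i, hol (F i) p r) -> inj_ball F p r -> nrm (q - p) < r ->
  dif (F i) q v != 0 -> inj_der F q.
Proof.
move=> IH hF iF qp dv.
have [j dj] : exists j, dif (F i) q (ej R j) != 0.
  apply: contrapT => H; move/eqP: dv; apply; rewrite (lin_rV (difP (F i) q)).
  apply: big1 => j _; have [->|jn] := eqVneq (dif (F i) q (ej R j)) 0; first by rewrite mulr0.
  by case: H; exists j.
pose r' := r - nrm (q - p); have r'0 : 0 < r' by rewrite subr_gt0.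
have inr x : nrm (x - q) < r' -> nrm (x - p) < r.
  by rewrite /r' => h; apply: le_lt_trans (nrm_tri x q p) _; lra.
pose h := fsubc (F i) (F i q).
have hsub x : nrm (x - q) < r' -> differentiable h x /\ forall v, dif h x v = dif (F i) x v.
  by move=> /inr/(hF i); exact: diff_subc.
have hh : hol h q r' by move=> x /hsub[].
have hq : h q = 0 by rewrite /h /fsubc subrr.
have qq : nrm (q - q) < r' by rewrite subrr nrm0.
have hj : dif h q (ej R j) != 0 by rewrite (hsub q qq).2.
have [d d0 [s0 /andP[s00 s0r] [s [sq _] sP]]] := implicit r'0 hh hq hj.
have sr y : nrm (y - del j q) < d -> nrm (s y - q) < r' by move=> /sP[h1 _ _ _]; apply: lt_le_trans s0r.
have sv z : vec (fun k z => s z 0 k) z = s z by apply/rowP => k; rewrite mxE.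
have ch k y : nrm (y - del j q) < d -> differentiable (fun z => F k (s z)) y /\
    forall w, dif (fun z => F k (s z)) y w = dif (F k) (s y) (w *m D (fun k z => s z 0 k) y).
  move=> yd; have [_ _ _ ds] := sP y yd.
  have dFk : differentiable (F k) (vec (fun k z => s z 0 k) y) by rewrite sv; apply/hF/inr/sr.
  have := chain ds dFk; rewrite sv.
  by rewrite (_ : (fun z => F k (vec _ z)) = fun z => F k (s z)) // funeqE => z; rewrite sv.
pose g (k : 'I_n) z := F (lift i k) (s z).
have gd : inj_der g (del j q).
  apply: (IH g _ d d0); first by move=> k y /(ch (lift i k))[].
  move=> y z yd zd E; have [_ hy dy _] := sP y yd; have [_ hz dz _] := sP z zd.
  rewrite -dy -dz; congr (del j _); apply: iF; try exact/inr/sr.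
  move=> k; have [k' ->|->] := unliftP i k; first exact: E.
  by move: hy hz; rewrite /h /fsubc => /subr0_eq -> /subr0_eq ->.
have pq : nrm (del j q - del j q) < d by rewrite subrr nrm0.
have [_ _ _ ds] := sP _ pq.
move=> u u0; set S := del j u *m D (fun k z => s z 0 k) (del j q).
have Sk k : S 0 (lift j k) = u 0 (lift j k).
  rewrite /S DE mxE.
  have c1 := coord_dif k (del j q).
  have e1 y : nrm (y - del j q) < d -> y 0 k = s y 0 (lift j k).
    by move=> /sP[_ _ h1 _]; rewrite -{1}h1 mxE.
  by rewrite (dif_near d0 e1 c1.1).2 c1.2 mxE.
have Si : dif (F i) q S = 0.
  have e2 y : nrm (y - del j q) < d -> F i (s y) = F i (s (del j q)).
    move=> /sP[_ hy _ _]; move: hy; rewrite /h /fsubc => /subr0_eq ->; by rewrite sq.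
  by have := (ch i _ pq).2 (del j u); rewrite sq -/S => <-; apply: (dif_cst d0 e2).2.
have uS : u = S.
  have D0 : del j (u - S) = 0.
    rewrite delB; apply/rowP => k; rewrite mxE [X in _ + X]mxE [del j u 0 k]mxE [del j S 0 k]mxE Sk.
    by rewrite subrr mxE.
  apply/eqP; rewrite -subr_eq0 (del0_ej D0).
  have := difB (F i) q u S; rewrite u0 Si subrr {1}(del0_ej D0) difZ => /eqP.
  by rewrite mulf_eq0 (negbTE dj) orbF => /eqP ->; rewrite scale0r.
have : del j u = 0.
  apply: gd => k; have := (ch (lift i k) _ pq).2 (del j u).
  by rewrite /g sq -/S -uS u0.
by move=> u'0; rewrite uS /S u'0 mul0mx.
Qed.

Lemma zero_der_const (V : normedModType C) (f : V -> C) p d : hol f p d ->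
  (forall y v, nrm (y - p) < d -> dif f y v = 0) ->
  forall y z, nrm (y - p) < d -> nrm (z - p) < d -> f y = f z.
Proof.
move=> hf df0 y z yd zd; apply/eqP; rewrite -subr_eq0 -nrm_eq0 eq_le nrm_ge0 andbT.
have -> : y = z + (y - z) by rewrite addrC subrK.
apply: mv_seg => t /andP[t0 t1].
have h : nrm (z + rc t *: (y - z) - p) < d.
  have -> : z + rc t *: (y - z) - p = rc (1 - t) *: (z - p) + rc t *: (y - p).
    rewrite rcB rc1 scalerBl scale1r addrAC -[RHS]addrA; congr (_ + _).
    by rewrite addrC -scalerBr opprB addrA subrK.
  apply: le_lt_trans (nrmD _ _) _; rewrite !nrmZ !nrm_rc !ger0_norm ?subr_ge0 //.
  have [t00|tp] := leP t 0.
    have -> : t = 0 by apply/le_anti; rewrite t00.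
    by rewrite subr0 mul1r mul0r addr0.
  have : t * nrm (y - p) < t * d by rewrite ltr_pM2l.
  have : (1 - t) * nrm (z - p) <= (1 - t) * d by rewrite ler_wpM2l ?subr_ge0 ?(ltW zd).
  lra.
by split; [exact: hf|rewrite df0 // nrm0].
Qed.

Lemma half_bound (u v : C) (m : R) : m <= nrm u -> nrm (v - u) <= m / 16 -> m / 2 <= nrm v.
Proof. by move=> h1 h2; have := nrm_sub u v; have := nrm_ge0 (v - u); rewrite nrmC; lra. Qed.

Section Step.
Variables (n : nat) (F : 'I_n.+2 -> 'rV[C]_n.+2 -> C) (p : 'rV[C]_n.+2) (r : R).
Hypotheses (r0 : 0 < r) (hF : forall i, hol (F i) p r) (iF : inj_ball F p r)
  (slice : forall q i v, nrm (q - p) < r -> dif (F i) q v != 0 -> inj_der F q)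
  (nF : ~ inj_der F p).
Let J x := \det (D F x).

Lemma J_hol : hol J p r.
Proof.
move=> x xr; apply: diff_det => k i.
have hx : hol (F i) x (r - nrm (x - p)) by apply: hol_sub (hF i) _; lra.
rewrite (_ : (fun y => _) = fun y => dif (F i) y (ej R k)); last by rewrite funeqE => y; rewrite mxE.
by apply: (diff_diff _ _ hx); rewrite subr_gt0.
Qed.

Lemma not_inj_dif x : nrm (x - p) < r -> ~ inj_der F x -> forall i v, dif (F i) x v = 0.
Proof.
by move=> xr nx i v; have [//|h] := eqVneq (dif (F i) x v) 0; case: nx; apply: slice h.
Qed.

Lemma J0_dif x : nrm (x - p) < r -> J x = 0 -> forall i v, dif (F i) x v = 0.
Proof.
move=> xr Jx; apply: not_inj_dif => // /inj_der_unit.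
by rewrite unitmxE unitfE -/(J x) Jx eqxx.
Qed.

Lemma Jp : J p = 0.
Proof.
have pp : nrm (p - p) < r by rewrite subrr nrm0.
have E : D F p = 0 by apply/matrixP => k i; rewrite !mxE not_inj_dif.
by rewrite /J E det0.
Qed.

Lemma const_contra q s : 0 < s -> nrm (q - p) + s <= r ->
  (forall x, nrm (x - q) < s -> J x = 0) -> False.
Proof.
move=> s0 qs JF.
have inr x : nrm (x - q) < s -> nrm (x - p) < r.
  by move=> h; apply: le_lt_trans (nrm_tri x q p) _; lra.
have qq : nrm (q - q) < s by rewrite subrr nrm0.
pose x := q + rc (s / 2) *: ej R ord0.
have xs : nrm (x - q) < s.
  rewrite /x [q + _]addrC addrK nrmZ nrm_rc gtr0_norm ?divr_gt0 //.
  apply: le_lt_trans (_ : s / 2 * 1 < s); last lra.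
  by rewrite ler_wpM2l ?nrm_ej // divr_ge0 // ltW.
have E : x = q.
  apply: iF; [exact: inr|exact: inr|] => i.
  apply: (@zero_der_const _ (F i) q s) => //; first by move=> y /inr; exact: hF.
  by move=> y v ys; apply: J0_dif; [exact: inr|exact: JF].
have /eqP : rc (s / 2) *: ej R (ord0 : 'I_n.+2) = 0 by move/eqP: E; rewrite -subr_eq0 /x [q + _]addrC addrK => /eqP.
by rewrite scaler_eq0 (negbTE (ej_neq0 _)) orbF rc_eq0 gt_eqF // divr_gt0.
Qed.

(* The zero set of J contains no smooth hypersurface on which a function vanishing on it
   has nonzero derivative: by Hurwitz's theorem J would vanish on the whole hypersurface,
   so F would be constant there. *)
Lemma no_hypersurface q s h : 0 < s -> nrm (q - p) + s <= r -> hol h q s -> J q = 0 ->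
  (forall x, nrm (x - q) < s -> J x = 0 -> h x = 0) -> forall v, dif h q v = 0.
Proof.
move=> s0 qs hh Jq Jh v; apply: contrapT => dv.
have inr x : nrm (x - q) < s -> nrm (x - p) < r.
  by move=> xs; apply: le_lt_trans (nrm_tri x q p) _; lra.
have [j dj] : exists j, dif h q (ej R j) != 0.
  apply: contrapT => H; apply: dv; rewrite (lin_rV (difP h q)).
  apply: big1 => j _; have [->|jn] := eqVneq (dif h q (ej R j)) 0; first by rewrite mulr0.
  by case: H; exists j.
have qq : nrm (q - q) < s by rewrite subrr nrm0.
have [d d0 [s1 /andP[s10 s1s] [sg [sgq uniq] sP]]] := implicit s0 hh (Jh q qq Jq) dj.
have hJ : hol J q s by move=> x /inr; exact: J_hol.
have [B B0 HB] := dif_bound (hJ q qq).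
have [c c0 lip] := strict_diff s0 hJ (ltr01 : 0 < 1).
have lip' y z : nrm (y - q) < c -> nrm (z - q) < c -> nrm (J y - J z) <= (B + 1) * nrm (y - z).
  move=> yc zc; rewrite -[J y - J z](subrK (dif J q (y - z))).
  apply: le_trans (nrmD _ _) _; rewrite mulrDl addrC; apply: lerD; [exact: HB|].
  exact: lip.
pose m0 := Num.min (Num.min s1 c) d.
have [m00 [m0s1 [m0c m0d]]] : 0 < m0 /\ m0 <= s1 /\ m0 <= c /\ m0 <= d.
  by split; [rewrite !lt_min s10 c0 d0|rewrite /m0 !ge_min !lexx ?orbT].
pose a := m0 / 4; have a0 : 0 < a by rewrite divr_gt0.
pose f x' (t : C) := J (ins j (q 0 j + t) x').
have near x' t : nrm (x' - del j q) <= a -> nrm t <= a -> nrm (ins j (q 0 j + t) x' - q) < 3 * a.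
  move=> xa ta; rewrite -[q in _ - q](ins_del j q) insB [q 0 j + _]addrC addrK.
  by apply: le_lt_trans (nrm_ins _ _ _) _; lra.
have a4 : 4 * a = m0 by rewrite /a mulrC divfK.
clearbody a; clearbody m0.
have a3 : 3 * a < m0 by rewrite -a4 ltr_pM2r // ltr_nat.
have am : a < m0 by rewrite -[X in X < _]mul1r -a4 ltr_pM2r // ltr1n.
have a3s1 := lt_le_trans a3 m0s1; have a3s := lt_le_trans a3s1 s1s.
have a3c := lt_le_trans a3 m0c; have ad := lt_le_trans am m0d.
have inA (t : C) : sqr (sa 0 a) a t -> nrm t <= a by move=> /sa_ball; rewrite subr0.
have fE x' : ins j (q 0 j + 0) x' = ins j (q 0 j) x' by rewrite addr0.
have hf x' : nrm (x' - del j q) <= a -> hol_near (sqr (sa 0 a) a) (f x').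
  move=> xa w /inA wa; exists a => // t tw.
  have E u : ins j (q 0 j + u) x' = ins j (q 0 j) x' + u *: ej R j.
    by have := ins_shift j (ins j (q 0 j) x') u; rewrite ins_j del_ins.
  have tJ : differentiable J (ins j (q 0 j) x' + t *: ej R j).
    rewrite -E; apply: hJ; apply: lt_le_trans (_ : 4 * a <= s); last by rewrite a4; exact: le_trans s1s.
    rewrite -[q in _ - q](ins_del j q) insB [q 0 j + _]addrC addrK.
    apply: le_lt_trans (nrm_ins _ _ _) _.
    have : nrm t < 2 * a by have := nrmD (t - w) w; rewrite subrK; lra.
    lra.
  exists (dif J (ins j (q 0 j) x' + t *: ej R j) (ej R j)).
  by have := line_cder tJ; rewrite /f; under [X in _ -> cder X _ _]funext => u do rewrite E.
have da : nrm (del j q - del j q) <= a by rewrite subrr nrm0 ltW.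
have [m m1 Hm] : exists2 m, 0 < m & forall w, bd (sa 0 a) a w -> m <= nrm (f (del j q) w).
  apply: bd_min; first exact: ltW.
    move=> w [/(hf _ da)[b b0 fb] _]; have [|k /cder_continuous //] := fb w.
    by rewrite subrr nrm0.
  move=> w wb; apply/eqP => f0; have wa := inA _ wb.1.
  have xq := near _ _ da wa.
  have h0 : h (ins j (q 0 j + w) (del j q)) = 0.
    by apply: Jh => //; exact: lt_trans a3s.
  have := uniq (ins j (q 0 j + w) (del j q)); rewrite del_ins sgq => /(_ _ h0 _).
  have x1 := lt_trans xq a3s1; have x2 := le_lt_trans da ad.
  move=> /(_ x1 x2) /(congr1 (fun x : 'rV[C]_n.+2 => x 0 j)); rewrite ins_j.
  rewrite -[RHS]addr0 => /addrI w0.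
  by have := sa_bd wb; rewrite subr0 w0 nrm0 leNgt divr_gt0.
pose e := Num.min a (m / (16 * (B + 1))).
have B1 : 0 < B + 1 by rewrite addr_gt0.
have e0 : 0 < e by rewrite lt_min a0 divr_gt0 // mulr_gt0.
have ea : e <= a by rewrite ge_min lexx.
have em : (B + 1) * e <= m / 16.
  have : e <= m / (16 * (B + 1)) by rewrite ge_min lexx orbT.
  rewrite ler_pdivlMr ?mulr_gt0 // => h1; rewrite ler_pdivlMr //.
  by apply: le_trans h1; rewrite le_eqVlt; apply/orP; left; apply/eqP; ring.
clearbody e.
have close x' t : nrm (x' - del j q) < e -> nrm t <= a -> nrm (f x' t - f (del j q) t) <= m / 16.
  move=> xe ta; apply: le_trans em.
  have xa := le_trans (ltW xe) ea.
  have c1 := lt_trans (near _ _ xa ta) a3c; have c2 := lt_trans (near _ _ da ta) a3c.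
  apply: le_trans (lip' _ _ c1 c2) _; rewrite ler_wpM2l ?(ltW B1) // insB subrr.
  by apply: le_trans (nrm_ins _ _ _) _; rewrite nrm0 add0r ltW.
have ed := le_lt_trans ea ad.
have Js x' : nrm (x' - del j q) < e -> J (sg x') = 0.
  move=> xe; have xa := le_trans (ltW xe) ea.
  have m2 : 0 < m / 2 by rewrite divr_gt0.
  have [||t ta ft] := hurwitz a0 m2 (hf x' xa).
  - move=> w wb; exact: half_bound (Hm w wb) (close x' w xe (inA _ wb.1)).
  - have aa : nrm (0 : C) <= a by rewrite nrm0 ltW.
    have := close x' 0 xe aa.
    have -> : f (del j q) 0 = 0 by rewrite /f addr0 ins_del.
    rewrite subr0 -(ler_pM2l (ltr0n R 4)) => h4; apply: le_lt_trans h4 _.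
    by rewrite mulrCA ltr_pM2l // ltr_pdivrMr // mulrC ltr_pdivlMr // -!natrM ltr_nat.
  rewrite subr0 in ta; have n1 := near _ _ xa ta.
  have h0 : h (ins j (q 0 j + t) x') = 0 by apply: Jh => //; exact: lt_trans a3s.
  have := uniq (ins j (q 0 j + t) x'); rewrite del_ins => /(_ _ h0 _).
  by move=> /(_ (lt_trans n1 a3s1) (lt_trans xe ed)) <-.
have sv z : vec (fun k z => sg z 0 k) z = sg z by apply/rowP => k; rewrite mxE.
have sgr x' : nrm (x' - del j q) < e -> nrm (sg x' - p) < r.
  by move=> xe; have [h1 _ _ _] := sP _ (lt_trans xe ed); apply: inr; exact: lt_le_trans s1s.
have ch i y : nrm (y - del j q) < e -> differentiable (fun z => F i (sg z)) y /\
    forall w, dif (fun z => F i (sg z)) y w = 0.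
  move=> ye; have [_ _ _ ds] := sP y (lt_trans ye ed).
  have dFk : differentiable (F i) (vec (fun k z => sg z 0 k) y) by rewrite sv; apply/hF/sgr.
  have := chain ds dFk; rewrite sv.
  rewrite (_ : (fun z => F i (vec _ z)) = fun z => F i (sg z)); last by rewrite funeqE => z; rewrite sv.
  move=> [h1 h2]; split=> // w; rewrite h2; apply: J0_dif; [exact: sgr|exact: Js].
pose y := del j q + rc (e / 2) *: ej R ord0.
have ye : nrm (y - del j q) < e.
  rewrite /y [del j q + _]addrC addrK nrmZ nrm_rc gtr0_norm ?divr_gt0 //.
  apply: le_lt_trans (_ : e / 2 * 1 < e); last by rewrite mulr1 gtr_pMr // invf_lt1 // ltr1n.
  by rewrite ler_wpM2l ?nrm_ej // divr_ge0 // ltW.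
have qe : nrm (del j q - del j q) < e by rewrite subrr nrm0.
have E : sg y = sg (del j q).
  apply: iF; [exact: sgr|exact: sgr|] => i.
  apply: (@zero_der_const _ (fun z => F i (sg z)) (del j q) e) => //; first by move=> z /(ch i)[].
  by move=> z w /(ch i)[].
have [_ _ yy _] := sP _ (lt_trans ye ed); have [_ _ qq' _] := sP _ (lt_trans qe ed).
have Eq : y = del j q by rewrite -yy E qq'.
have /eqP : rc (e / 2) *: ej R (ord0 : 'I_n.+1) = 0 by move/eqP: Eq; rewrite -subr_eq0 /y [del j q + _]addrC addrK => /eqP.
by rewrite scaler_eq0 (negbTE (ej_neq0 _)) orbF rc_eq0 gt_eqF // divr_gt0.
Qed.

Definition vanishing h := hol h p r /\ forall x, nrm (x - p) < r -> J x = 0 -> h x = 0.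

Lemma vanishing_dif h v : vanishing h -> vanishing (fun x => dif h x v).
Proof.
move=> [hh h0]; split=> x xr.
  have hx : hol h x (r - nrm (x - p)) by apply: hol_sub hh _; lra.
  by apply: (diff_diff _ _ hx); rewrite subr_gt0.
move=> Jx; apply: (@no_hypersurface x (r - nrm (x - p)) h) => //; first by rewrite subr_gt0.
- lra.
- by apply: hol_sub hh _; lra.
move=> y yr; apply: h0; apply: le_lt_trans (nrm_tri y x p) _; lra.
Qed.

Lemma flat e k h : nrm e <= 1 -> vanishing h -> exists B, exists2 q, 0 < q &
  forall t : C, nrm t < q -> nrm (h (p + t *: e)) <= B * nrm t ^+ k.
Proof.
move=> e1; elim: k h => [|k IH] h vh.
  have pp : nrm (p - p) < r by rewrite subrr nrm0.
  have [q q0 [M HM]] := diff_bounded (vh.1 p pp).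
  exists M, q => // t tq; rewrite expr0 mulr1; apply: HM.
  rewrite [p + _]addrC addrK nrmZ; apply: le_lt_trans tq.
  by rewrite ler_piMr ?nrm_ge0.
have [B [q q0 HB]] := IH _ (vanishing_dif e vh).
exists B, (Num.min q r); first by rewrite lt_min q0.
move=> t; rewrite lt_min => /andP[tq tr].
have hp : h p = 0 by apply: vh.2; rewrite ?Jp // subrr nrm0.
rewrite -[h _]subr0 -hp; apply: mv_seg => u /andP[u0 u1].
have ut : nrm (rc u * t) <= nrm t by rewrite nrmM nrm_rc ger0_norm // ler_piMl ?nrm_ge0.
rewrite scalerA; split.
  apply: vh.1; rewrite [p + _]addrC addrK nrmZ; apply: le_lt_trans tr; apply: le_trans ut.
  by rewrite ler_piMr ?nrm_ge0.
rewrite difZ nrmM exprS [B * _]mulrCA ler_wpM2l ?nrm_ge0 //.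
have B0 : 0 <= B.
  have q2 : 0 < q / 2 by rewrite divr_gt0.
  have : nrm (rc (q / 2)) < q by rewrite nrm_rc gtr0_norm //; lra.
  move=> /HB/(le_trans (nrm_ge0 _)); rewrite nrm_rc gtr0_norm // pmulr_lge0 //.
  exact: exprn_gt0.
apply: le_trans (HB _ (le_lt_trans ut tq)) _; rewrite ler_wpM2l //.
by rewrite lerXn2r ?nnegrE ?nrm_ge0.
Qed.

Lemma step_contra : False.
Proof.
have pp : nrm (p - p) < r by rewrite subrr nrm0.
have [q q0 [M HM]] := diff_bounded (J_hol pp).
pose s := Num.min q r; have s0 : 0 < s by rewrite lt_min q0.
have sq : s <= q by rewrite ge_min lexx.
have sr : s <= r by rewrite ge_min lexx orbT.
apply: (@const_contra p (s / 8)); first by rewrite divr_gt0.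
  by rewrite subrr nrm0; lra.
move=> x xs; have [->|xp] := eqVneq x p; first exact: Jp.
have t0 : 0 < nrm (x - p) by rewrite nrm_gt0 subr_eq0.
pose e := (rc (nrm (x - p)))^-1 *: (x - p).
have e1 : nrm e <= 1 by rewrite nrmZ nrmV nrm_rc gtr0_norm // mulVf ?gt_eqF.
have xe : x = p + rc (nrm (x - p)) *: e.
  by rewrite scalerA mulfV ?rc_eq0 ?gt_eqF // scale1r addrC subrK.
have ins t : nrm (t - 0) < s -> nrm (p + t *: e - p) < s.
  rewrite subr0 [p + _]addrC addrK nrmZ => ts; apply: le_lt_trans ts.
  by rewrite ler_piMr ?nrm_ge0.
rewrite xe; apply: (@flat_zero R (fun t => J (p + t *: e)) 0 s M s0).
- move=> t /ins ts; exists (dif J (p + t *: e) e); apply: line_cder; apply: J_hol; exact: lt_le_trans sr.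
- by move=> t /ins ts; apply: HM; exact: lt_le_trans sq.
- move=> k; have [|B [b b0 HB]] := @flat e k J e1; first by split=> //; exact: J_hol.
  by exists B, b => // z; rewrite subr0; exact: HB.
by rewrite subr0 nrm_rc gtr0_norm //; lra.
Qed.
End Step.

Theorem osgood_all n : osgood n.
Proof.
elim: n => [|n IH] F p r r0 hF iF; first by move=> v _; apply/rowP => -[].
have slice q i v : nrm (q - p) < r -> dif (F i) q v != 0 -> inj_der F q.
  by move=> qr; exact: osgood_slice.
case: n IH F p hF iF slice => [|n] IH F p hF iF slice; last first.
  by apply: contrapT => nF; exact: step_contra slice nF.
have pt t : nrm (t - 0) < r -> nrm (p + t *: ej R ord0 - p) < r.
  rewrite subr0 [p + _]addrC addrK nrmZ => tr; apply: le_lt_trans tr.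
  by rewrite ler_piMr ?nrm_ge0 ?nrm_ej.
have pp : nrm (p - p) < r by rewrite subrr nrm0.
apply: (slice p ord0 (ej R ord0) pp).
have h1 : hol1 (fun t => F ord0 (p + t *: ej R ord0)) 0 r.
  by move=> t /pt tr; eexists; apply: line_cder; exact: hF.
have := inj_cder_neq0 r0 h1.
have -> : dif (fun t : C => F ord0 (p + t *: ej R ord0)) 0 1 = dif (F ord0) p (ej R ord0).
  have := @line_cder R _ (F ord0) p (ej R ord0) 0; rewrite scale0r addr0.
  by move=> /(_ (hF _ _ pp))/cder_difE.
apply=> x y xr yr E.
have : p + x *: ej R ord0 = p + y *: ej R ord0.
  by apply: iF; [exact: pt|exact: pt|] => i; rewrite (ord1 i).
by move=> /addrI/rowP/(_ ord0); rewrite !mxE !eqxx !mulr1.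
Qed.

End Osgood.

(** * Holomorphic functions on a manifold *)

Section Manifolds.
Variables (R : realType) (N : nat) (M : complexManifold R N).
Notation C := (Cplx R).
Implicit Types (c : chart R N M) (z w : M) (f g : M -> C) (K U : set M).

Lemma compact_img (T T' : topologicalType) (f : T -> T') (K : set T) :
  (forall x, K x -> {for x, continuous f}) -> compact K -> compact (f @` K).
Proof.
by move=> cf; apply: continuous_compact; apply: continuous_in_subspaceT => x /set_mem; exact: cf.
Qed.

Lemma chartK c z : chart_dom c z -> chart_inv c (c z) = z.
Proof. by move=> zc; apply: (chart_mapK (c := c)); exact/mem_set. Qed.

Lemma chart_ball c z (U : set M) : chart_dom c z -> nbhs z U -> exists2 r : R, 0 < r &
  forall x, nrm (x - c z) < r -> [/\ chart_dom c (chart_inv c x), c (chart_inv c x) = x & U (chart_inv c x)].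
Proof.
move=> zc nU.
have n1 : nbhs (c z) (chart_map c @` chart_dom c).
  by apply: open_nbhs_nbhs; split; [exact: chart_cod_open|exists z].
have n2 : nbhs (c z) (chart_inv c @^-1` U).
  by apply: (chart_inv_continuous zc); rewrite chartK.
have [r r0 H] := (@nbhs_nrm R ('rV[C]_N) (c z) (chart_map c @` chart_dom c `&` chart_inv c @^-1` U)).1 (filterI n1 n2).
by exists r => // x /H[[w wc <-] h2]; rewrite chartK //; split=> //; move: h2; rewrite /= chartK.
Qed.

Lemma chart_nbhs c z (r : R) : chart_dom c z -> 0 < r ->
  nbhs z [set w | chart_dom c w /\ nrm (c w - c z) < r].
Proof.
move=> zc r0; apply: filterI; first by apply: open_nbhs_nbhs; split; [exact: chart_dom_open|].
have /(chart_map_continuous zc) : nbhs (c z) [set x | nrm (x - c z) < r] by apply/nbhs_nrm; exists r.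
by [].
Qed.

Lemma chart_compact c z (r r' : R) : 0 <= r' -> r' < r ->
  (forall x, nrm (x - c z) < r -> chart_dom c (chart_inv c x) /\ c (chart_inv c x) = x) ->
  compact (chart_inv c @` [set x | nrm (x - c z) <= r']).
Proof.
move=> r0 rr H; apply: compact_img; last exact: ball_compact.
move=> x /= xr; have [h1 h2] := H x (le_lt_trans xr rr).
by rewrite -h2; exact: chart_inv_continuous.
Qed.

Lemma holo_cont U f : open U -> holomorphic_on U f -> forall z, U z -> {for z, continuous f}.
Proof.
move=> oU hf z Uz; have [c cA zc] := atlas_cover z.
have := differentiable_continuous (hf c cA z Uz zc) => ct A; rewrite -{1}(chartK zc) => nA.
have n1 : nbhs z (chart_map c @^-1` ((f \o chart_inv c) @^-1` A)) by apply/(chart_map_continuous zc)/(ct A nA).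
have n2 : nbhs z (chart_dom c) by apply: open_nbhs_nbhs; split; [exact: chart_dom_open|].
have n3 := @filterI _ _ (nbhs_filter z) _ _ n1 n2.
suff : nbhs z (f @^-1` A) by [].
by apply: (@filterS _ _ (nbhs_filter z) _ _ _ n3) => w [] /= h wc; move: h; rewrite chartK.
Qed.

Lemma holo_continuous f : holomorphic f -> continuous f.
Proof. by move=> hf z; apply: (holo_cont openT hf). Qed.

Lemma holo_bound f K : holomorphic f -> compact K -> exists2 B : R, 0 < B & forall z, K z -> nrm (f z) <= B.
Proof. by move=> hf cK; apply: compact_cont_bound cK _ => x _; exact: holo_continuous. Qed.

Lemma holo_cst (a : C) : holomorphic (fun _ : M => a).
Proof. by move=> c cA z _ zc; exact: differentiable_cst. Qed.

Lemma holoD f g : holomorphic f -> holomorphic g -> holomorphic (fun z => f z + g z).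
Proof.
move=> hf hg c cA z zU zc; have h := differentiableD (hf c cA z zU zc) (hg c cA z zU zc).
exact: h.
Qed.

Lemma holoB f g : holomorphic f -> holomorphic g -> holomorphic (fun z => f z - g z).
Proof.
move=> hf hg c cA z zU zc; exact: (diff_sub (hf c cA z zU zc) (hg c cA z zU zc)).1.
Qed.

Lemma holoM f g : holomorphic f -> holomorphic g -> holomorphic (fun z => f z * g z).
Proof.
move=> hf hg c cA z zU zc; have h := differentiableM (hf c cA z zU zc) (hg c cA z zU zc).
exact: h.
Qed.

Lemma holo_entire f (v : C -> C) : holomorphic f -> entire1 v -> holomorphic (fun z => v (f z)).
Proof.
move=> hf ev c cA z zU zc; have [d /cder_differentiable[h _]] := ev (f (chart_inv c (c z))).
have h' := differentiable_comp (hf c cA z zU zc) h; exact: h'.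
Qed.

Lemma holo_limit f : (forall K, compact K -> forall e : R, 0 < e ->
    exists2 g, holomorphic g & forall z, K z -> nrm (g z - f z) <= e) -> holomorphic f.
Proof.
move=> H c cA z _ zc.
have [r r0 Hr] := chart_ball zc (filterT : nbhs z setT).
have r2 : 0 < r / 2 by rewrite divr_gt0.
apply: (weier r2) => e e0.
have cK : compact (chart_inv c @` [set x | nrm (x - c z) <= r / 2]).
  apply: (@chart_compact c z r); [exact: ltW|lra|].
  by move=> x /Hr[].
have [g hg gf] := H _ cK e e0; exists (g \o chart_inv c).
  move=> y yr; have [|h1 h2 _] := Hr y; first by lra.
  by rewrite -[X in differentiable _ X]h2; exact: hg.
by move=> y yr; apply: gf; exists y => //; exact: ltW.
Qed.

Section Topology.
Let T := holo M.
Implicit Types (F G : T).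

Lemma holoP F : holomorphic (set_val F : M -> C).
Proof. exact: set_mem (valP F). Qed.

Definition mk f (hf : holomorphic f) : T := SigSub (mem_set hf : (f : {family compact, M -> C}) \in [set f : {family compact, M -> C} | holomorphic (f : M -> C)]).

Lemma holo_nbhs F K (e : R) : compact K -> 0 < e ->
  nbhs F [set G : T | forall z, K z -> nrm (set_val G z - set_val F z) < e].
Proof.
move=> cK e0.
pose E := [set p : C * C | `|p.1 - p.2| < rc e].
have entE : entourage E.
  rewrite -entourage_ballE; exists (rc e); first by rewrite /= rc_gt0.
  by move=> p; rewrite /= -ball_normE.
have := @fam_nbhs _ _ compact K E (set_val F : {family compact, M -> C}) entE cK.
move=> /(@initial_continuous _ _ (set_val : T -> {family compact, M -> C}) F) n1.
by apply: (@filterS _ _ (nbhs_filter F) _ _ _ n1) => G /= H z /H; rewrite /E /= normE rc_lt nrmC.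
Qed.

Lemma holo_nbhsP F (O : set T) : nbhs F O -> exists2 K, compact K & exists2 e : R, 0 < e &
  forall G, (forall z, K z -> nrm (set_val G z - set_val F z) < e) -> O G.
Proof.
move=> [_ [[B oB <-] BF sB]].
pose Fl : set_system (M -> C) := fun A => exists2 K, compact K & exists2 e : R, 0 < e &
  forall g : M -> C, (forall z, K z -> nrm (g z - set_val F z) < e) -> A g.
have fFl : Filter Fl.
  split.
  - by exists set0; [exact: compact0|exists 1].
  - move=> P Q [K cK [e e0 H]] [K' cK' [e' e'0 H']].
    exists (K `|` K'); first exact: compactU.
    exists (Num.min e e'); first by rewrite lt_min e0.
    move=> g h; split; [apply: H|apply: H'] => z zK.
      by have := h z (or_introl zK); rewrite lt_min => /andP[].
    by have := h z (or_intror zK); rewrite lt_min => /andP[].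
  - by move=> P Q PQ [K cK [e e0 H]]; exists K => //; exists e => // g /H/PQ.
have cv : Fl --> (set_val F : {family compact, M -> C}).
  apply/(@fam_cvgP _ _ _ _ _ fFl) => K cK P /uniform_nbhs[E [entE EP]].
  have : entourage E by []; rewrite -entourage_ballE => -[e e0 He].
  have [ee e0'] := pos_rc e0.
  exists K => //; exists (re e) => // g gF; apply: EP => y Ky; apply: He.
  rewrite /= -ball_normE /= ee; rewrite normE rc_lt nrmC; exact: gF.
have /cv[K cK [e e0 H]] : nbhs (set_val F : {family compact, M -> C}) B.
  by apply: open_nbhs_nbhs.
by exists K => //; exists e => // G /H/sB.
Qed.

Lemma dense_holo (S : set T) : dense S <-> forall f, holomorphic f -> forall K, compact K ->
  forall e : R, 0 < e -> exists2 G, S G & forall z, K z -> nrm (set_val G z - f z) < e.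
Proof.
split=> [dS f hf K cK e e0|H O [F OF] oO].
  have /nbhs_interior nb := @holo_nbhs (mk hf) K e cK e0.
  have ne : [set G : T | forall z, K z -> nrm (set_val G z - f z) < e]° !=set0.
    by exists (mk hf); apply: nbhs_singleton nb.
  have [G [GO SG]] := dS _ ne (open_interior _).
  by exists G => //; exact: (interior_subset GO).
have [K cK [e e0 OK]] := @holo_nbhsP F O (open_nbhs_nbhs (conj oO OF)).
have [G SG GF] := H _ (holoP F) K cK e e0.
by exists G; split=> //; exact: OK.
Qed.

End Topology.
End Manifolds.

(** * Inverse maps and necessity of the conditions *)

Section InverseMaps.
Variables (R : realType) (N : nat) (M : complexManifold R N) (phi : M -> M).
Notation C := (Cplx R).
Hypothesis hphi : holomorphic_map phi.
Implicit Types (c d : chart R N M) (z w : M) (f g : M -> C) (K U : set M).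

Lemma holo_on_comp U f : open U -> (forall z, U (phi z)) -> holomorphic_on U f -> holomorphic (f \o phi).
Proof.
move=> oU Uphi hf c cA z _ zc; have [d dA dz] := atlas_cover (phi z).
have h1 := hphi.2 c d cA dA z zc dz.
have h2 : differentiable (f \o chart_inv d) ((d \o phi \o chart_inv c) (c z)).
  by have := hf d dA _ (Uphi z) dz; rewrite /= chartK.
have h3 := differentiable_comp h1 h2.
have n1 : nbhs z (phi @^-1` chart_dom d).
  by apply: hphi.1; apply: open_nbhs_nbhs; split; [exact: chart_dom_open|].
have [r r0 Hr] := chart_ball zc n1.
by apply: (dif_near r0 _ h3).1 => x /Hr[_ _ h]; rewrite /= chartK.
Qed.

Lemma holo_iter f k : holomorphic f -> holomorphic (f \o iter k phi).
Proof.
move=> hf; elim: k => [//|k IH].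
have -> : f \o iter k.+1 phi = (f \o iter k phi) \o phi by rewrite funeqE => z; exact: (congr1 f (iterSr k phi z)).
exact: holomorphic_comp.
Qed.

Lemma cont_iter k : continuous (iter k phi).
Proof.
elim: k => [|k IH] z; first exact: cvg_id.
exact: (continuous_comp (IH z) (hphi.1 _)).
Qed.

Lemma compact_iter k K : compact K -> compact (iter k phi @` K).
Proof. by move=> cK; apply: compact_img cK => z _; exact: cont_iter. Qed.

Hypothesis inj : injective phi.

Lemma local_inverse d z : atlas d -> chart_dom d (phi z) -> exists c, [/\ atlas c, chart_dom c z &
  exists2 psi : 'rV[C]_N -> 'rV[C]_N, psi (d (phi z)) = c z /\ differentiable psi (d (phi z)) &
  exists2 r : R, 0 < r & forall y, nrm (y - d (phi z)) < r ->
    [/\ chart_dom d (chart_inv d y), d (chart_inv d y) = y &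
      phi (chart_inv c (psi y)) = chart_inv d y]].
Proof.
move=> dA dz; have [c cA cz] := atlas_cover z; exists c; split=> //.
have n1 : nbhs z (phi @^-1` chart_dom d).
  by apply: hphi.1; apply: open_nbhs_nbhs; split; [exact: chart_dom_open|].
have [r r0 Hr] := chart_ball cz n1.
pose G i (x : 'rV[C]_N) : C := d (phi (chart_inv c x)) 0 i.
have vG x : vec G x = d (phi (chart_inv c x)) by apply/rowP => i; rewrite mxE.
have hG i : hol (G i) (c z) r.
  move=> x /Hr[h1 h2 h3]; have hd := hphi.2 c d cA dA _ h1 h3; rewrite h2 in hd.
  have h4 := differentiable_comp hd (coord_dif i _).1; exact: h4.
have iG : inj_ball G (c z) r.
  move=> x y /Hr[x1 x2 x3] /Hr[y1 y2 y3] E.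
  rewrite -x2 -y2; congr (chart_map c _); apply: inj.
  by rewrite -(chartK x3) -(chartK y3) -!vG; congr chart_inv; apply/rowP => i; rewrite !mxE.
have dG x : nrm (x - c z) < r -> inj_der G x.
  move=> xr; apply: (@osgood_all R N G x (r - nrm (x - c z))); first by rewrite subr_gt0.
    by move=> i; apply: hol_sub (hG i) _; lra.
  move=> u v ur vr; apply: iG; apply: le_lt_trans (nrm_tri _ x _) _; lra.
have [r1 r10 [psi [psi0 psiP]]] := inverse_function r0 hG iG dG.
have E0 : vec G (c z) = d (phi z) by rewrite vG chartK.
rewrite E0 in psi0 psiP.
exists psi.
  split=> //.
  have dd : nrm (d (phi z) - d (phi z)) < r1 by rewrite subrr nrm0.
  have [_ _ dpsi] := psiP _ dd.
  have vpsi : vec (fun j y => psi y 0 j) = psi.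
    by rewrite funeqE => y; apply/rowP => j; rewrite mxE.
  have hd := vec_hasder dpsi; rewrite vpsi in hd.
  have [B B0 HB] := mxbound (D (fun j y => psi y 0 j) (d (phi z))).
  have [] := @hasder_linear R _ _ psi (d (phi z)) _ B _ HB hd; last by [].
  by move=> a u v; rewrite mulmxDl -scalemxAl.
have [r2 r20 H2] := chart_ball dz (filterT : nbhs (phi z) setT).
exists (Num.min r1 r2); first by rewrite lt_min r10.
move=> y; rewrite lt_min => /andP[/psiP[p1 p2 _] /H2[q1 q2 _]]; split=> //.
have [_ _ p3] := Hr _ p1.
by rewrite -(chartK p3) -vG p2.
Qed.

Lemma range_open : open (range phi).
Proof.
rewrite openE => w [z _ <-]; have [d dA dz] := atlas_cover (phi z).
have [c [cA cz [psi _ [r r0 Hr]]]] := local_inverse dA dz.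
apply: filterS (chart_nbhs dz r0) => w' [w'd /Hr[_ _ E]].
by exists (chart_inv c (psi (d w'))) => //; rewrite E chartK.
Qed.

Lemma inverse_map : exists2 psi : M -> M, (forall z, psi (phi z) = z) &
  (forall z, {for phi z, continuous psi}) /\
  forall f, holomorphic f -> holomorphic_on (range phi) (f \o psi).
Proof.
have ex w : exists z, range phi w -> phi z = w.
  by have [[z _ <-]|h] := pselect (range phi w); [exists z|exists w].
have [psi Hpsi] := choice ex.
have psiK z : psi (phi z) = z by apply: inj; apply: Hpsi; exists z.
have loc c d z (ps : 'rV[C]_N -> 'rV[C]_N) y :
  phi (chart_inv c (ps y)) = chart_inv d y -> psi (chart_inv d y) = chart_inv c (ps y).
  by move=> <-.
exists psi => //; split.
  move=> z; have [d dA dz] := atlas_cover (phi z).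
  have [c [cA cz [ps [ps0 dps] [r r0 Hr]]]] := local_inverse dA dz.
  move=> A; rewrite psiK => nA.
  have n1 : nbhs (c z) (chart_inv c @^-1` A) by apply: (chart_inv_continuous cz); rewrite chartK.
  have n2 : nbhs (d (phi z)) (ps @^-1` (chart_inv c @^-1` A)).
    by apply: (differentiable_continuous dps); rewrite ps0.
  have n3 := chart_map_continuous dz n2.
  suff : nbhs (phi z) (psi @^-1` A) by [].
  apply: (@filterS _ _ (nbhs_filter (phi z)) _ _ _
    (@filterI _ _ (nbhs_filter (phi z)) _ _ n3 (chart_nbhs dz r0))) => w [/= wA [wd /Hr[_ _ E]]].
  by have := loc c d z ps (d w) E; rewrite chartK // => ->.
move=> f hf d dA w [z _ <-] dz.
have [c [cA cz [ps [ps0 dps] [r r0 Hr]]]] := local_inverse dA dz.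
have h1 : differentiable (f \o chart_inv c) (ps (d (phi z))) by rewrite ps0; exact: hf.
apply: (dif_near r0 _ (differentiable_comp dps h1)).1 => y /Hr[_ _ E].
by rewrite /= (loc c d z ps y E).
Qed.

Definition dense_range (T : M -> M) := forall f, holomorphic f -> forall K, compact K ->
  forall e : R, 0 < e -> exists2 g, holomorphic g & forall z, K z -> nrm (g (T z) - f z) < e.

Lemma runge_dense : runge_domain (range phi) -> dense_range phi.
Proof.
move=> [_ Rg] f hf K cK e e0; have [psi psiK [_ psih]] := inverse_map.
have cK' : compact (phi @` K) by apply: compact_img cK => z _; exact: hphi.1.
have sK : phi @` K `<=` range phi by move=> _ [z _ <-]; exists z.
have [g hg gf] := Rg _ (psih f hf) _ cK' sK e e0.
exists g => // z Kz; have := gf (phi z); rewrite -nrm_cnorm /= psiK nrmC; apply.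
by exists z.
Qed.

Lemma dense_runge : connected [set: M] -> dense_range phi -> runge_domain (range phi).
Proof.
move=> cM dr; split.
  split; first exact: range_open.
  apply: connected_continuous_connected => //.
  by apply: continuous_subspaceT; exact: hphi.1.
move=> f hf K cK sK e e0; have [psi psiK [cpsi _]] := inverse_map.
have cK' : compact (psi @` K) by apply: compact_img cK => w /sK[z _ <-]; exact: cpsi.
have ran z : range phi (phi z) by exists z.
have [g hg gf] := dr _ (holo_on_comp range_open ran hf) _ cK' e e0.
exists g => // w Kw; have [z _ wz] := sK w Kw.
rewrite -nrm_cnorm nrmC -wz; apply: gf; exists w => //; by rewrite -wz psiK.
Qed.

End InverseMaps.

Section Necessity.
Variables (R : realType) (N : nat) (M : complexManifold R N) (phi : M -> M).
Notation C := (Cplx R).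
Hypothesis hphi : holomorphic_map phi.
Implicit Types (z w : M) (f g : M -> C) (K U : set M) (n : nat -> nat).

Lemma iter_composition m (F : holo M) :
  set_val (iter m (composition_operator hphi) F) = (set_val F : M -> C) \o iter m phi :> (M -> C).
Proof.
elim: m => [//|m IH]; rewrite iterS composition_operatorE IH.
by rewrite funeqE => z; exact: (congr1 (set_val F : M -> C) (esym (iterSr m phi z))).
Qed.

Lemma universalP n : universal (fun l => iter (n l) (composition_operator hphi)) <->
  exists2 F : M -> C, holomorphic F & forall f, holomorphic f -> forall K, compact K ->
    forall e : R, 0 < e -> exists l, forall z, K z -> nrm (F (iter (n l) phi z) - f z) < e.
Proof.
split=> [[F /dense_holo dF]|[F hF HF]].
  exists (set_val F : M -> C); first exact: holoP.
  move=> f hf K cK e e0; have [_ [l _ <-] H] := dF f hf K cK e e0.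
  by exists l => z /H; rewrite iter_composition.
exists (mk hF); apply/dense_holo => f hf K cK e e0; have [l H] := HF f hf K cK e e0.
by exists (iter (n l) (composition_operator hphi) (mk hF)); [exists l|move=> z /H; rewrite iter_composition].
Qed.

Lemma entireP (f : C -> C) : entire f <-> entire1 f.
Proof.
split=> ef z; first exact/differentiable_ex_cder.
by have [d /cder_differentiable[]] := ef z.
Qed.

Lemma polynomial_hullP (X : set C) a : polynomial_hull X a <-> hullE X a.
Proof.
split=> H f /entireP ef.
  move=> B fB; rewrite -lee_fin nrm_cnorm; apply: le_trans (H f ef) _.
  apply: ge_ereal_sup => _ [w Xw <-]; rewrite lee_fin -nrm_cnorm; exact: fB.
have ub (w : C) : X w -> ((cnorm (f w))%:E <= ereal_sup [set (cnorm (f w))%:E | w in X])%E.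
  by move=> Xw; apply: ereal_sup_ubound; exists w.
case E: (ereal_sup _) => [r| |]; [|by rewrite leey|].
  rewrite lee_fin -nrm_cnorm; apply: H => //.
  by move=> x /ub; rewrite E lee_fin -nrm_cnorm.
exfalso; have := H (fun=> 1) (entire1_cst 1) (-1); rewrite nrm1 => h.
have : (1 : R) <= -1 by apply: h => x /ub; rewrite E.
lra.
Qed.

Section OneSequence.
Variables (n : nat -> nat) (F : M -> C).
Hypotheses (hn : increasing n) (hF : holomorphic F)
  (HF : forall f, holomorphic f -> forall K, compact K ->
    forall e : R, 0 < e -> exists l, forall z, K z -> nrm (F (iter (n l) phi z) - f z) < e).

(* The iterate with exponent 0 is avoided by perturbing the target by a constant. *)
Lemma universal_pos f K (e : R) : holomorphic f -> compact K -> 0 < e ->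
  exists2 m, (0 < m)%N & forall z, K z -> nrm (F (iter m phi z) - f z) < e.
Proof.
move=> hf cK e0; have e8 : 0 < e / 8 by rewrite divr_gt0.
have [[z0 Kz0]|K0] := pselect (K !=set0); last first.
  exists (n 1%N); first by have := hn (ltnSn 0); case: (n 1%N).
  by move=> z Kz; case: K0; exists z.
have [l0 H0] := HF hf cK e8.
have [n0|n0] := posnP (n l0); last by exists (n l0) => // z /H0; lra.
have hf' := holoD hf (holo_cst (rc (e / 2)) : holomorphic (fun _ : M => _)).
have [l1 H1] := HF hf' cK e8.
have [n1|n1] := posnP (n l1).
  exfalso; have := H0 z0 Kz0; have := H1 z0 Kz0; rewrite n0 n1 /=.
  have := nrm_sub (rc (e / 2)) (F z0 - f z0 : C); rewrite nrm_rc gtr0_norm ?divr_gt0 //.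
  have -> : rc (e / 2) - (F z0 - f z0) = - (F z0 - (f z0 + rc (e / 2))) by ring.
  by rewrite nrmN; lra.
exists (n l1) => // z /H1 h.
have -> : F (iter (n l1) phi z) - f z = (F (iter (n l1) phi z) - (f z + rc (e / 2))) + rc (e / 2) by ring.
apply: le_lt_trans (nrmD _ _) _; rewrite nrm_rc gtr0_norm ?divr_gt0 //; lra.
Qed.

Lemma universal_dense : dense_range phi.
Proof.
move=> f hf K cK e e0; have [[//|m] _ H] := universal_pos hf cK e0.
by exists (F \o iter m phi); [exact: holo_iter|move=> z /H; rewrite iterSr].
Qed.

Lemma universal_inj : stein M -> injective phi.
Proof.
move=> sM z w E; apply: contrapT => zw; have [f hf fzw] := stein_separates sM zw.
have e0 : 0 < nrm (f z - f w) / 2 by rewrite divr_gt0 // nrm_gt0 subr_eq0; apply/eqP.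
have cK : compact [set z; w] by apply: compactU; exact: compact_set1.
have [[//|m] _ H] := universal_pos hf cK e0.
have := H z (or_introl erefl); have := H w (or_intror erefl); rewrite !iterSr E.
set u := F _ => h1 h2; have := nrm_tri (f z) u (f w); rewrite [nrm (f z - u)]nrmC; lra.
Qed.

Lemma universal_separable K : compact K -> exists l, separable K (iter (n l) phi @` K).
Proof.
move=> cK; have [B B0 HB] := holo_bound hF cK.
have [l Hl] := HF (holo_cst (rc (B + 2)) : holomorphic (fun _ : M => _)) cK ltr01.
exists l, F => //; apply/seteqP; split=> // x [/polynomial_hullP h1 /polynomial_hullP h2].
have := h1 id; move=> /(_ _ B _); rewrite /=.
have e1 : entire1 (id : C -> C) by move=> z; exists 1; exact: cder_id.
move=> /(_ e1); have b1 y : (F @` K) y -> nrm y <= B by move=> [z Kz <-]; exact: HB.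
move=> /(_ b1) xB.
have b2 y : (F @` (iter (n l) phi @` K)) y -> nrm (y - rc (B + 2)) <= 1.
  by move=> [_ [z Kz <-] <-]; apply/ltW/Hl.
have := h2 _ (entire1_sub (rc (B + 2))) 1 b2.
have := nrm_sub (rc (B + 2)) x; rewrite nrmC nrm_rc gtr0_norm; last by rewrite addr_gt0.
lra.
Qed.

End OneSequence.

Lemma necessity n : stein M -> connected [set: M] -> increasing n ->
  universal (fun l => iter (n l) (composition_operator hphi)) ->
  [/\ injective phi, runge_domain (range phi) &
      forall K : set M, convex_compact K -> exists l, separable K (iter (n l) phi @` K)].
Proof.
move=> sM cM hn /universalP[F hF HF].
have inj := universal_inj hn HF sM.
split=> //; first exact: dense_runge hphi inj cM (universal_dense hn hF HF).
by move=> K [cK _]; exact: universal_separable hF HF _ cK.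
Qed.

End Necessity.

(** * A dense sequence of holomorphic functions *)

Section Exhaustion.
Variables (R : realType) (N : nat) (M : complexManifold R N) (E : nat -> set M).
Notation C := (Cplx R).
Hypotheses (cE : forall l, compact (E l)) (EE : forall l, E l `<=` (E l.+1)°) (EU : \bigcup_l E l = setT).
Implicit Types (z w : M) (f g : M -> C) (K : set M).

Lemma finite_net (T : topologicalType) (K : set T) (V : T -> T -> Prop) : compact K ->
  (forall x, K x -> nbhs x (V x)) -> exists s : seq T, forall x, K x -> exists2 p, p \in s & V p x.
Proof.
move=> /compact_near_coveringP cK nV.
pose Fl : set_system (seq T) := fun A => exists s0 : seq T, forall s, {subset s0 <= s} -> A s.
have fFl : Filter Fl.
  split; first by exists [::].
    move=> P Q [s0 H0] [s1 H1]; exists (s0 ++ s1) => s hs.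
    by split; [apply: H0|apply: H1] => x xs; apply: hs; rewrite mem_cat xs ?orbT.
  by move=> P Q PQ [s0 H0]; exists s0 => s /H0/PQ.
have [x Kx|s0 H0] := cK (seq T) Fl (fun s x => exists2 p, p \in s & V p x) fFl.
  exists (V x, [set s : seq T | x \in s]) => /=.
    split; first exact: nV.
    by exists [:: x] => s; apply; rewrite inE.
  by move=> [y s] /= [Vy xs]; exists x.
by exists s0; exact: H0.
Qed.

Lemma exhaustion_mono i j : (i <= j)%N -> E i `<=` E j.
Proof.
move=> /subnKC <-; elim: (j - i)%N => [|k IH] z Ez; first by rewrite addn0.
by rewrite addnS; apply: interior_subset; apply: EE; exact: IH.
Qed.

Lemma exhaustion_compact K : compact K -> exists l0, forall l, (l0 <= l)%N -> K `<=` E l.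
Proof.
move=> cK; have ex z : exists l, E l z by have : (\bigcup_l E l) z by [rewrite EU]; case=> l _; exists l.
have [ix Hix] := choice ex.
have nV z : K z -> nbhs z (E (ix z).+1).
  by move=> _; apply: EE; exact: Hix.
have [s Hs] := finite_net (V := fun z => E (ix z).+1) cK nV.
exists (\max_(p <- s) (ix p).+1)%N => l hl z /Hs[p ps]; apply: exhaustion_mono.
by apply: leq_trans hl; exact: (@leq_bigmax_seq _ s xpredT (fun p => (ix p).+1) p).
Qed.

Definition bounded_on l (m : R) f := holomorphic f /\ forall z, E l.+1 z -> nrm (f z) <= m.

Lemma equicontinuous l m (e : R) z : E l z -> 0 < e ->
  nbhs z [set w | forall f, bounded_on l m f -> nrm (f w - f z) <= e].
Proof.
move=> Ez e0; have [c cA cz] := atlas_cover z.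
have [r r0 Hr] := chart_ball cz (EE Ez : nbhs z (E l.+1)).
pose m' := Num.max m 0; have m'0 : 0 <= m' by rewrite le_max lexx orbT.
pose B := 32 * m' / r + 1024 * m' / r ^+ 2.
have b0 : 0 <= 32 * m' / r by apply: divr_ge0 (mulr_ge0 (ler0n _ _) m'0) (ltW r0).
have b1 : 0 <= 1024 * m' / r ^+ 2 := divr_ge0 (mulr_ge0 (ler0n _ _) m'0) (exprn_ge0 2 (ltW r0)).
have B0 : 0 <= B := addr_ge0 b0 b1.
have B1 : 0 < B + 1 by rewrite ltr_wpDl.
pose d := Num.min (Num.min 1 (r / 8)) (e / (B + 1)).
have d0 : 0 < d by rewrite !lt_min ltr01 !divr_gt0.
apply: (@filterS _ _ (nbhs_filter z) _ _ _ (chart_nbhs cz d0)) => w [cw].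
rewrite !lt_min => /andP[/andP[v1 v2] v3] f [hf fm].
have Hf : hol (f \o chart_inv c) (c z) r.
  by move=> x /Hr[h1 h2 _]; rewrite -[X in differentiable _ X]h2; exact: hf.
have Hm y : nrm (y - c z) < r -> nrm ((f \o chart_inv c) y) <= m'.
  by move=> /Hr[_ _ h]; apply: le_trans (fm _ h) _; rewrite le_max lexx.
have [e1 /(_ (ltW v2))] := cauchyV r0 Hf Hm (c w - c z).
have -> : c z + (c w - c z) = c w by rewrite addrC subrK.
rewrite /= !chartK // => e2.
set v := nrm (c w - c z) in v1 v2 v3 e1 e2 *.
have v0 : 0 <= v := nrm_ge0 _.
rewrite -[f w - f z](subrK (dif (f \o chart_inv c) (c z) (c w - c z))).
apply: le_trans (nrmD _ _) _; apply: le_trans (lerD e2 e1) _.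
apply: le_trans (_ : B * v <= _).
  rewrite [leLHS]addrC [leRHS]mulrDl; apply: lerD => //; apply: (ler_wpM2l b1).
  by rewrite expr2 ler_piMl // ltW.
have : v * (B + 1) < e by rewrite -ltr_pdivlMr.
by rewrite mulrDr mulr1 mulrC; lra.
Qed.

Definition code (k : nat) (a : C) : int * int :=
  (Num.floor (re a * k.+1%:R), Num.floor (im a * k.+1%:R)).

Lemma code_close k (a b : C) : code k a = code k b -> nrm (a - b) <= 2 / k.+1%:R.
Proof.
have k0 : (0 : R) < k.+1%:R by rewrite ltr0n.
have cl (x y : R) : Num.floor (x * k.+1%:R) = Num.floor (y * k.+1%:R) -> `|x - y| <= k.+1%:R^-1.
  move=> h; have /andP[x1 x2] := floor_itv (x * k.+1%:R); have /andP[y1 y2] := floor_itv (y * k.+1%:R).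
  rewrite -h intrD in x1 x2 y1 y2; rewrite -div1r ler_pdivlMr //.
  rewrite -[k.+1%:R in leLHS]gtr0_norm // -normrM mulrBl ler_norml; apply/andP; split; lra.
move=> [/cl h1 /cl h2]; apply: le_trans (nrm_le_reim _) _; rewrite reB imB.
by apply: le_trans (lerD h1 h2) _; rewrite [2 / _]mulr_natl mulr2n.
Qed.

(* For every (l, m, k) the functions bounded by m on E (l+1) are determined on E l, up to O(1/k), by
   the integer parts of k f at a finite net, and one representative is chosen for every such code.
   Indexing by 2^a 3^J - 1 makes each representative recur infinitely often. *)
Lemma dense_sequence : exists g : nat -> M -> C, (forall j, holomorphic (g j)) /\
  forall f, holomorphic f -> forall K, compact K -> forall e : R, 0 < e -> forall J,
    exists2 j, (J <= j)%N & forall z, K z -> nrm (g j z - f z) < e.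
Proof.
have net (t : nat * nat * nat) : exists s : seq M, forall z, E t.1.1 z -> exists2 p, p \in s &
    forall f, bounded_on t.1.1 t.1.2%:R f -> nrm (f z - f p) <= t.2.+1%:R^-1.
  pose V (p w : M) := E t.1.1 p -> forall f, bounded_on t.1.1 t.1.2%:R f -> nrm (f w - f p) <= t.2.+1%:R^-1.
  have [z Ez|s Hs] := finite_net (V := fun p w => E t.1.1 p /\ V p w) (@cE t.1.1).
    have t0 : (0 : R) < t.2.+1%:R^-1 by rewrite invr_gt0 ltr0n.
    apply: (@filterS _ _ (nbhs_filter z) _ _ _ (equicontinuous t.1.2%:R Ez t0)) => w Hw.
    by split=> // _.
  by exists s => z /Hs[p ps [Ep /(_ Ep)]]; exists p.
have [p Hp] := choice net.
pose T := (nat * nat * nat * seq (int * int))%type.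
pose ok (t : T) f := bounded_on t.1.1.1 t.1.1.2%:R f /\ [seq code t.1.2 (f z) | z <- p t.1] = t.2.
have rep (t : T) : exists f, holomorphic f /\ ((exists f', ok t f') -> ok t f).
  have [[f ft]|h] := pselect (exists f', ok t f'); first by exists f; split=> //; exact: ft.1.1.
  by exists (fun=> 0); split; [exact: holo_cst|move=> /h].
have [q Hq] := choice rep.
pose g j := if unpickle (logn 2 j.+1) is Some t then q t else (fun=> 0).
exists g; split.
  by move=> j; rewrite /g; case: (unpickle _) => [t|]; [exact: (Hq t).1|exact: holo_cst].
move=> f hf K cK e e0 J.
have [l0 /(_ l0 (leqnn _)) Kl] := exhaustion_compact cK.
have [B B0 HB] := holo_bound hf (@cE l0.+1).
pose m := Num.bound B; have Bm : B < m%:R by exact: archi_boundP (ltW B0).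
pose k := Num.bound (4 / e).
have kk : 4 / e < k.+1%:R.
  have h4 : 0 <= 4 / e by rewrite divr_ge0 // ltW.
  by apply: lt_trans (archi_boundP h4) _; rewrite ltr_nat.
pose t : T := ((l0, m, k), [seq code k (f z) | z <- p (l0, m, k)]).
have okf : ok t f by split=> //; split=> // z /HB h; apply: le_trans h _; exact: ltW.
have [hq /(_ (ex_intro _ f okf))[bq cq]] := Hq t.
exists ((2 ^ pickle t * 3 ^ J).-1)%N.
  rewrite -ltnS prednK ?muln_gt0 ?expn_gt0 //.
  apply: leq_trans (ltn_expl J (isT : 1 < 3)%N) _.
  by rewrite leq_pmull // expn_gt0.
move=> z Kz; rewrite /g prednK ?muln_gt0 ?expn_gt0 //.
rewrite lognM ?expn_gt0 // !lognX (_ : logn 2 2 = 1)%N // (_ : logn 2 3 = 0)%N // muln0 addn0 muln1 pickleK.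
have [x xp Hx] := Hp (l0, m, k) z (Kl z Kz).
have /code_close c1 : code k (q t x) = code k (f x) by have /eq_in_map := cq; apply.
have a1 := Hx f okf.1; have a2 := Hx (q t) bq; rewrite /= in a1 a2 c1.
have -> : q t z - f z = (q t z - q t x) + (q t x - f x) - (f z - f x) by ring.
apply: le_lt_trans (nrmB _ _) _; apply: le_lt_trans (lerD (nrmD _ _) (lexx _)) _.
apply: le_lt_trans (lerD (lerD a2 c1) a1) _.
have k0 : (0 : R) < k.+1%:R by rewrite ltr0n.
have -> : k.+1%:R^-1 + 2 / k.+1%:R + k.+1%:R^-1 = 4 / k.+1%:R :> R by ring.
by rewrite ltr_pdivrMr // mulrC -ltr_pdivrMr.
Qed.

End Exhaustion.

(** * Sufficiency of the conditions *)

Section Sufficiency.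
Variables (R : realType) (N : nat) (M : complexManifold R N) (phi : M -> M).
Notation C := (Cplx R).
Hypotheses (hphi : holomorphic_map phi) (sM : stein M).
Implicit Types (z w : M) (f g : M -> C) (K : set M) (n : nat -> nat).

Lemma dense_iter m : dense_range phi -> dense_range (iter m phi).
Proof.
move=> dr; elim: m => [|m IH] f hf K cK e e0.
  by exists f => // z _; rewrite subrr nrm0.
have e2 : 0 < e / 2 by rewrite divr_gt0.
have [g1 hg1 H1] := dr f hf K cK _ e2.
have cK' : compact (phi @` K) by apply: compact_img cK => z _; exact: hphi.1.
have [g hg H] := IH g1 hg1 _ cK' _ e2.
exists g => // z Kz; rewrite iterSr; have := H1 z Kz.
have /H : (phi @` K) (phi z) by exists z.
by have := nrm_tri (g (iter m phi (phi z))) (g1 (phi z)) (f z); lra.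
Qed.

Lemma hull_convex K : compact K -> convex_compact (holomorphic_hull K) /\ K `<=` holomorphic_hull K.
Proof.
move=> cK; have sub (L : set M) : L `<=` holomorphic_hull L.
  by move=> z Lz f hf; apply: ereal_sup_ubound; exists z.
split; last exact: sub.
split; first exact: stein_hull.
apply/seteqP; split; first exact: sub.
move=> z hz f hf; apply: le_trans (hz f hf) _.
by apply: ge_ereal_sup => _ [w hw <-]; exact: hw.
Qed.

Lemma transitive n : dense_range phi ->
  (forall K : set M, convex_compact K -> exists l, separable K (iter (n l) phi @` K)) ->
  forall f g K (e : R), holomorphic f -> holomorphic g -> compact K -> 0 < e ->
  exists l, exists2 h, holomorphic h & forall z, K z ->
    nrm (h z - f z) < e /\ nrm (h (iter (n l) phi z) - g z) < e.
Proof.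
move=> dr sep f g K0 e hf hg cK0 e0.
have [[cK Kh] K0K] := hull_convex cK0; set K := holomorphic_hull K0 in cK Kh K0K.
have [l [F hF sF]] := sep K (conj cK Kh); exists l; set m := n l in sF *.
have cK' := @compact_iter R N M phi hphi m K cK.
have e2 : 0 < e / 2 by rewrite divr_gt0.
have [G hG HG] := dense_iter m dr hg cK e2.
have cKK : compact (K `|` iter m phi @` K) by exact: compactU.
have [B1 B10 H1] := holo_bound hF cKK.
have [B2 B20 H2] := holo_bound (holoB hG hf) cKK.
have XB x : (F @` K) x -> nrm x <= B1 by move=> [z Kz <-]; apply: H1; left.
have YB x : (F @` (iter m phi @` K)) x -> nrm x <= B1.
  by move=> [_ [z Kz <-] <-]; apply: H1; right; exists z.
have dis a : hullE (F @` K) a -> hullE (F @` (iter m phi @` K)) a -> False.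
  move=> /polynomial_hullP h1 /polynomial_hullP h2.
  by have : (set0 : set C) a by rewrite -sF.
have d0 : 0 < e / 4 / B2 by rewrite !divr_gt0.
have [v ev [v0 v1]] := separation XB YB dis d0.
exists (fun z => f z + v (F z) * (G z - f z)).
  by apply: (holoD hf); apply: holoM (holoB hG hf); exact: holo_entire.
have eB : e / 4 / B2 * B2 = e / 4 by rewrite divfK // gt_eqF.
move=> z /K0K Kz; split.
  rewrite [f z + _]addrC addrK nrmM.
  apply: le_lt_trans (_ : e / 4 / B2 * B2 < e); last by rewrite eB; lra.
  apply: ler_pM; rewrite ?nrm_ge0 //; first by apply: v0; exists z.
  by apply: H2; left.
set w := iter m phi z.
have wK : (iter m phi @` K) w by exists z.
have -> : f w + v (F w) * (G w - f w) - g z = (G w - g z) + (v (F w) - 1) * (G w - f w) by ring.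
apply: le_lt_trans (nrmD _ _) _; rewrite nrmM.
have h1 := HG z Kz; rewrite -/w in h1.
have h2 : nrm (v (F w) - 1) * nrm (G w - f w) <= e / 4.
  rewrite -eB; apply: ler_pM; rewrite ?nrm_ge0 //; first by apply: v1; exists w.
  by apply: H2; right.
lra.
Qed.

(* A state (f_j, D_j, l_j) is corrected by less than 2^-j on D_j and E_j so that the n(l_j)-th iterate
   is close to g_j on E_j; D_(j+1) also contains the image of E_j, which keeps this true in the limit. *)
Lemma universal_exists n :
  (forall f g K (e : R), holomorphic f -> holomorphic g -> compact K -> 0 < e ->
    exists l, exists2 h, holomorphic h & forall z, K z ->
      nrm (h z - f z) < e /\ nrm (h (iter (n l) phi z) - g z) < e) ->
  exists2 F : M -> C, holomorphic F & forall f, holomorphic f -> forall K, compact K ->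
    forall e : R, 0 < e -> exists l, forall z, K z -> nrm (F (iter (n l) phi z) - f z) < e.
Proof.
move=> tr; have [E [cE EE EU]] := stein_exhaustion sM.
have [g [hg gd]] := dense_sequence cE EE EU.
pose St := ((M -> C) * set M * nat)%type.
pose inv (s : St) := holomorphic s.1.1 /\ compact s.1.2.
pose step j (s s' : St) := [/\ inv s', s'.1.2 = (s.1.2 `|` E j) `|` iter (n s'.2) phi @` E j,
  forall z, (s.1.2 `|` E j) z -> nrm (s'.1.1 z - s.1.1 z) < (2 ^+ j)^-1 &
  forall z, E j z -> nrm (s'.1.1 (iter (n s'.2) phi z) - g j z) < (2 ^+ j)^-1].
have p2 j : (0 : R) < (2 ^+ j)^-1 by rewrite invr_gt0 exprn_gt0.
have ex (p : nat * St) : exists s', inv p.2 -> step p.1 p.2 s'.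
  case: p => j [[f D] l0] /=.
  have [[hf cD]|h] := pselect (inv (f, D, l0)); last by exists (f, D, l0).
  have cDE : compact (D `|` E j) by exact: compactU.
  have [l [h hh H]] := tr f (g j) _ _ hf (hg j) cDE (p2 j).
  exists (h, (D `|` E j) `|` iter (n l) phi @` E j, l) => _; split=> //=.
  - by split=> //=; apply: compactU => //; exact: compact_iter.
  - by move=> z /H[].
  - by move=> z Ez; have [] := H z (or_intror Ez).
have [nxt Hnxt] := choice ex.
pose s := fix s (j : nat) : St := if j is i.+1 then nxt (i, s i) else ((fun=> 0) : M -> C, set0, 0%N).
have invs j : inv (s j).
  elim: j => [|j IH]; first by split; [exact: holo_cst|exact: compact0].
  by have [] := Hnxt (j, s j) IH.
have sP j : step j (s j) (s j.+1) by exact: (Hnxt (j, s j) (invs j)).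
pose D j := (s j).1.2 `|` E j; pose f j := (s j).1.1; pose l j := (s j.+1).2.
have fP j z : D j z -> nrm (f j.+1 z - f j z) < (2 ^+ j)^-1 by have [_ _ h _] := sP j; exact: h.
have gP j z : E j z -> nrm (f j.+1 (iter (n (l j)) phi z) - g j z) < (2 ^+ j)^-1.
  by have [_ _ _ h] := sP j; exact: h.
have DD j z : D j z -> D j.+1 z by have [_ h _ _] := sP j; rewrite /D h => ?; left; left.
have Dit j z : E j z -> D j.+1 (iter (n (l j)) phi z).
  by have [_ h _ _] := sP j; rewrite /D h => ?; left; right; exists z.
have Dm i j z : (i <= j)%N -> D i z -> D j z.
  by move=> /subnKC <-; elim: (j - i)%N => [|k IH] Dz; rewrite ?addn0 // addnS; apply/DD/IH.
have ED j z : E j z -> D j z by right.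
have lim z : exists a, forall j, D j z -> nrm (f j z - a) <= 4 / 2 ^+ j.
  have exj : exists j, `[< D j z >].
    have : (\bigcup_l E l) z by rewrite EU.
    by move=> [j _ /ED Dz]; exists j; exact/asboolP.
  case: (ex_minnP exj) => i /asboolP Di mini.
  have [a Ha] : exists a, forall k, nrm (f (i + k)%N z - a) <= 4 * (2 ^+ i)^-1 / 2 ^+ k.
    apply: complete_cplx => k; rewrite addnS -invfM -exprD.
    by apply/ltW/fP; apply: Dm Di; exact: leq_addr.
  exists a => j /asboolP/mini ij; have := Ha (j - i)%N.
  by rewrite subnKC // -mulrA -invfM -exprD subnKC.
have [F HF] := choice lim.
have small (B e : R) : 0 < e -> exists J, forall j, (J <= j)%N -> B / 2 ^+ j < e.
  move=> e0; have [J HJ] := small_pow `|B| e0; exists J => j Jj; apply: le_lt_trans HJ.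
  apply: le_trans (_ : `|B| / 2 ^+ j <= _); first by rewrite ler_wpM2r ?ler_norm // ltW.
  by rewrite ler_wpM2l // lef_pV2 ?posrE ?exprn_gt0 // ler_eXn2l // ltr1n.
have hF : holomorphic F.
  apply: holo_limit => K cK e e0; have [l0 Hl0] := exhaustion_compact EE EU cK.
  have [J HJ] := small 4 e e0.
  exists (f (maxn l0 J)); first exact: (invs _).1.
  move=> z Kz; apply: le_trans (ltW (HJ _ (leq_maxr l0 J))).
  by apply/HF/ED/Hl0 => //; exact: leq_maxl.
exists F => // h hh K cK e e0.
have [l0 Hl0] := exhaustion_compact EE EU cK.
have e2 : 0 < e / 2 by rewrite divr_gt0.
have [J HJ] := small 3 _ e2.
have [j Jj gj] := gd h hh K cK _ e2 (maxn l0 J).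
have [l0j Jj'] : (l0 <= j)%N /\ (J <= j)%N by move: Jj; rewrite geq_max => /andP[].
exists (l j) => z Kz; have Ez := Hl0 j l0j z Kz.
set w := iter _ _ z; have b1 := gP j z Ez; have b2 := HF w _ (Dit j z Ez); have b3 := gj z Kz.
have b4 := HJ j Jj'; rewrite -/w in b1.
have b5 : 4 / 2 ^+ j.+1 = 2 * (2 ^+ j)^-1 :> R by rewrite exprS invfM; field; rewrite expf_neq0.
rewrite b5 in b2; rewrite nrmC in b2.
have -> : F w - h z = (F w - f j.+1 w) + (f j.+1 w - g j z) + (g j z - h z) by ring.
apply: le_lt_trans (nrmD _ _) _; apply: le_lt_trans (lerD (nrmD _ _) (lexx _)) _.
by move: b1 b2 b3 b4; move: ((2 ^+ j)^-1) => q; lra.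
Qed.

Lemma sufficiency n : injective phi -> runge_domain (range phi) ->
  (forall K : set M, convex_compact K -> exists l, separable K (iter (n l) phi @` K)) ->
  universal (fun l => iter (n l) (composition_operator hphi)).
Proof.
move=> inj rg sep; apply/(universalP hphi n).2/universal_exists/transitive => //.
exact: runge_dense.
Qed.

End Sufficiency.

Theorem theorem3p5 (R : realType) (N : nat) (Omega : complexManifold R N)
    (hStein : stein Omega) (hconn : connected [set: Omega])
    (phi : Omega -> Omega) (hphi : holomorphic_map phi)
    (n : nat -> nat) (hn : increasing n) :
  (hypercyclic (composition_operator hphi) n <->
     [/\ injective phi,
         runge_domain (range phi) &
         forall K : set Omega, convex_compact K ->
           exists l, separable K (iter (n l) phi @` K)])
  /\
  (hereditarily_hypercyclic (composition_operator hphi) n <->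
     [/\ injective phi,
         runge_domain (range phi) &
         forall K : set Omega, convex_compact K ->
           exists l0, forall l, (l0 <= l)%N ->
             separable K (iter (n l) phi @` K)]).
Proof.
split; split.
- exact: necessity.
- by move=> [inj rg sep]; exact: sufficiency.
- move=> H; have inc k : increasing k -> increasing (fun l => n (k l)).
    by move=> hk i j /hk/hn.
  have [|inj rg _] := @necessity R N Omega phi hphi n hStein hconn hn.
    by apply: (H id).
  split=> // K cK; apply: contrapT => bad.
  have ex m : exists l, (m <= l)%N /\ ~ separable K (iter (n l) phi @` K).
    apply: contrapT => h; apply: bad; exists m => l ml; apply: contrapT => nl.
    by apply: h; exists l.
  have [nx Hnx] := choice ex.
  pose k := fix k (i : nat) := if i is j.+1 then nx (k j).+1 else nx 0%N.
  have kS i : (k i < k i.+1)%N by exact: (Hnx (k i).+1).1.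
  have kinc : increasing k by apply: (homo_ltn (r := fun a b => (a < b)%N)) => [a b c|]; [exact: ltn_trans|exact: kS].
  have [_ _ /(_ K cK)[l]] := necessity hStein hconn (inc k kinc) (H k kinc).
  by case: l => [|l]; apply: (Hnx _).2.
move=> [inj rg sep] k hk; apply: (@sufficiency R N Omega phi hphi hStein (fun l => n (k l))) => //.
move=> K cK; have [l0 Hl0] := sep K cK; exists l0; apply: Hl0.
by elim: l0 => // l IH; exact: leq_ltn_trans IH (hk l l.+1 (ltnSn l)).
Qed.
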